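(* Let $I\subset\mathbb R$ be an interval, $\alpha_0\in I$, and let $A,B:I\to\mathbb R$ with $B(\alpha)\neq0$ for all $\alpha\in I$. For $\alpha\in I$ let $G_\alpha$ be the bounded operator on $L^2(\mathbb R)$ obtained by density from $G_\alpha f(u)=\int_{\mathbb R}\hat f(\xi)e^{i[A(\alpha)\xi^2+B(\alpha)u\xi]}\,d\xi$ ($f$ Schwartz). Then $\lim_{\alpha\to\alpha_0}\|G_\alpha f-G_{\alpha_0}f\|_{L^2(\mathbb R)}=0$ for every $f\in L^2(\mathbb R)$ if and only if $A$ and $B$ are continuous at $\alpha_0$.
   Context: The Fourier transform is normalized as $\hat f(\xi)=\frac1{\sqrt{2\pi}}\int_{\mathbb R}e^{-i\xi t}f(t)\,dt$. *)

(* Defs.v *)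
From HB Require Import structures.
From mathcomp Require Import all_boot all_order all_algebra.
From mathcomp Require Import all_classical all_reals all_analysis.
From mathcomp Require Import complex.
Set Implicit Arguments. Unset Strict Implicit. Unset Printing Implicit Defensive.
Import Order.TTheory GRing.Theory Num.Theory.
Import numFieldNormedType.Exports.
Local Open Scope classical_set_scope.
Local Open Scope ring_scope.
Local Open Scope complex_scope.

Section Defs.
Variable R : realType.
Local Notation C := (R[i]).
Local Notation mu := (@lebesgue_measure R).

Definition cexpi (x : R) : C := Complex (cos x) (sin x).

Definition cintegral (h : R -> C) : C :=
  Complex (Rintegral mu setT (fun x => complex.Re (h x)))
          (Rintegral mu setT (fun x => complex.Im (h x))).

Definition schwartzR (g : R -> R) : Prop :=
  (forall (n : nat) (x : R), derivable (derive1n n g) x 1) /\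
  (forall k n : nat, exists M : R, forall x : R, `|x ^+ k * derive1n n g x| <= M).

Definition schwartz (f : R -> C) : Prop :=
  schwartzR (fun x => complex.Re (f x)) /\ schwartzR (fun x => complex.Im (f x)).

Definition fourier (f : R -> C) (xi : R) : C :=
  ((Num.sqrt (2 * pi))^-1)%:C * cintegral (fun t => cexpi (- (xi * t)) * f t).

(** G_alpha on Schwartz functions:
    G f(u) = \int \hat f(xi) e^{i [A xi^2 + B u xi]} dxi, with a = A(alpha), b = B(alpha). *)
Definition Gop (a b : R) (f : R -> C) (u : R) : C :=
  cintegral (fun xi => fourier f xi * cexpi (a * xi ^+ 2 + b * u * xi)).

Definition cnorm2 (z : C) : R := complex.Re z ^+ 2 + complex.Im z ^+ 2.

(** f belongs to L^2(R) (a representative: Borel measurable, square integrable). *)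
Definition L2 (f : R -> C) : Prop :=
  measurable_fun setT (fun x => complex.Re (f x)) /\
  measurable_fun setT (fun x => complex.Im (f x)) /\
  (\int[mu]_x (cnorm2 (f x))%:E < +oo)%E.

Definition L2dist (f g : R -> C) : R :=
  Num.sqrt (Rintegral mu setT (fun x => cnorm2 (f x - g x))).

(** [isG a b f g]: g (an L^2 function) represents G f, where G is the
    extension by density of [Gop a b] from Schwartz functions to L^2:
    for every sequence of Schwartz functions f_n -> f in L^2,
    Gop a b f_n -> g in L^2. *)
Definition isG (a b : R) (f g : R -> C) : Prop :=
  L2 g /\
  forall fn : nat -> R -> C,
    (forall n, schwartz (fn n)) ->
    (L2dist (fn n) f @[n --> \oo] --> 0) ->
    (L2dist (Gop a b (fn n)) g @[n --> \oo] --> 0).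

End Defs.

(* Main.v *)
(** Write [G f (u) = h^ (B u)], where [h = e^{i A x^2} f^].

    A Plancherel inequality with an explicit constant makes all the [G] with [B]
    bounded away from [0] uniformly bounded on [L2]. It is obtained separately for
    the cosine and sine transforms: the transform is squared against the weight
    [e^{-e u}], Fubini turns this into a quadratic form whose kernel is a combination
    of two Poisson kernels, Schur's test bounds it by [pi], uniformly in [e], and [e]
    goes to [0]. If [A] and [B] are continuous, [G f] is therefore continuous in [L2]
    once it is so for Schwartz [f], and for those it follows from
    [|e^{i A x^2} - e^{i A' x^2}| <= |A - A'| x^2] and from the [L2]-continuity of
    dilations. Both steps use the density of Schwartz functions, obtained by
    approximating indicators of intervals by [exp (- y^{2n})], [y] affine.

    Conversely, take [g t = e^{- k t^2}]. Integration by parts gives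
    [B u G g (u) = (1 - 4 i k A) G (t g) (u)], so the [L2]-limits of [G g] and
    [G (t g)] force [(1 - 4 i k A) / B] to converge, hence [1 / B] and [A / B]. *)

Require Import Defs.
From HB Require Import structures.
From mathcomp Require Import all_boot all_order all_algebra.
From mathcomp Require Import all_classical all_reals all_analysis.
From mathcomp Require Import complex.
From mathcomp Require Import measurable_realfun ring lra.
Import Order.TTheory GRing.Theory Num.Theory.
Import numFieldNormedType.Exports.
Local Open Scope classical_set_scope.
Local Open Scope ring_scope.

Set Implicit Arguments.
Unset Strict Implicit.
Unset Printing Implicit Defensive.

(** In the statement the family [Gf] is any choice of representatives. Sufficiency takes it as given
    and carries the bound on Schwartz functions over to it along an approximating sequence;
    necessity has to exhibit one, and for Schwartz [f] the function [Gop a b f] itself serves. The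
    weight [e^{-e u}] is there because a product of two cosines or two sines is not integrable in
    [u]: damping turns its integral into Laplace transforms of cosines, Poisson kernels of mass [pi]
    for every [e]. Losing a constant factor is harmless, since only boundedness uniform in [b] near
    [b0] matters. In the converse, [u X = kap Y] with [X = G g], [Y = G (t g)] and
    [kap = (1 - 4 i k A) / B]. L2 convergence does not survive multiplication by [u], and [kap] can
    be recovered only where the limit of [Y] is nonzero. Both are settled on a short interval
    [[d/2, d]] inside [[0, 1]]: [u] is bounded there, and [Y] is bounded below because [X] is
    nonzero at 0. To this end [k] is small in terms of [A a0], so that the oscillation of
    [e^{i A xi^2}] cannot cancel the Gaussian integral. *)

Section LineIntegrals.
Context {R : realType}.
Local Notation mu := (@lebesgue_measure R).
Implicit Types (f F : R -> R).

(** * Integration on the line: exhaustion, primitives, decay, Fubini *)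

Lemma ge0_integralZ (c : R) (g : R -> R) : 0 <= c -> measurable_fun setT g ->
  (forall x, 0 <= g x) ->
  (\int[mu]_x (c * g x)%:E = c%:E * \int[mu]_x (g x)%:E)%E.
Proof.
move=> c0 mg g0; under eq_integral do rewrite EFinM.
apply: ge0_integralZl => //; try exact/measurable_EFinP.
by move=> x _; rewrite lee_fin.
Qed.

Lemma ge0_integral_add (f g : R -> R) : measurable_fun setT f ->
  measurable_fun setT g -> (forall x, 0 <= f x) -> (forall x, 0 <= g x) ->
  (\int[mu]_x (f x + g x)%:E = \int[mu]_x (f x)%:E + \int[mu]_x (g x)%:E)%E.
Proof.
move=> mf mg f0 g0; under eq_integral do rewrite EFinD.
rewrite ge0_integralD//; first by move=> x _; rewrite lee_fin.
- exact/measurable_EFinP.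
- by move=> x _; rewrite lee_fin.
- exact/measurable_EFinP.
Qed.

Lemma ge0_integral_le (f g : R -> R) : measurable_fun setT f ->
  measurable_fun setT g -> (forall x, 0 <= f x) -> (forall x, f x <= g x) ->
  (\int[mu]_x (f x)%:E <= \int[mu]_x (g x)%:E)%E.
Proof.
move=> mf mg f0 fg; apply: ge0_le_integral => //.
- by move=> x _; rewrite lee_fin.
- exact/measurable_EFinP.
- exact/measurable_EFinP.
- by move=> x _; rewrite lee_fin.
Qed.

Lemma EFin_Rintegral (f : R -> R) : mu.-integrable setT (EFin \o f) ->
  ((Rintegral mu setT f)%:E = \int[mu]_x (f x)%:E)%E.
Proof.
by move=> fi; rewrite /Rintegral fineK//; exact: (integrable_fin_num measurableT fi).
Qed.

Lemma normr_Rintegral_le (f : R -> R) : mu.-integrable setT (EFin \o f) ->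
  (`|Rintegral mu setT f|%:E <= \int[mu]_x (`|f x|)%:E)%E.
Proof.
move=> fi; rewrite -EFin_Rintegral; first by rewrite lee_fin le_normr_Rintegral.
exact: (integrable_norm fi).
Qed.

Lemma is_derive_continuous (f g : R -> R) :
  (forall x : R, is_derive x 1 f (g x)) -> continuous f.
Proof.
move=> df x; apply: differentiable_continuous; apply/derivable1_diffP.
by case: (df x).
Qed.

(** Dominated convergence for the restrictions of [f] to [F n], with [|f|] as the bound; at each
    point of [D] they are eventually equal to [f]. *)
Lemma cvg_integral_exhaust (D : set R) (F : nat -> set R) f :
  measurable D -> (forall n, measurable (F n)) -> (forall n, F n `<=` D) ->
  (forall x, D x -> \forall n \near \oo, F n x) ->
  mu.-integrable D (EFin \o f) ->
  (\int[mu]_(x in F n) (f x)%:E @[n --> \oo] --> \int[mu]_(x in D) (f x)%:E)%E.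
Proof.
move=> mD mF FD nF fi.
have -> : (fun n => \int[mu]_(x in F n) (f x)%:E)%E =
    (fun n => \int[mu]_(x in D) ((EFin \o f) \_ (F n)) x)%E.
  apply/funext => n; rewrite integral_mkcond [RHS]integral_mkcond.
  apply: eq_integral => x _; rewrite /patch.
  have [xF|//] := boolP (x \in F n).
    by rewrite (mem_set (FD n _ _))//; exact/set_mem.
  by case: ifP.
apply: (@dominated_cvg _ _ _ mu D mD _ _ (fun x => `|f x|%:E)).
- move=> n; apply: (@measurable_funS _ _ _ _ setT) => //.
  have /(measurable_restrictT (EFin \o f) (mF n)) : measurable_fun (F n) (EFin \o f).
    by apply: (measurable_funS mD (FD n)); exact: (measurable_int mu).
  exact.
- move=> x Dx; apply: cvg_near_cst.
  near=> n; rewrite /patch mem_set//.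
  by near: n; exact: nF.
- by [].
- have := integrable_abse fi; apply: eq_integrable => // x _.
- move=> n x Dx; rewrite /patch; case: ifP => _ //=.
  by rewrite normr0 lee_fin.
Unshelve. all: by end_near. Qed.

Lemma near_symm_itv (x : R) : \forall n \near \oo, `[- n%:R, n%:R]%classic x.
Proof.
near=> n; rewrite /= in_itv/= -ler_norml.
by near: n; exact: nbhs_infty_ger.
Unshelve. all: by end_near. Qed.

Lemma integral_derive_itv f F (a b : R) : a < b ->
  (forall x : R, is_derive x 1 F (f x)) -> continuous f ->
  (\int[mu]_(x in `[a, b]) (f x)%:E = (F b - F a)%:E)%E.
Proof.
move=> ab dF cf.
have cF := is_derive_continuous dF.
rewrite (@continuous_FTC2 _ f F a b ab).
- by rewrite EFinB.
- exact: continuous_subspaceT.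
- split.
  + by move=> x _; case: (dF x).
  + by apply: cvg_at_right_filter; exact: cF.
  + by apply: cvg_at_left_filter; exact: cF.
- by move=> x _; rewrite derive1E; case: (dF x).
Qed.

Lemma decay_cvg0 F (M : R) : (forall x, `|x * F x| <= M) ->
  F n%:R @[n --> \oo] --> 0 /\ F (- n%:R) @[n --> \oo] --> 0.
Proof.
move=> FM.
have h (g : nat -> R) : (forall n, `|n%:R * g n| <= M) -> g n @[n --> \oo] --> 0.
  move=> gM; apply/cvgrPdist_le => e e0.
  near=> n; rewrite sub0r normrN.
  have n0 : 0 < n%:R :> R by rewrite ltr0n; near: n; exact: nbhs_infty_gt.
  rewrite -(ler_pM2l n0).
  have := gM n; rewrite normrM ger0_norm; last exact: ltW.
  move=> /le_trans; apply.
  rewrite -ler_pdivrMr//.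
  by near: n; exact: nbhs_infty_ger.
split; apply: h => n; first exact: FM.
by have := FM (- n%:R); rewrite mulNr normrN.
Unshelve. all: by end_near. Qed.

(** The integral over [[-n, n]] is [F n - F (- n)], and both values are at most [M / n] in absolute
    value. Applied to products [F], this is the integration by parts of all later sections. *)
Lemma integral_derive_decay f F (M : R) :
  (forall x : R, is_derive x 1 F (f x)) -> continuous f ->
  mu.-integrable setT (EFin \o f) -> (forall x, `|x * F x| <= M) ->
  Rintegral mu setT f = 0.
Proof.
move=> dF cf fi /decay_cvg0[F1 F2].
have h := @cvg_integral_exhaust setT (fun n => `[- n%:R, n%:R]%classic) f
  measurableT (fun=> measurable_itv _) (fun=> @subsetT _ _)
  (fun x _ => near_symm_itv x) fi.
rewrite /Rintegral.
suff -> : (\int[mu]_x (f x)%:E = 0)%E by [].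
apply: (cvg_unique (@ereal_hausdorff R) h) => /=.
apply: (@cvg_trans _ ((F n%:R - F (- n%:R))%:E @[n --> \oo])).
  apply: near_eq_cvg; near=> n.
  rewrite (integral_derive_itv _ dF)//.
  have n0 : 0 < n%:R :> R by rewrite ltr0n; near: n; exact: nbhs_infty_gt.
  lra.
apply: cvg_EFin; first exact: nearW.
rewrite -[X in _ --> X](subr0 0).
exact: cvgB.
Unshelve. all: by end_near. Qed.

Lemma integral_derive_decay0y f F (M : R) :
  (forall x : R, is_derive x 1 F (f x)) -> continuous f ->
  mu.-integrable `[0, +oo[ (EFin \o f) -> (forall x, 0 <= x -> `|x * F x| <= M) ->
  Rintegral mu `[0, +oo[ f = - F 0.
Proof.
move=> dF cf fi FM.
(* [decay_cvg0] asks for a bound on both sides of 0, while [FM] gives one only for [0 <= x];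
   composing with the absolute value fills in the other side. *)
have [F1 _] : F n%:R @[n --> \oo] --> 0 /\ (F \o Num.norm) (- n%:R) @[n --> \oo] --> 0.
  have [|H1 H2] := @decay_cvg0 (F \o Num.norm) M.
    by move=> x /=; rewrite normrM -[X in X * _]normr_id -normrM FM.
  split => //; apply: cvg_trans H1; apply: near_eq_cvg.
  by apply: nearW => n /=; rewrite ger0_norm.
have h := @cvg_integral_exhaust `[0, +oo[%classic (fun n => `[0, n%:R]%classic) f
  (measurable_itv _) (fun=> measurable_itv _).
have {}h := h _ _ fi.
rewrite /Rintegral.
suff -> : (\int[mu]_(x in `[0%R, +oo[) (f x)%:E = (- F 0)%:E)%E by [].
apply: (cvg_unique (@ereal_hausdorff R) (h _ _)) => /=.
- by move=> n x /=; rewrite !in_itv/= => /andP[->].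
- move=> x /=; rewrite in_itv/= andbT => x0.
  near=> n; rewrite in_itv/= x0/=.
  by near: n; exact: nbhs_infty_ger.
apply: (@cvg_trans _ ((F n%:R - F 0)%:E @[n --> \oo])).
  apply: near_eq_cvg; near=> n.
  rewrite (integral_derive_itv _ dF)//.
  by rewrite ltr0n; near: n; exact: nbhs_infty_gt.
apply: cvg_EFin; first exact: nearW.
rewrite -[X in _ --> X]sub0r.
by apply: cvgB => //; exact: cvg_cst.
Unshelve. all: by end_near. Qed.

(** By monotone convergence over [[-n, n]], so that integrability of [f] comes out as a
    conclusion. *)
Lemma ge0_integral_derive_le f F (M : R) :
  (forall x : R, is_derive x 1 F (f x)) -> continuous f -> (forall x, 0 <= f x) ->
  (forall x, `|F x| <= M) ->
  (\int[mu]_x (f x)%:E <= (2 * M)%:E)%E.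
Proof.
move=> dF cf f0 FM.
have h := @ge0_nondecreasing_set_cvg_integral _ (measurableTypeR R) R
  (fun n => `[- n%:R, n%:R]%classic) (EFin \o f) mu.
have U : \bigcup_i `[- (i%:R : R), i%:R]%classic = setT.
  apply/seteqP; split => // x _.
  by have [n _ /(_ n (leqnn n)) Hn] := near_symm_itv x; exists n.
rewrite -U; apply: (cvge_le _ (h _ _ _ _)); last first.
- by move=> n x _; rewrite lee_fin.
- move=> n; apply/measurable_EFinP; apply: measurable_funTS.
  exact: continuous_measurable_fun.
- by move=> n; exact: measurable_itv.
- move=> m n mn; apply/subsetPset => x /=; rewrite !in_itv/= => /andP[h1 h2].
  have mnR : m%:R <= n%:R :> R by rewrite ler_nat.
  apply/andP; split; lra.
near=> n.
rewrite /= (integral_derive_itv _ dF)//.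
  rewrite lee_fin.
  have := FM n%:R; have := FM (- n%:R); rewrite !ler_norml => /andP[? ?] /andP[? ?].
  lra.
have n0 : 0 < n%:R :> R by rewrite ltr0n; near: n; exact: nbhs_infty_gt.
lra.
Unshelve. all: by end_near. Qed.

(** The primitive [atan ((x + c) / e)] stays below [pi / 2] in absolute value. The bound does not
    depend on [e], which is what makes Schur's test uniform. *)
Lemma integral_poisson_le (e c : R) : 0 < e ->
  (\int[mu]_x (e / (e ^+ 2 + (x + c) ^+ 2))%:E <= pi%:E)%E.
Proof.
move=> e0.
have pos x : 0 < e ^+ 2 + (x + c) ^+ 2.
  by rewrite ltr_pwDl ?sqr_ge0// exprn_gt0.
have -> : pi = 2 * (pi / 2) :> R by field.
apply: (@ge0_integral_derive_le _ (fun x => atan ((x + c) / e))).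
- move=> x; apply: is_derive_eq.
  rewrite /GRing.scale/=; field.
  by rewrite !gt_eqF//= ?pos//.
- move=> x; apply: cvgM; first exact: cvg_cst.
  apply: cvgV; first by rewrite gt_eqF.
  apply: cvgD; first exact: cvg_cst.
  apply: (@continuous_comp _ _ _ (fun x => x + c) (fun x => x ^+ 2)).
    by apply: cvgD; [exact: cvg_id|exact: cvg_cst].
  exact: exprn_continuous.
- by move=> x; rewrite divr_ge0// ltW.
- move=> x; rewrite ler_norml; have := atan_gtNpi2 ((x + c) / e).
  by have := atan_ltpi2 ((x + c) / e); lra.
Qed.

(** Comparison with [M / (1 + x^2)], a multiple of the Poisson kernel with [e = 1] and [c = 0]. *)
Lemma integrable_decay (f : R -> R) (M : R) : measurable_fun setT f ->
  (forall x, (1 + x ^+ 2) * `|f x| <= M) -> mu.-integrable setT (EFin \o f).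
Proof.
move=> mf fM; apply/integrableP; split; first exact/measurable_EFinP.
have pos x : 0 < 1 + x ^+ 2 :> R by rewrite ltr_pwDl ?sqr_ge0.
have mV : measurable_fun setT (fun x : R => 1 / (1 + x ^+ 2)).
  apply: continuous_measurable_fun => x; apply: cvgM; first exact: cvg_cst.
  apply: cvgV; first by rewrite gt_eqF.
  by apply: cvgD; [exact: cvg_cst|exact: exprn_continuous].
apply: (@le_lt_trans _ _ (\int[mu]_x (M%:E * (1 / (1 + x ^+ 2))%:E))%E).
  apply: ge0_le_integral => //.
  - by apply: measurableT_comp => //; exact/measurable_EFinP.
  - by apply/measurable_EFinP; apply: measurable_funM.
  - move=> x _ /=; rewrite lee_fin mulrA mulr1 ler_pdivlMr// mulrC.
    exact: fM.
have M0 : 0 <= M by apply: le_trans (fM 0); rewrite mulr_ge0// ltW.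
rewrite ge0_integralZl//; last 2 first.
- exact/measurable_EFinP.
- by move=> x _; rewrite lee_fin divr_ge0// ltW.
apply: (@le_lt_trans _ _ (M%:E * pi%:E)%E); last by rewrite -EFinM ltry.
apply: lee_wpmul2l; rewrite ?lee_fin//.
apply: le_trans (@integral_poisson_le 1 0 ltr01).
rewrite le_eqVlt; apply/orP; left; apply/eqP.
by apply: eq_integral => x _; rewrite expr1n addr0.
Qed.

Lemma integrable_bounded_mul (f g : R -> R) (M : R) :
  mu.-integrable setT (EFin \o f) -> measurable_fun setT g ->
  (forall x, `|g x| <= M) -> mu.-integrable setT (EFin \o (fun x => f x * g x)).
Proof.
move=> fi mg gM.
have mf : measurable_fun setT f by apply/measurable_EFinP; exact: measurable_int fi.
have := integrableZl measurableT M fi; apply: le_integrable => //.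
  by apply/measurable_EFinP; exact: measurable_funM.
move=> x _ /=; rewrite lee_fin !normrM mulrC ler_wpM2r//.
by apply: le_trans (gM x) _; exact: ler_norm.
Qed.

(** Fubini, the integrand being dominated by [|q x| |r y|], whose double integral is a product of
    two finite integrals. The kernel [m] will be the cosine or the sine of [x y]. *)
Lemma Rintegral_swap (q r : R -> R) (m : R -> R -> R) :
  mu.-integrable setT (EFin \o q) -> mu.-integrable setT (EFin \o r) ->
  measurable_fun setT (fun z : R * R => m z.1 z.2) ->
  (forall x y, `|m x y| <= 1) ->
  Rintegral mu setT (fun x => q x * Rintegral mu setT (fun y => r y * m x y)) =
  Rintegral mu setT (fun y => r y * Rintegral mu setT (fun x => q x * m x y)).
Proof.
move=> iq ir mm m1.
have mq : measurable_fun setT q by apply/measurable_EFinP; exact: measurable_int iq.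
have mr : measurable_fun setT r by apply/measurable_EFinP; exact: measurable_int ir.
have mmx x : measurable_fun setT (m x).
  exact: (measurableT_comp mm (@pair1_measurable _ _ R R x)).
have mmy y : measurable_fun setT (m ^~ y).
  exact: (measurableT_comp mm (@pair2_measurable _ _ R R y)).
pose f (z : R * R) := (q z.1 * (r z.2 * m z.1 z.2))%:E.
have mf : measurable_fun setT f.
  apply/measurable_EFinP; apply: measurable_funM.
    by apply: measurableT_comp => //; exact: measurable_fst.
  apply: measurable_funM => //.
  by apply: measurableT_comp => //; exact: measurable_snd.
have irm x : mu.-integrable setT (EFin \o (fun y => r y * m x y)).
  exact: (integrable_bounded_mul ir (mmx x) (m1 x)).
have iqm y : mu.-integrable setT (EFin \o (fun x => q x * m x y)).
  exact: (integrable_bounded_mul iq (mmy y) (m1 ^~ y)).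
have intf : (mu \x mu)%E.-integrable setT f.
  apply/integrable12ltyP => //.
  apply: (@le_lt_trans _ _ (\int[mu]_x (`|(q x)%:E| * \int[mu]_y `|(r y)%:E|))%E).
    apply: ge0_le_integral => //.
    - by move=> x _; apply: integral_ge0.
    - apply: (@measurable_fun_fubini_tonelli_F _ _ (measurableTypeR R)
        (measurableTypeR R) R mu (abse \o f)) => //=.
      exact: measurableT_comp.
    - apply: emeasurable_funM => //; apply: measurableT_comp => //.
      exact/measurable_EFinP.
    - move=> x _; rewrite -ge0_integralZl//; last first.
        by apply: measurableT_comp => //; exact/measurable_EFinP.
      apply: ge0_le_integral => //.
      + apply: measurableT_comp => //; apply/measurable_EFinP.
        have : measurable_fun setT (fun y => q x * (r y * m x y)).
          by apply: measurable_funM => //; exact: measurable_funM.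
        exact.
      + apply: emeasurable_funM => //; apply: measurableT_comp => //.
        exact/measurable_EFinP.
      + move=> y _; rewrite /f/= lee_fin !normrM ler_wpM2l// ler_piMr//.
  rewrite ge0_integralZr//; last 2 first.
    by apply: measurableT_comp => //; exact/measurable_EFinP.
    exact: integral_ge0.
  have /integrableP[_ h1] := iq; have /integrableP[_ h2] := ir.
  by apply: lte_mul_pinfty => //; rewrite ?integral_ge0// ge0_fin_numE ?integral_ge0.
have := Fubini intf.
move=> H; rewrite /Rintegral; apply: (congr1 fine).
transitivity (\int[mu]_x \int[mu]_y f (x, y))%E.
  apply: eq_integral => x _.
  rewrite /f/= EFinM fineK; last exact: (integrable_fin_num measurableT (irm x)).
  by rewrite -(integralZl measurableT (irm x)).
rewrite H; apply: eq_integral => y _.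
rewrite EFinM fineK; last exact: (integrable_fin_num measurableT (iqm y)).
rewrite -(integralZl measurableT (iqm y)).
by apply: eq_integral => x _; rewrite /f/= -EFinM mulrCA.
Qed.

(** * Laplace transforms of cosines *)

Lemma continuous_cosM (x : R) : continuous (fun u : R => cos (u * x)).
Proof.
apply: (@is_derive_continuous _ (fun u => - x * sin (u * x))) => u.
by apply: is_derive_eq; rewrite /GRing.scale/=; ring.
Qed.

(** The weight lives on the whole line, vanishing for [u < 0], so that all integrals are over [setT]
    and [Rintegral_swap] applies. *)
Definition hexp (e u : R) : R := expR (- (e * u)) * \1_`[0, +oo[ u.

Lemma hexp_ge0 (e u : R) : 0 <= hexp e u.
Proof. by rewrite mulr_ge0 ?expR_ge0// indicE ler0n. Qed.

Lemma measurable_hexp (e : R) : measurable_fun setT (hexp e).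
Proof.
apply: measurable_funM; last exact: measurable_indic.
by apply: measurableT_comp => //; apply: measurableT_comp => //.
Qed.

(** From [expR t >= 1 + t^2 / 2] at [t = e u]; the constant makes [(1 + 2 / e^2) (1 + (e u)^2 / 2)]
    expand to [1 + u^2] plus nonnegative terms. *)
Lemma hexp_decay (e u : R) : 0 < e ->
  (1 + u ^+ 2) * `|hexp e u| <= 1 + 2 / e ^+ 2.
Proof.
move=> e0; rewrite ger0_norm ?hexp_ge0// /hexp indicE.
have Me : 0 <= 2 / e ^+ 2 by rewrite divr_ge0// exprn_ge0 ?ltW.
have [/set_mem/=|_] := boolP (u \in _); last by rewrite !mulr0 addr_ge0.
rewrite in_itv/= andbT => u0; rewrite mulr1 expRN ler_pdivrMr ?expR_gt0//.
have h : 1 + (e * u) ^+ 2 / 2 <= expR (e * u).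
  by have := @expR_ge1Dxn R (e * u) 1; apply; rewrite mulr_ge0// ltW.
apply: le_trans (ler_wpM2l _ h); last by rewrite addr_ge0.
have -> : (1 + 2 / e ^+ 2) * (1 + (e * u) ^+ 2 / 2) =
    1 + u ^+ 2 + (2 / e ^+ 2 + (e * u) ^+ 2 / 2).
  by field; rewrite gt_eqF.
by rewrite lerDl addr_ge0// divr_ge0// exprn_ge0// mulr_ge0// ltW.
Qed.

Lemma integrable_hexp (e : R) : 0 < e -> mu.-integrable setT (EFin \o hexp e).
Proof.
move=> e0; apply: (@integrable_decay _ (1 + 2 / e ^+ 2)).
  exact: measurable_hexp.
by move=> x; exact: hexp_decay.
Qed.

Lemma Rintegral_hexp_cos (e x : R) : 0 < e ->
  Rintegral mu setT (fun u => hexp e u * cos (u * x)) = e / (e ^+ 2 + x ^+ 2).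
Proof.
move=> e0.
have pos : 0 < e ^+ 2 + x ^+ 2 by rewrite ltr_pwDl ?sqr_ge0// exprn_gt0.
pose f u := expR (- (e * u)) * cos (u * x).
(* The real part of [e^{(- e + i x) u} / (- e + i x)], a primitive of [f] with value
   [- e / (e^2 + x^2)] at 0. *)
pose F u := expR (- (e * u)) * (x * sin (u * x) - e * cos (u * x)) / (e ^+ 2 + x ^+ 2).
have icos : mu.-integrable setT (EFin \o (fun u => hexp e u * cos (u * x))).
  apply: (@integrable_bounded_mul _ _ 1 (integrable_hexp e0)).
    by apply: continuous_measurable_fun; exact: continuous_cosM.
  by move=> u; rewrite ler_norml cos_geN1 cos_le1.
have fE u : hexp e u * cos (u * x) = (f \_ `[0, +oo[) u.
  rewrite /hexp indicE /f patchE; case: ifP => _; first by rewrite mulr1.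
  by rewrite mulr0 mul0r.
have -> : (fun u => hexp e u * cos (u * x)) = f \_ `[0, +oo[.
  by apply/funext.
rewrite -Rintegral_mkcond.
have df (u : R) : is_derive u 1 f
    (expR (- (e * u)) * (- e * cos (u * x) - x * sin (u * x))).
  by apply: is_derive_eq; rewrite /GRing.scale/=; ring.
have dF (u : R) : is_derive u 1 F (f u).
  apply: is_derive_eq; rewrite /GRing.scale/= /f; field; exact: lt0r_neq0.
(* [hexp_decay] bounds [u expR (- e u)], since [u <= 1 + u^2]; the second factor of [M] bounds the
   trigonometric part of [F]. *)
rewrite (integral_derive_decay0y (M := (1 + 2 / e ^+ 2) * ((`|x| + e) / (e ^+ 2 + x ^+ 2))) dF).
- rewrite /F mulr0 oppr0 expR0 mul0r sin0 cos0; field; exact: lt0r_neq0.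
- exact: (is_derive_continuous df).
- apply/integrable_mkcond => //; move: icos; apply: eq_integrable => // u _.
  by rewrite /= fE restrict_EFin.
- move=> u u0.
  have -> : u * F u = (u * expR (- (e * u))) *
      ((x * sin (u * x) - e * cos (u * x)) / (e ^+ 2 + x ^+ 2)) by rewrite /F; ring.
  rewrite normrM; apply: ler_pM => //.
    have := hexp_decay u e0; rewrite /hexp indicE mem_set/=; last by rewrite in_itv/= u0.
    rewrite mulr1; apply: le_trans; rewrite normrM ler_wpM2r// (ger0_norm u0).
    by nra.
  rewrite normrM (gtr0_norm (x := _^-1)) ?invr_gt0// ler_wpM2r ?invr_ge0 ?(ltW pos)//.
  apply: le_trans (ler_normB _ _) _; rewrite !normrM (gtr0_norm e0).
  apply: lerD; first by rewrite ler_piMr// ler_norml sin_geN1 sin_le1.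
  by rewrite ler_piMr ?(ltW e0)// ler_norml cos_geN1 cos_le1.
Qed.

(** * Cosine and sine transforms: Schur's test and the L2 bound *)

Definition kft (k p : R -> R) (v : R) : R :=
  Rintegral mu setT (fun x => p x * k (v * x)).

(** [pi] times the Poisson kernel of the upper half-plane at height [e], hence of total mass
    [pi]. *)
Definition poisson (e x : R) : R := e / (e ^+ 2 + x ^+ 2).

Lemma integrable_kft (k p : R -> R) (v : R) : continuous k ->
  (forall x, `|k x| <= 1) -> mu.-integrable setT (EFin \o p) ->
  mu.-integrable setT (EFin \o (fun x => p x * k (v * x))).
Proof.
move=> ck k1 ip; apply: (integrable_bounded_mul (M := 1) ip) => //.
apply: continuous_measurable_fun => x.
apply: (@continuous_comp _ _ _ (fun x => v * x) k); last exact: ck.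
by apply: cvgM; [exact: cvg_cst|exact: cvg_id].
Qed.

Lemma continuous_kft (k p : R -> R) : continuous k -> (forall x, `|k x| <= 1) ->
  mu.-integrable setT (EFin \o p) -> continuous (kft k p).
Proof.
move=> ck k1 ip v.
have ckx (x : R) : continuous (fun w : R => k (w * x)).
  move=> w; apply: (@continuous_comp R R R (fun w : R => w * x) k); last exact: ck.
  by apply: cvgM; [exact: cvg_id|exact: cvg_cst].
apply: (@continuity_under_integral _ _ _ mu (fun v x => p x * k (v * x)) setT
  measurableT (v - 1) (v + 1) _ _ (fun x => `|p x|)).
- by move=> w _; exact: integrable_kft.
- by apply: aeW => x _ w _; apply: cvgM; [exact: cvg_cst|exact: ckx].
- exact: integrable_norm.
- by move=> w _; apply: aeW => x _; rewrite normrM ler_piMr.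
- by rewrite inE/= in_itv/=; apply/andP; split; lra.
Qed.

Lemma kft_bounded (k p : R -> R) : continuous k -> (forall x, `|k x| <= 1) ->
  mu.-integrable setT (EFin \o p) ->
  forall v, `|kft k p v| <= Rintegral mu setT (fun x => `|p x|).
Proof.
move=> ck k1 ip v.
apply: le_trans (le_normr_Rintegral measurableT (integrable_kft v ck k1 ip)) _.
apply: le_Rintegral => //.
- exact/integrable_norm/integrable_kft.
- exact: integrable_norm.
- by move=> x _; rewrite normrM ler_piMr.
Qed.

Lemma integral_poisson2_le (e x : R) : 0 < e ->
  (\int[mu]_y ((poisson e (x - y) + poisson e (x + y)) / 2)%:E <= pi%:E)%E.
Proof.
move=> e0.
have mP c : measurable_fun setT (fun y : R => e / (e ^+ 2 + (y + c) ^+ 2)).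
  have pos y : 0 < e ^+ 2 + (y + c) ^+ 2.
    by rewrite ltr_pwDl ?sqr_ge0// exprn_gt0.
  apply: continuous_measurable_fun => y; apply: cvgM; first exact: cvg_cst.
  apply: cvgV; first by rewrite gt_eqF.
  apply: cvgD; first exact: cvg_cst.
  apply: (@continuous_comp _ _ _ (fun x => x + c) (fun x => x ^+ 2)).
    by apply: cvgD; [exact: cvg_id|exact: cvg_cst].
  exact: exprn_continuous.
have P0 c y : 0 <= e / (e ^+ 2 + (y + c) ^+ 2).
  by rewrite divr_ge0 ?(ltW e0)// addr_ge0// sqr_ge0.
have -> : (\int[mu]_y ((poisson e (x - y) + poisson e (x + y)) / 2)%:E =
   \int[mu]_y (2^-1 * (e / (e ^+ 2 + (y + - x) ^+ 2) +
                e / (e ^+ 2 + (y + x) ^+ 2)))%:E)%E.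
  apply: eq_integral => y _; rewrite mulrC /poisson.
  by rewrite -(sqrrN (x - y)) opprB (addrC x y).
rewrite ge0_integralZ//; last 2 first.
- exact: measurable_funD.
- by move=> y; rewrite addr_ge0.
rewrite ge0_integral_add//.
apply: (@le_trans _ _ ((2^-1)%:E * (pi%:E + pi%:E))%E).
  apply: lee_wpmul2l; first by rewrite lee_fin invr_ge0.
  by apply: leeD; exact: integral_poisson_le.
by rewrite -EFinD -EFinM lee_fin; lra.
Qed.

(* Schur's test: the double integral of [p x * p y * K x y] is bounded with
   [|p x| |p y| <= (p x ^+ 2 + p y ^+ 2) / 2] and the total mass of [K x]. *)
Lemma kft_weighted_le (k p : R -> R) (e : R) : 0 < e -> continuous k ->
  (forall x, `|k x| <= 1) ->
  (forall x y, `|Rintegral mu setT (fun u => hexp e u * k (u * x) * k (u * y))| <=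
     (poisson e (x - y) + poisson e (x + y)) / 2) ->
  mu.-integrable setT (EFin \o p) ->
  (\int[mu]_u (hexp e u * kft k p u ^+ 2)%:E <=
   pi%:E * \int[mu]_x (p x ^+ 2)%:E)%E.
Proof.
move=> e0 ck k1 kk ip.
have mp : measurable_fun setT p by apply/measurable_EFinP; exact: measurable_int ip.
pose c := kft k p; pose L := Rintegral mu setT (fun x => `|p x|).
have cc : continuous c by exact: continuous_kft.
have mc : measurable_fun setT c by exact: continuous_measurable_fun.
have cL v : `|c v| <= L by exact: kft_bounded.
have ihc : mu.-integrable setT (EFin \o (fun u => hexp e u * c u)).
  exact: (integrable_bounded_mul (integrable_hexp e0) mc cL).
have mkM : measurable_fun setT (fun z : R * R => k (z.1 * z.2)).
  apply: measurableT_comp; first exact: continuous_measurable_fun.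
  by apply: measurable_funM; [exact: measurable_fst|exact: measurable_snd].
have ihk x : mu.-integrable setT (EFin \o (fun u => hexp e u * k (u * x))).
  have := integrable_kft x ck k1 (integrable_hexp e0).
  by apply: eq_integrable => // u _ /=; rewrite (mulrC x).
(* [d] is [p] transformed by the kernel [int hexp e u k (u x) k (u y) du]: one exchange of integrals
   ([dE]) shows this, another ([AE]) turns the weighted integral of [c ^+ 2] into the quadratic form
   [int p d]. *)
pose d := kft k (fun u => hexp e u * c u).
have cd : continuous d by exact: continuous_kft.
have md : measurable_fun setT d by exact: continuous_measurable_fun.
have ipd : mu.-integrable setT (EFin \o (fun x => p x * d x)).
  by apply: (integrable_bounded_mul ip md (kft_bounded ck k1 ihc)).
pose K x y : R := (poisson e (x - y) + poisson e (x + y)) / 2.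
have K0 x y : 0 <= K x y.
  by rewrite divr_ge0// addr_ge0// divr_ge0 ?(ltW e0)// addr_ge0 ?sqr_ge0.
have dE x : d x = Rintegral mu setT
    (fun y => p y * Rintegral mu setT (fun u => hexp e u * k (u * x) * k (u * y))).
  rewrite -(Rintegral_swap (m := fun u y => k (u * y)) (ihk x) ip mkM) //.
  apply: eq_Rintegral => u _.
  by rewrite [in LHS](mulrC x u) mulrAC.
have AE : Rintegral mu setT (fun u => hexp e u * c u ^+ 2) =
    Rintegral mu setT (fun x => p x * d x).
  transitivity (Rintegral mu setT (fun u => (hexp e u * c u) *
      Rintegral mu setT (fun x => p x * k (u * x)))).
    by apply: eq_Rintegral => u _; rewrite expr2 mulrA.
  transitivity (Rintegral mu setT (fun x => p x *
      Rintegral mu setT (fun u => (hexp e u * c u) * k (u * x)))).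
    exact: (Rintegral_swap (m := fun u x => k (u * x)) ihc ip mkM).
  apply: eq_Rintegral => x _; congr (_ * _).
  by apply: eq_Rintegral => u _; rewrite (mulrC u).
have ihc2 : mu.-integrable setT (EFin \o (fun u => hexp e u * c u ^+ 2)).
  have := integrable_bounded_mul ihc mc cL.
  by apply: eq_integrable => // u _ /=; rewrite expr2 mulrA.
have -> : (\int[mu]_u (hexp e u * kft k p u ^+ 2)%:E =
    (Rintegral mu setT (fun x => p x * d x))%:E)%E.
  by rewrite -AE /Rintegral fineK//; exact: (integrable_fin_num measurableT ihc2).
have mK : measurable_fun setT (fun z : R * R => K z.1 z.2).
  have cP : continuous (poisson e).
    move=> y; apply: cvgM; first exact: cvg_cst.
    apply: cvgV; first by rewrite gt_eqF// ltr_pwDl ?sqr_ge0// exprn_gt0.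
    by apply: cvgD; [exact: cvg_cst|exact: exprn_continuous].
  have mP : measurable_fun setT (poisson e) by exact: continuous_measurable_fun.
  apply: measurable_funM => //; apply: measurable_funD.
    apply: measurableT_comp => //.
    by apply: measurable_funB; [exact: measurable_fst|exact: measurable_snd].
  apply: measurableT_comp => //.
  by apply: measurable_funD; [exact: measurable_fst|exact: measurable_snd].
have mKx x : measurable_fun setT (K x).
  exact: (measurableT_comp mK (@pair1_measurable _ _ R R x)).
have mKy y : measurable_fun setT (K ^~ y).
  exact: (measurableT_comp mK (@pair2_measurable _ _ R R y)).
have Ksym x y : K x y = K y x.
  by rewrite /K /poisson -(sqrrN (x - y)) opprB (addrC x y).
(* The two halves of [(p x ^+ 2 + p y ^+ 2) / 2], each against [K]. For [f1] the inner integral in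
   [y] is a mass of [K]; for [f2] the order of integration is exchanged first, and [Ksym] brings the
   same mass back. *)
pose f1 (z : R * R) := (2^-1 * p z.1 ^+ 2 * K z.1 z.2)%:E.
pose f2 (z : R * R) := (2^-1 * p z.2 ^+ 2 * K z.1 z.2)%:E.
have f10 z : (0 <= f1 z)%E by rewrite lee_fin mulr_ge0// mulr_ge0// sqr_ge0.
have f20 z : (0 <= f2 z)%E by rewrite lee_fin mulr_ge0// mulr_ge0// sqr_ge0.
have mf1 : measurable_fun setT f1.
  apply/measurable_EFinP; apply: measurable_funM => //; apply: measurable_funM => //.
  apply: measurable_funX.
  by apply: measurableT_comp => //; exact: measurable_fst.
have mf2 : measurable_fun setT f2.
  apply/measurable_EFinP; apply: measurable_funM => //; apply: measurable_funM => //.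
  apply: measurable_funX.
  by apply: measurableT_comp => //; exact: measurable_snd.
have mf1x x : measurable_fun setT (fun y : R => f1 (x, y)).
  exact: (measurableT_comp mf1 (@pair1_measurable _ _ R R x)).
have mf2x x : measurable_fun setT (fun y : R => f2 (x, y)).
  exact: (measurableT_comp mf2 (@pair1_measurable _ _ R R x)).
have mF1 := @measurable_fun_fubini_tonelli_F _ _ (measurableTypeR R)
  (measurableTypeR R) R mu f1 mf1 f10.
have mF2 := @measurable_fun_fubini_tonelli_F _ _ (measurableTypeR R)
  (measurableTypeR R) R mu f2 mf2 f20.
have mp2 : measurable_fun setT (fun x => p x ^+ 2) by exact: measurable_funX.
have half x : (\int[mu]_y (2^-1 * p x ^+ 2 * K x y)%:E <= (2^-1 * pi * p x ^+ 2)%:E)%E.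
  rewrite ge0_integralZ//; last by rewrite mulr_ge0// sqr_ge0.
  apply: (@le_trans _ _ ((2^-1 * p x ^+ 2)%:E * pi%:E)%E).
    apply: lee_wpmul2l; first by rewrite lee_fin mulr_ge0 ?sqr_ge0.
    exact: integral_poisson2_le.
  by rewrite -EFinM lee_fin; lra.
apply: (@le_trans _ _ (\int[mu]_x `|(p x * d x)%:E|)%E).
  apply: (le_trans _ (normr_Rintegral_le ipd)).
  by rewrite lee_fin ler_norm.
apply: (@le_trans _ _ (\int[mu]_x (\int[mu]_y f1 (x, y) + \int[mu]_y f2 (x, y)))%E).
  apply: ge0_le_integral => //.
  - apply: measurableT_comp => //; apply/measurable_EFinP.
    exact: measurable_funM.
  - exact: emeasurable_funD.
  move=> x _; rewrite -ge0_integralD//; [|exact: mf1x|exact: mf2x].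
  rewrite dE /= normrM.
  have ikk : mu.-integrable setT (EFin \o (fun y => p y *
      Rintegral mu setT (fun u => hexp e u * k (u * x) * k (u * y)))).
    have ck2 := continuous_kft ck k1 (ihk x).
    have bk2 := kft_bounded ck k1 (ihk x).
    have := integrable_bounded_mul ip (continuous_measurable_fun ck2) bk2.
    apply: eq_integrable => // y _ /=; congr (_ * _)%:E.
    by apply: eq_Rintegral => u _; rewrite (mulrC y).
  rewrite EFinM.
  apply: le_trans (lee_wpmul2l _ (normr_Rintegral_le ikk)) _ => //.
  have mkk := measurable_int _ (integrable_norm ikk).
  rewrite -ge0_integralZl//.
  apply: ge0_le_integral => //.
  - exact: measurable_funeM.
  - exact: (emeasurable_funD (mf1x x) (mf2x x)).
  move=> y _; rewrite /f1 /f2 -EFinM -EFinD lee_fin /= normrM.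
  have := kk x y; rewrite -/(K x y) => kxy.
  apply: (@le_trans _ _ (`|p x| * (`|p y| * K x y))).
    by apply: ler_wpM2l => //; apply: ler_wpM2l.
  rewrite -[p x ^+ 2]real_normK ?num_real// -[p y ^+ 2]real_normK ?num_real//.
  have : 0 <= 2^-1 * (`|p x| - `|p y|) ^+ 2 * K x y.
    by rewrite mulr_ge0// mulr_ge0// sqr_ge0.
  lra.
rewrite ge0_integralD//; last 2 first.
  by move=> x _; exact: integral_ge0.
  by move=> x _; exact: integral_ge0.
rewrite [X in (_ + X)%E](_ : _ = \int[mu]_y \int[mu]_x f2 (x, y))%E; last first.
  exact: (@fubini_tonelli _ _ (measurableTypeR R) (measurableTypeR R) R mu mu
    f2 mf2 f20).
apply: (@le_trans _ _ (\int[mu]_x ((2^-1 * pi * p x ^+ 2)%:E) +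
    \int[mu]_x ((2^-1 * pi * p x ^+ 2)%:E))%E).
  apply: leeD; apply: ge0_le_integral => //.
  - by move=> x _; exact: integral_ge0.
  - apply/measurable_EFinP; exact: measurable_funM.
  - by move=> x _; exact: half.
  - by move=> y _; exact: integral_ge0.
  - exact: (@measurable_fun_fubini_tonelli_G _ _ (measurableTypeR R)
      (measurableTypeR R) R mu f2 mf2 f20).
  - apply/measurable_EFinP; exact: measurable_funM.
  - move=> y _; rewrite /f2/=; under eq_integral do rewrite Ksym.
    exact: half.
have pi0 : 0 <= pi :> R := pi_ge0 R.
rewrite (@ge0_integralZ (2^-1 * pi) (fun x => p x ^+ 2)) ?mulr_ge0//; last first.
  by move=> x; rewrite sqr_ge0.
rewrite -ge0_muleDl ?lee_fin ?mulr_ge0// -EFinD.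
by rewrite (_ : 2^-1 * pi + 2^-1 * pi = pi)//; lra.
Qed.

Lemma hexp_cos_cos_le (e x y : R) : 0 < e ->
  `|Rintegral mu setT (fun u => hexp e u * cos (u * x) * cos (u * y))| <=
  (poisson e (x - y) + poisson e (x + y)) / 2.
Proof.
move=> e0.
have ic z : mu.-integrable setT (EFin \o (fun u => hexp e u * cos (u * z))).
  apply: (integrable_bounded_mul (M := 1) (integrable_hexp e0)).
    by apply: continuous_measurable_fun; exact: continuous_cosM.
  by move=> u; rewrite ler_norml cos_geN1 cos_le1.
have P0 z : 0 <= poisson e z.
  by rewrite divr_ge0 ?(ltW e0)// addr_ge0 ?sqr_ge0.
rewrite (_ : Rintegral _ _ _ = (poisson e (x - y) + poisson e (x + y)) / 2).
  by rewrite ger0_norm// divr_ge0// addr_ge0.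
rewrite /poisson -!Rintegral_hexp_cos// -RintegralD// -RintegralZr//.
  apply: eq_Rintegral => u _ /=.
  by rewrite mulrBr mulrDr cosB cosD; field.
exact: (integrableD measurableT (ic _) (ic _)).
Qed.

(** A product of sines is half a difference of cosines, so the integral is half the difference of
    two Poisson kernels. Bounding it by half their sum gives both transforms the same majorant. *)
Lemma hexp_sin_sin_le (e x y : R) : 0 < e ->
  `|Rintegral mu setT (fun u => hexp e u * sin (u * x) * sin (u * y))| <=
  (poisson e (x - y) + poisson e (x + y)) / 2.
Proof.
move=> e0.
have ic z : mu.-integrable setT (EFin \o (fun u => hexp e u * cos (u * z))).
  apply: (integrable_bounded_mul (M := 1) (integrable_hexp e0)).
    by apply: continuous_measurable_fun; exact: continuous_cosM.
  by move=> u; rewrite ler_norml cos_geN1 cos_le1.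
have P0 z : 0 <= poisson e z.
  by rewrite divr_ge0 ?(ltW e0)// addr_ge0 ?sqr_ge0.
rewrite (_ : Rintegral _ _ _ = (poisson e (x - y) - poisson e (x + y)) / 2).
  have := P0 (x - y); have := P0 (x + y).
  by rewrite ler_norml; move=> *; apply/andP; split; lra.
rewrite /poisson -!Rintegral_hexp_cos// -RintegralB// -RintegralZr//.
  apply: eq_Rintegral => u _ /=.
  by rewrite mulrBr mulrDr cosB cosD; field.
exact: (integrableB measurableT (ic _) (ic _)).
Qed.

(** The parity sign [s] makes [kft k p u ^+ 2] even. In the constant, 2 comes from reducing to the
    half-line, [expR 1] from removing the weight with [e = n^-1] on [[0, n]], and [pi] from Schur's
    test; monotone convergence in [n] concludes. *)
Lemma kft_L2_le (k p : R -> R) (s : R) : continuous k ->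
  (forall x, `|k x| <= 1) -> (forall x, k (- x) = s * k x) -> s ^+ 2 = 1 ->
  (forall e x y, 0 < e ->
     `|Rintegral mu setT (fun u => hexp e u * k (u * x) * k (u * y))| <=
     (poisson e (x - y) + poisson e (x + y)) / 2) ->
  mu.-integrable setT (EFin \o p) ->
  (\int[mu]_u (kft k p u ^+ 2)%:E <=
   (2 * expR 1 * pi)%:E * \int[mu]_x (p x ^+ 2)%:E)%E.
Proof.
move=> ck k1 ks s1 kk ip.
have cc := continuous_kft ck k1 ip.
have mc : measurable_fun setT (kft k p) by exact: continuous_measurable_fun.
have mc2 : measurable_fun setT (fun u => kft k p u ^+ 2) by exact: measurable_funX.
have even u : kft k p u ^+ 2 = kft k p (- u) ^+ 2.
  have -> : kft k p (- u) = s * kft k p u.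
    rewrite /kft -RintegralZl//; last exact: integrable_kft.
    by apply: eq_Rintegral => x _; rewrite mulNr ks mulrCA.
  by rewrite exprMn s1 mul1r.
rewrite ge0_symfun_integralT; last 3 first.
- by move=> u; exact: sqr_ge0.
- move=> u; apply: (@continuous_comp R R R (kft k p) (fun x => x ^+ 2)); first exact: cc.
  exact: exprn_continuous.
- by move=> u; rewrite /= even.
rewrite -mulrA [(2 * _)%:E]EFinM -muleA.
apply: lee_wpmul2l; first by rewrite lee_fin.
have UE : [set x : R | 0 <= x] = \bigcup_(n : nat) `[0, n%:R]%classic.
  apply/seteqP; split => x /=; last by move=> [n _] /=; rewrite in_itv/= => /andP[].
  move=> x0; exists (Num.truncn x).+1 => //=; rewrite in_itv/= x0/=.
  by apply: ltW; rewrite truncnS_gt.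
rewrite UE; apply: cvge_le (ge0_nondecreasing_set_cvg_integral _ _ _ _); last first.
- by move=> n x _; rewrite lee_fin sqr_ge0.
- by move=> n; apply/measurable_EFinP; exact: measurable_funTS.
- by move=> n; exact: measurable_itv.
- move=> m n mn; apply/subsetPset => x /=; rewrite !in_itv/= => /andP[-> h2] /=.
  by apply: le_trans h2 _; rewrite ler_nat.
near=> n.
have n0 : 0 < n%:R :> R by rewrite ltr0n; near: n; exact: nbhs_infty_gt.
have e0 : 0 < n%:R^-1 :> R by rewrite invr_gt0.
(* The weight [expR (- u / n)] is at least [expR (- 1)] on [0, n]. *)
apply: (@le_trans _ _ (\int[mu]_u (expR 1 * (hexp n%:R^-1 u * kft k p u ^+ 2))%:E)%E).
  rewrite integral_mkcond; apply: ge0_le_integral => //.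
  - by move=> u _; apply: erestrict_ge0 => v _; rewrite lee_fin sqr_ge0.
  - apply/(measurable_restrictT (EFin \o (fun u => kft k p u ^+ 2))) => //.
    by apply/measurable_EFinP; exact: measurable_funTS.
  - apply/measurable_EFinP; apply: measurable_funM => //.
    apply: measurable_funM => //; exact: measurable_hexp.
  move=> u _; rewrite patchE; case: ifP; last first.
    by rewrite lee_fin => _; rewrite mulr_ge0 ?expR_ge0// mulr_ge0 ?hexp_ge0 ?sqr_ge0.
  rewrite inE /= in_itv/= => /andP[u0 un].
  rewrite lee_fin /hexp indicE mem_set/= ?in_itv/= ?u0// mulr1 mulrA -expRD.
  rewrite ler_peMl ?sqr_ge0//.
  rewrite -[X in X <= _]expR0 ler_expR subr_ge0 mulrC ler_pdivrMr ?mul1r//.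
rewrite ge0_integralZ ?expR_ge0//; last 2 first.
- apply: measurable_funM => //; exact: measurable_hexp.
- by move=> u; rewrite mulr_ge0 ?hexp_ge0 ?sqr_ge0.
rewrite EFinM -muleA; apply: lee_wpmul2l; first by rewrite lee_fin expR_ge0.
by apply: kft_weighted_le => // x y; exact: kk.
Unshelve. all: by end_near. Qed.

Lemma kft_cos_L2_le (p : R -> R) : mu.-integrable setT (EFin \o p) ->
  (\int[mu]_u (kft cos p u ^+ 2)%:E <=
   (2 * expR 1 * pi)%:E * \int[mu]_x (p x ^+ 2)%:E)%E.
Proof.
move=> ip; apply: (@kft_L2_le _ _ 1) => //.
- exact: continuous_cos.
- by move=> x; rewrite ler_norml cos_geN1 cos_le1.
- by move=> x; rewrite cosN mul1r.
- by rewrite expr1n.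
- by move=> e x y; exact: hexp_cos_cos_le.
Qed.

Lemma kft_sin_L2_le (p : R -> R) : mu.-integrable setT (EFin \o p) ->
  (\int[mu]_u (kft sin p u ^+ 2)%:E <=
   (2 * expR 1 * pi)%:E * \int[mu]_x (p x ^+ 2)%:E)%E.
Proof.
move=> ip; apply: (@kft_L2_le _ _ (- 1)) => //.
- exact: continuous_sin.
- by move=> x; rewrite ler_norml sin_geN1 sin_le1.
- by move=> x; rewrite sinN mulN1r.
- by rewrite sqrrN expr1n.
- by move=> e x y; exact: hexp_sin_sin_le.
Qed.

End LineIntegrals.

(** * Complex-valued functions, square norms and the transform [cft] *)

Section ComplexL2.
Context {R : realType}.
Local Notation mu := (@lebesgue_measure R).
Local Notation Re := complex.Re.
Local Notation Im := complex.Im.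
Implicit Types (f g h : R -> R[i]).

(** Valued in the extended reals, so that estimates chain before finiteness is known; [L2dist] is
    the square root of its [fine] part. *)
Definition sqnorm f : \bar R := (\int[mu]_x (cnorm2 (f x))%:E)%E.

Definition cmeasurable f :=
  measurable_fun setT (fun x => Re (f x)) /\ measurable_fun setT (fun x => Im (f x)).

Definition cintegrable f :=
  mu.-integrable setT (EFin \o (fun x => Re (f x))) /\
  mu.-integrable setT (EFin \o (fun x => Im (f x))).

Definition ccontinuous f :=
  continuous (fun x => Re (f x)) /\ continuous (fun x => Im (f x)).

(** Without normalization and with the sign of the exponent in [G]; [fourier] is a multiple of its
    reflection. *)
Definition cft h (v : R) : R[i] := cintegral (fun x => h x * cexpi (v * x)).

Lemma cReD (x y : R[i]) : Re (x + y) = Re x + Re y.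
Proof. by case: x; case: y. Qed.

Lemma cImD (x y : R[i]) : Im (x + y) = Im x + Im y.
Proof. by case: x; case: y. Qed.

Lemma cReB (x y : R[i]) : Re (x - y) = Re x - Re y.
Proof. by case: x; case: y. Qed.

Lemma cImB (x y : R[i]) : Im (x - y) = Im x - Im y.
Proof. by case: x; case: y. Qed.

Lemma cReM (x y : R[i]) : Re (x * y) = Re x * Re y - Im x * Im y.
Proof. by case: x; case: y. Qed.

Lemma cImM (x y : R[i]) : Im (x * y) = Re x * Im y + Im x * Re y.
Proof. by case: x; case: y. Qed.

Lemma complexP (x y : R[i]) : Re x = Re y -> Im x = Im y -> x = y.
Proof. by case: x => a b; case: y => c d /= -> ->. Qed.

Lemma cnorm2_ge0 (z : R[i]) : 0 <= cnorm2 z.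
Proof. by rewrite addr_ge0 ?sqr_ge0. Qed.

Lemma cnorm2M (x y : R[i]) : cnorm2 (x * y) = cnorm2 x * cnorm2 y.
Proof. by rewrite /cnorm2 cReM cImM; ring. Qed.

Lemma cnorm2_cexpi (t : R) : cnorm2 (cexpi t) = 1.
Proof. by rewrite /cnorm2/= cos2Dsin2. Qed.

Lemma cnorm2D_le (x y : R[i]) : cnorm2 (x + y) <= 2 * cnorm2 x + 2 * cnorm2 y.
Proof.
rewrite -subr_ge0 (_ : _ - _ = (Re x - Re y) ^+ 2 + (Im x - Im y) ^+ 2).
  by rewrite addr_ge0 ?sqr_ge0.
by rewrite /cnorm2 cReD cImD; ring.
Qed.

Lemma cnorm2B (x y : R[i]) : cnorm2 (x - y) = cnorm2 (y - x).
Proof. by rewrite /cnorm2 !cReB !cImB; ring. Qed.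

Lemma ccontinuous_cmeasurable f : ccontinuous f -> cmeasurable f.
Proof. by move=> [c1 c2]; split; exact: continuous_measurable_fun. Qed.

Lemma cintegrable_cmeasurable f : cintegrable f -> cmeasurable f.
Proof.
by move=> [i1 i2]; split; apply/measurable_EFinP; [exact: measurable_int i1|
  exact: measurable_int i2].
Qed.

Lemma cmeasurableB f g : cmeasurable f -> cmeasurable g ->
  cmeasurable (fun x => f x - g x).
Proof.
move=> [f1 f2] [g1 g2]; split.
  by under eq_fun do rewrite cReB; exact: measurable_funB.
by under eq_fun do rewrite cImB; exact: measurable_funB.
Qed.

Lemma cmeasurableM f g : cmeasurable f -> cmeasurable g ->
  cmeasurable (fun x => f x * g x).
Proof.
move=> [f1 f2] [g1 g2]; split.
  under eq_fun do rewrite cReM.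
  by apply: measurable_funB; exact: measurable_funM.
under eq_fun do rewrite cImM.
by apply: measurable_funD; exact: measurable_funM.
Qed.

Lemma cintegrableB f g : cintegrable f -> cintegrable g ->
  cintegrable (fun x => f x - g x).
Proof.
move=> [f1 f2] [g1 g2]; split.
  have := integrableB measurableT f1 g1.
  by apply: eq_integrable => // x _ /=; rewrite cReB EFinB.
have := integrableB measurableT f2 g2.
by apply: eq_integrable => // x _ /=; rewrite cImB EFinB.
Qed.

Lemma cintegrable_cexpi f (t : R -> R) : measurable_fun setT t ->
  cintegrable f -> cintegrable (fun x => f x * cexpi (t x)).
Proof.
move=> mt [f1 f2].
have mcos : measurable_fun setT (fun x => cos (t x)).
  apply: measurableT_comp => //; apply: continuous_measurable_fun.
  exact: continuous_cos.
have msin : measurable_fun setT (fun x => sin (t x)).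
  apply: measurableT_comp => //; apply: continuous_measurable_fun.
  exact: continuous_sin.
have cos1 x : `|cos (t x)| <= 1 by rewrite ler_norml cos_geN1 cos_le1.
have sin1 x : `|sin (t x)| <= 1 by rewrite ler_norml sin_geN1 sin_le1.
split.
  have := integrableB measurableT (integrable_bounded_mul f1 mcos cos1)
    (integrable_bounded_mul f2 msin sin1).
  by apply: eq_integrable => // x _ /=; rewrite cReM EFinB.
have := integrableD measurableT (integrable_bounded_mul f1 msin sin1)
  (integrable_bounded_mul f2 mcos cos1).
by apply: eq_integrable => // x _ /=; rewrite cImM EFinD.
Qed.

Lemma cintegralB f g : cintegrable f -> cintegrable g ->
  cintegral (fun x => f x - g x) = cintegral f - cintegral g.
Proof.
move=> [f1 f2] [g1 g2]; apply: complexP; rewrite ?cReB ?cImB /=.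
  by rewrite -RintegralB//; apply: eq_Rintegral => x _; rewrite cReB.
by rewrite -RintegralB//; apply: eq_Rintegral => x _; rewrite cImB.
Qed.

Lemma measurable_cnorm2 f : cmeasurable f ->
  measurable_fun setT (fun x => cnorm2 (f x)).
Proof. by move=> [f1 f2]; apply: measurable_funD; exact: measurable_funX. Qed.

Lemma sqnorm_ge0 f : (0 <= sqnorm f)%E.
Proof. by apply: integral_ge0 => x _; rewrite lee_fin cnorm2_ge0. Qed.

Lemma eq_sqnorm f g : f =1 g -> sqnorm f = sqnorm g.
Proof. by move=> fg; apply: eq_integral => x _; rewrite fg. Qed.

Lemma sqnormE f : cmeasurable f -> sqnorm f =
  (\int[mu]_x (Re (f x) ^+ 2)%:E + \int[mu]_x (Im (f x) ^+ 2)%:E)%E.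
Proof.
move=> [f1 f2]; rewrite -ge0_integral_add// => [||x|x]; rewrite ?sqr_ge0//.
  exact: measurable_funX.
exact: measurable_funX.
Qed.

Lemma sqnorm_sym f g : sqnorm (fun x => f x - g x) = sqnorm (fun x => g x - f x).
Proof. by apply: eq_integral => x _; rewrite cnorm2B. Qed.

(** The triangle inequality in squared form, from [|x + y|^2 <= 2 |x|^2 + 2 |y|^2]. The
    approximation arguments below count their errors with these factors 2. *)
Lemma sqnorm_trans g f h : cmeasurable f -> cmeasurable g -> cmeasurable h ->
  (sqnorm (fun x => f x - h x)%R <=
   2%:E * sqnorm (fun x => f x - g x)%R + 2%:E * sqnorm (fun x => g x - h x)%R)%E.
Proof.
move=> mf mg mh.
have m1 := measurable_cnorm2 (cmeasurableB mf mg).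
have m2 := measurable_cnorm2 (cmeasurableB mg mh).
have m3 := measurable_cnorm2 (cmeasurableB mf mh).
have two : (0 : R) <= 2 by [].
rewrite /sqnorm -!ge0_integralZ// => [|x|x]; try exact: cnorm2_ge0.
have g0 (k : R -> R[i]) x : 0 <= 2 * cnorm2 (k x) by rewrite mulr_ge0// cnorm2_ge0.
rewrite -ge0_integral_add//; try by apply: measurable_funM.
- apply: ge0_integral_le => //.
  + apply: measurable_funD; exact: measurable_funM.
  + by move=> x; exact: cnorm2_ge0.
  + by move=> x; rewrite -(subrKA (g x)); exact: cnorm2D_le.
- by move=> x; exact: (g0 (fun x => f x - g x)).
- by move=> x; exact: (g0 (fun x => g x - h x)).
Qed.

Lemma ReIm_cft h v : cintegrable h ->
  Re (cft h v) = kft cos (fun x => Re (h x)) v - kft sin (fun x => Im (h x)) v /\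
  Im (cft h v) = kft sin (fun x => Re (h x)) v + kft cos (fun x => Im (h x)) v.
Proof.
move=> [h1 h2].
have cos1 (x : R) : `|cos x| <= 1 by rewrite ler_norml cos_geN1 cos_le1.
have sin1 (x : R) : `|sin x| <= 1 by rewrite ler_norml sin_geN1 sin_le1.
have ic p : mu.-integrable setT (EFin \o p) ->
    mu.-integrable setT (EFin \o (fun x => p x * cos (v * x))).
  by move=> ip; apply: integrable_kft => //; exact: continuous_cos.
have iS p : mu.-integrable setT (EFin \o p) ->
    mu.-integrable setT (EFin \o (fun x => p x * sin (v * x))).
  by move=> ip; apply: integrable_kft => //; exact: continuous_sin.
rewrite /cft /cintegral /kft/=; split.
  rewrite -RintegralB//; [|exact: ic|exact: iS].
  by apply: eq_Rintegral => x _; rewrite cReM.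
rewrite -RintegralD//; [|exact: iS|exact: ic].
by apply: eq_Rintegral => x _; rewrite cImM.
Qed.

Lemma ccontinuous_cft h : cintegrable h -> ccontinuous (cft h).
Proof.
move=> ih; have [h1 h2] := ih.
have cos1 (x : R) : `|cos x| <= 1 by rewrite ler_norml cos_geN1 cos_le1.
have sin1 (x : R) : `|sin x| <= 1 by rewrite ler_norml sin_geN1 sin_le1.
have cc := @continuous_cos R; have cs := @continuous_sin R.
split.
  have -> : (fun x => Re (cft h x)) =
      kft cos (fun x => Re (h x)) \- kft sin (fun x => Im (h x)).
    by apply/funext => v; rewrite (ReIm_cft v ih).1.
  by move=> v; apply: cvgB; apply: continuous_kft.
have -> : (fun x => Im (cft h x)) =
    kft sin (fun x => Re (h x)) \+ kft cos (fun x => Im (h x)).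
  by apply/funext => v; rewrite (ReIm_cft v ih).2.
by move=> v; apply: cvgD; apply: continuous_kft.
Qed.

(** The exact Plancherel constant of [cft] is [2 pi]. Here the bound [2 * expR 1 * pi] is doubled
    when the real and imaginary parts are expanded, and again because [Re h] and [Im h] each enter
    through both the cosine and the sine transform. *)
Definition plancherel_cst : R := 4 * (2 * expR 1 * pi).

Lemma plancherel_cst_ge0 : 0 <= plancherel_cst.
Proof. by rewrite !mulr_ge0 ?expR_ge0 ?pi_ge0. Qed.

Lemma sqnorm_cft_le h : cintegrable h ->
  (sqnorm (cft h) <= plancherel_cst%:E * sqnorm h)%E.
Proof.
move=> ih; have [h1 h2] := ih.
have cos1 (x : R) : `|cos x| <= 1 by rewrite ler_norml cos_geN1 cos_le1.
have sin1 (x : R) : `|sin x| <= 1 by rewrite ler_norml sin_geN1 sin_le1.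
have cc := @continuous_cos R; have cs := @continuous_sin R.
have mk (k p : R -> R) : continuous k -> (forall x, `|k x| <= 1) ->
    mu.-integrable setT (EFin \o p) -> measurable_fun setT (fun x => kft k p x ^+ 2).
  move=> ck k1 ip; apply: measurable_funX; apply: continuous_measurable_fun.
  exact: continuous_kft.
set p := fun x => Re (h x) in h1; set q := fun x => Im (h x) in h2.
pose c := 2 * expR 1 * pi : R.
have c0 : 0 <= c by rewrite !mulr_ge0 ?expR_ge0 ?pi_ge0.
rewrite (sqnormE (cintegrable_cmeasurable ih)) -/p -/q.
pose F v := (kft cos p v ^+ 2 + kft sin q v ^+ 2) + (kft sin p v ^+ 2 + kft cos q v ^+ 2).
have F0 v : 0 <= F v by rewrite /F !addr_ge0 ?sqr_ge0.
have mF : measurable_fun setT F.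
  by apply: measurable_funD; apply: measurable_funD; apply: mk.
apply: (@le_trans _ _ (\int[mu]_v (2 * F v)%:E)%E).
  apply: ge0_integral_le.
  - apply: measurable_cnorm2; apply: ccontinuous_cmeasurable.
    exact: ccontinuous_cft.
  - exact: measurable_funM.
  - by move=> v; exact: cnorm2_ge0.
  - move=> v; have [E1 E2] := ReIm_cft v ih.
    rewrite -subr_ge0 (_ : _ - _ = (kft cos p v + kft sin q v) ^+ 2 +
        (kft sin p v - kft cos q v) ^+ 2); first by rewrite addr_ge0 ?sqr_ge0.
    by rewrite /cnorm2 E1 E2 -/p -/q /F; ring.
rewrite ge0_integralZ// ge0_integral_add; last 4 first.
- by apply: measurable_funD; apply: mk.
- by apply: measurable_funD; apply: mk.
- by move=> v; rewrite addr_ge0 ?sqr_ge0.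
- by move=> v; rewrite addr_ge0 ?sqr_ge0.
rewrite !ge0_integral_add; try (by apply: mk); try (by move=> v; exact: sqr_ge0).
have Hp := kft_cos_L2_le h1; have Hp' := kft_sin_L2_le h1.
have Hq := kft_cos_L2_le h2; have Hq' := kft_sin_L2_le h2.
have P0 (k : R -> R) : (0 <= \int[mu]_x (k x ^+ 2)%:E)%E.
  by apply: integral_ge0 => x _; rewrite lee_fin sqr_ge0.
rewrite (_ : plancherel_cst = 2 * (2 * c)); last by rewrite /plancherel_cst /c; ring.
rewrite [(2 * (2 * c))%:E]EFinM -muleA; apply: lee_wpmul2l; first by rewrite lee_fin.
rewrite EFinM -muleA.
rewrite (_ : 2%:E = 1%:E + 1%:E)%E; last by rewrite -EFinD.
rewrite ge0_muleDl ?lee_fin// mul1e.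
rewrite ge0_muleDr//.
by apply: leeD; apply: leeD; [exact: Hp|exact: Hq'|exact: Hp'|exact: Hq].
Qed.

Lemma cftB h g v : cintegrable h -> cintegrable g ->
  cft (fun x => h x - g x) v = cft h v - cft g v.
Proof.
move=> ih ig; rewrite /cft -cintegralB; first last.
- by apply: cintegrable_cexpi => //.
- by apply: cintegrable_cexpi => //.
by congr cintegral; apply/funext => x; rewrite mulrBl.
Qed.

(** * Dilations, and comparison of [L2dist] with [sqnorm] *)

Lemma ge0_integral_opp (G : R -> R) : continuous G -> (forall x, 0 <= G x) ->
  (\int[mu]_x (G (- x))%:E = \int[mu]_x (G x)%:E)%E.
Proof.
move=> cG G0.
have mG : measurable_fun setT G by exact: continuous_measurable_fun.
have := @ge0_integral_pushforward _ _ (measurableTypeR R) (measurableTypeR R) R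
  (-%R : _ -> measurableTypeR R) _ mu setT (EFin \o G).
rewrite preimage_setT => <- //=.
- apply: eq_measure_integral => //= A mA AS; exact: lebesgue_measureN.
- exact/measurable_EFinP.
- by move=> y _; rewrite lee_fin.
Qed.

(** Substitution along an increasing map; a negative factor is first turned into a positive one by
    reflecting [G]. *)
Lemma ge0_integral_dilate (G : R -> R) (b : R) : b != 0 -> continuous G ->
  (forall x, 0 <= G x) ->
  (\int[mu]_x (G (b * x))%:E = (`|b|^-1)%:E * \int[mu]_x (G x)%:E)%E.
Proof.
wlog b0 : G b / 0 < b.
  move=> H bn0 cG G0; have [b0|] := ltP 0 b; first exact: H.
  rewrite le_eqVlt (negbTE bn0)/= => b0.
  rewrite -(ge0_integral_opp cG G0).
  have cM (c : R) : continuous (fun x : R => c * x).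
    by move=> x; apply: cvgM; [exact: cvg_cst|exact: cvg_id].
  rewrite -normrN -(H (fun x => G (- x)) (- b)); first last.
  - by move=> x; exact: G0.
  - move=> x; apply: (@continuous_comp R R R -%R G); last exact: cG.
    by apply: cvgN; exact: cvg_id.
  - by rewrite oppr_eq0.
  - by rewrite oppr_gt0.
  by apply: eq_integral => x _; rewrite mulNr opprK.
move=> bn0 cG G0.
have dF : derive1 (fun x : R => b * x) = cst b.
  apply/funext => x; rewrite derive1E.
  have : is_derive x 1 (fun x : R => b * x) b.
    by apply: is_derive_eq; rewrite /GRing.scale/=; ring.
  by case.
rewrite (gtr0_norm b0).
rewrite (@increasing_ge0_integration_by_substitutionT _ (fun x => b * x) G).
- rewrite dF.
  have -> : (\int[mu]_x (((G \o (fun x => b * x)) * cst b) x)%:E =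
      \int[mu]_x (b * G (b * x))%:E)%E.
    by apply: eq_integral => x _; rewrite /= fctE mulrC.
  rewrite ge0_integralZ//; [|exact: ltW| ].
    by rewrite muleA -EFinM mulVf// mul1e.
  apply: continuous_measurable_fun => x.
  apply: (@continuous_comp R R R (fun x => b * x) G); last exact: cG.
  by apply: cvgM; [exact: cvg_cst|exact: cvg_id].
- by move=> x y xy; rewrite ltr_pM2l.
- by rewrite dF; move=> x; exact: cvg_cst.
- by rewrite dF; exact: is_cvg_cst.
- by rewrite dF; exact: is_cvg_cst.
- move=> x; have : is_derive x 1 (fun x : R => b * x) b.
    by apply: is_derive_eq; rewrite /GRing.scale/=; ring.
  by case.
- apply/cvgrNyPle => A; near=> x; rewrite mulrC -ler_pdivlMr//.
- apply/cvgryPge => A; near=> x; rewrite mulrC -ler_pdivrMr//.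
- exact: cG.
- exact: G0.
Unshelve. all: by end_near. Qed.

Lemma continuous_cnorm2 f : ccontinuous f -> continuous (fun x => cnorm2 (f x)).
Proof.
move=> [c1 c2] x; apply: cvgD.
  apply: (@continuous_comp R R R (fun x => Re (f x)) (fun x => x ^+ 2)); first exact: c1.
  exact: exprn_continuous.
apply: (@continuous_comp R R R (fun x => Im (f x)) (fun x => x ^+ 2)); first exact: c2.
exact: exprn_continuous.
Qed.

Lemma sqnorm_dilate f (b : R) : b != 0 -> ccontinuous f ->
  (sqnorm (fun u => f (b * u))%R = (`|b|^-1)%:E * sqnorm f)%E.
Proof.
move=> b0 cf; rewrite /sqnorm -(ge0_integral_dilate b0 (continuous_cnorm2 cf))//.
by move=> x; exact: cnorm2_ge0.
Qed.

Lemma ccontinuous_dilate f (b : R) : ccontinuous f -> ccontinuous (fun u => f (b * u)).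
Proof.
have cM : continuous (fun x : R => b * x).
  by move=> x; apply: cvgM; [exact: cvg_cst|exact: cvg_id].
move=> [c1 c2]; split=> x.
  by apply: (@continuous_comp R R R (fun x => b * x) (fun x => Re (f x))); [exact: cM|exact: c1].
by apply: (@continuous_comp R R R (fun x => b * x) (fun x => Im (f x))); [exact: cM|exact: c2].
Qed.

Lemma L2P f : L2 f <-> cmeasurable f /\ (sqnorm f < +oo)%E.
Proof. by split=> [[? [? ?]]|[[? ?] ?]]. Qed.

Lemma sqnormB_lty f g : L2 f -> L2 g -> (sqnorm (fun x => f x - g x)%R < +oo)%E.
Proof.
move=> /L2P[mf f2] /L2P[mg g2].
have m0 : cmeasurable (fun=> 0) by split => //=; exact: measurable_cst.
apply: le_lt_trans (sqnorm_trans mf m0 mg) _.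
rewrite (@eq_sqnorm _ f); last by move=> x; rewrite subr0.
rewrite (@sqnorm_sym (fun=> 0) g) (@eq_sqnorm (fun x => g x - 0) g); last first.
  by move=> x; rewrite subr0.
by rewrite lte_add_pinfty// lte_mul_pinfty// ?lee_fin.
Qed.

Lemma L2dist_le f g (e : R) : 0 <= e ->
  (sqnorm (fun x => f x - g x)%R <= (e ^+ 2)%:E)%E -> L2dist f g <= e.
Proof.
move=> e0 h; rewrite -[leRHS](ger0_norm e0) -sqrtr_sqr ler_wsqrtr// -lee_fin.
rewrite /Rintegral fineK// ge0_fin_numE; first by apply: le_lt_trans h _; rewrite ltry.
by apply: integral_ge0 => x _; rewrite lee_fin cnorm2_ge0.
Qed.

(** Finiteness must be known beforehand: an infinite [sqnorm] has [fine] value 0 and would give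
    distance 0. *)
Lemma L2dist_sqnorm_le f g (e : R) : (sqnorm (fun x => f x - g x)%R < +oo)%E ->
  L2dist f g <= e -> (sqnorm (fun x => f x - g x)%R <= (e ^+ 2)%:E)%E.
Proof.
move=> fin h.
have fn : sqnorm (fun x => f x - g x) \is a fin_num.
  by rewrite ge0_fin_numE// sqnorm_ge0.
rewrite -(fineK fn) lee_fin -[leLHS]sqr_sqrtr ?fine_ge0 ?sqnorm_ge0//.
by apply: lerXn2r => //; rewrite nnegrE ?sqrtr_ge0//; apply: le_trans h; exact: sqrtr_ge0.
Qed.

Lemma cexpiD (x y : R) : cexpi (x + y) = cexpi x * cexpi y.
Proof.
by apply: complexP; rewrite ?cReM ?cImM /= ?cosD ?sinD; ring.
Qed.

Local Open Scope complex_scope.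

(** * The Fourier transform, the chirp, and [G] as their composition with a dilation *)

Lemma fourierE f (xi : R) :
  fourier f xi = ((Num.sqrt (2 * pi))^-1)%:C * cft f (- 1 * xi).
Proof.
rewrite /fourier /cft; congr (_ * cintegral _); apply/funext => t.
by rewrite mulrC mulN1r mulNr.
Qed.

Lemma cnorm2_real (c : R) (z : R[i]) : cnorm2 (c%:C * z) = c ^+ 2 * cnorm2 z.
Proof. by rewrite cnorm2M; congr (_ * _); rewrite /cnorm2/= expr0n addr0. Qed.

Lemma ccontinuous_real (c : R) f : ccontinuous f -> ccontinuous (fun x => c%:C * f x).
Proof.
move=> [c1 c2]; split=> x.
  under eq_fun do rewrite cReM /= mul0r subr0.
  by apply: cvgM; [exact: cvg_cst|exact: c1].
under eq_fun do rewrite cImM /= mul0r addr0.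
by apply: cvgM; [exact: cvg_cst|exact: c2].
Qed.

Lemma ccontinuous_fourier f : cintegrable f -> ccontinuous (fourier f).
Proof.
move=> fi.
have -> : fourier f = (fun xi => ((Num.sqrt (2 * pi))^-1)%:C * cft f (- 1 * xi)).
  by apply/funext => xi; exact: fourierE.
apply: ccontinuous_real.
exact: (ccontinuous_dilate (- 1) (ccontinuous_cft fi)).
Qed.

Lemma sqnorm_fourier_le f : cintegrable f ->
  (sqnorm (fourier f) <= ((2 * pi)^-1 * plancherel_cst)%:E * sqnorm f)%E.
Proof.
move=> fi.
have c0 : 0 <= (2 * pi)^-1 :> R by rewrite invr_ge0 mulr_ge0// pi_ge0.
have -> : (sqnorm (fourier f) =
    \int[mu]_x ((2 * pi)^-1 * cnorm2 (cft f (- 1 * x)))%:E)%E.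
  apply: eq_integral => x _; rewrite fourierE cnorm2_real exprVn sqr_sqrtr//.
  by rewrite mulr_ge0// pi_ge0.
have cd := ccontinuous_dilate (- 1) (ccontinuous_cft fi).
rewrite ge0_integralZ//; last 2 first.
- exact: (measurable_cnorm2 (ccontinuous_cmeasurable cd)).
- by move=> x; exact: cnorm2_ge0.
rewrite EFinM -muleA; apply: lee_wpmul2l; first by rewrite lee_fin.
have := sqnorm_dilate (b := - 1) _ (ccontinuous_cft fi).
rewrite /sqnorm => ->; last by rewrite oppr_eq0 oner_neq0.
by rewrite normrN1 invr1 mul1e; exact: sqnorm_cft_le.
Qed.

Lemma fourierB f g xi : cintegrable f -> cintegrable g ->
  fourier (fun x => f x - g x) xi = fourier f xi - fourier g xi.
Proof. by move=> fi gi; rewrite !fourierE cftB// mulrBr. Qed.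

Definition chirp (a : R) f (xi : R) : R[i] := f xi * cexpi (a * xi ^+ 2).

Lemma cintegrable_chirp a f : cintegrable f -> cintegrable (chirp a f).
Proof.
by apply: cintegrable_cexpi; apply: measurable_funM => //; exact: exprn_measurable.
Qed.

Lemma sqnorm_chirp a f : sqnorm (chirp a f) = sqnorm f.
Proof.
by apply: eq_integral => x _; rewrite cnorm2M cnorm2_cexpi mulr1.
Qed.

Lemma GopE a b f u : Gop a b f u = cft (chirp a (fourier f)) (b * u).
Proof.
rewrite /Gop /cft /chirp; congr cintegral; apply/funext => xi.
by rewrite cexpiD mulrA.
Qed.

(* Where the integrals defining [Gop] diverge, [Rintegral] returns junk. *)
Definition admissible f := cintegrable f /\ cintegrable (fourier f).

Lemma admissibleB f g : admissible f -> admissible g ->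
  admissible (fun x => f x - g x).
Proof.
move=> [f1 f2] [g1 g2]; split; first exact: cintegrableB.
rewrite (_ : fourier _ = fun xi => fourier f xi - fourier g xi).
  exact: cintegrableB.
by apply/funext => xi; exact: fourierB.
Qed.

Lemma GopB a b f g u : admissible f -> admissible g ->
  Gop a b (fun x => f x - g x) u = Gop a b f u - Gop a b g u.
Proof.
move=> [f1 f2] [g1 g2]; rewrite !GopE -cftB; try exact: cintegrable_chirp.
rewrite (_ : chirp a (fourier (fun x => f x - g x)) =
  fun xi => chirp a (fourier f) xi - chirp a (fourier g) xi)//.
by apply/funext => xi; rewrite /chirp fourierB// mulrBl.
Qed.

Lemma ccontinuous_Gop a b f : admissible f -> ccontinuous (Gop a b f).
Proof.
move=> [f1 f2].
have -> : Gop a b f = (fun u => cft (chirp a (fourier f)) (b * u)).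
  by apply/funext => u; exact: GopE.
exact/ccontinuous_dilate/ccontinuous_cft/cintegrable_chirp.
Qed.

(** The product of the bounds of the two transforms. The chirp is an isometry, and the factor
    [|b|^-1] of the dilation is kept apart because it varies with [b]. *)
Definition Gop_cst : R := plancherel_cst * ((2 * pi)^-1 * plancherel_cst).

Lemma Gop_cst_ge0 : 0 <= Gop_cst.
Proof.
have c0 : 0 <= (2 * pi)^-1 :> R by rewrite invr_ge0 mulr_ge0// pi_ge0.
by rewrite /Gop_cst mulr_ge0 ?plancherel_cst_ge0// mulr_ge0 ?plancherel_cst_ge0.
Qed.

Lemma sqnorm_Gop_le a b f : b != 0 -> admissible f ->
  (sqnorm (Gop a b f) <= (`|b|^-1 * Gop_cst)%:E * sqnorm f)%E.
Proof.
move=> b0 [f1 f2].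
rewrite (@eq_sqnorm _ (fun u => cft (chirp a (fourier f)) (b * u))); last exact: GopE.
have cc := ccontinuous_cft (cintegrable_chirp a f2).
rewrite sqnorm_dilate//.
rewrite [(_ * Gop_cst)%:E]EFinM -muleA; apply: lee_wpmul2l; first by rewrite lee_fin invr_ge0.
apply: le_trans (sqnorm_cft_le (cintegrable_chirp a f2)) _.
rewrite [Gop_cst%:E]EFinM -muleA; apply: lee_wpmul2l; first by rewrite lee_fin plancherel_cst_ge0.
by rewrite sqnorm_chirp; exact: sqnorm_fourier_le.
Qed.

End ComplexL2.

(** * Schwartz functions: decay of their transforms, effect of dilations *)

Section SchwartzFunctions.
Context {R : realType}.
Local Notation mu := (@lebesgue_measure R).
Local Notation Re := complex.Re.
Local Notation Im := complex.Im.
Implicit Types (g : R -> R) (f : R -> R[i]).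

Lemma schwartzR_is_derive g n (x : R) : schwartzR g ->
  is_derive x 1 (derive1n n g) (derive1n n.+1 g x).
Proof.
move=> [dg _]; apply: DeriveDef; first exact: dg.
by rewrite derive1nS derive1E.
Qed.

Lemma continuous_schwartzR g n : schwartzR g -> continuous (derive1n n g).
Proof.
move=> sg; apply: (@is_derive_continuous _ _ (derive1n n.+1 g)) => x.
exact: schwartzR_is_derive.
Qed.

Lemma continuous_schwartzR0 g : schwartzR g -> continuous g.
Proof. exact: (@continuous_schwartzR g 0). Qed.

Lemma schwartzR_derive1n g n : schwartzR g -> schwartzR (derive1n n g).
Proof.
move=> [dg bg].
have E m : derive1n m (derive1n n g) = derive1n (m + n) g.
  by elim: m => // m IH; rewrite addSn !derive1nS IH.
by split=> [m x|k m]; rewrite E.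
Qed.

Lemma schwartzR_decay g : schwartzR g -> exists2 M : R, 0 <= M &
  forall x, (1 + x ^+ 2) * `|g x| <= M.
Proof.
move=> [_ bg]; have [M0 h0] := bg 0%N 0%N; have [M2 h2] := bg 2%N 0%N.
have H x : (1 + x ^+ 2) * `|g x| <= M0 + M2.
  rewrite mulrDl mul1r; apply: lerD.
    by have := h0 x; rewrite expr0 mul1r derive1n0.
  by have := h2 x; rewrite normrM derive1n0 ger0_norm// sqr_ge0.
exists (M0 + M2) => //; apply: le_trans (H 0).
by rewrite mulr_ge0// addr_ge0// sqr_ge0.
Qed.

Lemma measurable_schwartzR g : schwartzR g -> measurable_fun setT g.
Proof.
by move=> /continuous_schwartzR0; exact: continuous_measurable_fun.
Qed.

Lemma integrable_schwartzR g : schwartzR g -> mu.-integrable setT (EFin \o g).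
Proof.
move=> sg; have [M _ HM] := schwartzR_decay sg.
exact: (integrable_decay (measurable_schwartzR sg) HM).
Qed.

Lemma integrable_sqr_schwartzR g : schwartzR g ->
  mu.-integrable setT (EFin \o (fun x => g x ^+ 2)).
Proof.
move=> sg; have [M M0 HM] := schwartzR_decay sg.
apply: (@integrable_decay _ _ (M * M)).
  by apply: measurable_funX; exact: measurable_schwartzR.
move=> x; rewrite normrX [`|g x| ^+ 2]expr2 mulrA; apply: ler_pM => //.
  by rewrite mulr_ge0// addr_ge0// sqr_ge0.
apply: le_trans (HM x); rewrite ler_peMl// lerDl; exact: sqr_ge0.
Qed.

Lemma schwartzR_xdecay g : schwartzR g -> exists M : R, forall x, `|x * g x| <= M.
Proof. by move=> [_ /(_ 1%N 0%N)[M HM]]; exists M => x; have := HM x; rewrite expr1. Qed.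

(** The derivative of [g x * k (v * x)] has integral 0, because [k] and [x * g x] are bounded. *)
Lemma kft_by_parts (k k' : R -> R) g v : schwartzR g ->
  (forall x : R, is_derive x 1 k (k' x)) -> continuous k' ->
  (forall x, `|k x| <= 1) -> (forall x, `|k' x| <= 1) ->
  kft k (derive1n 1 g) v = - v * kft k' g v.
Proof.
move=> sg dk ck' k1 k'1.
have ck := is_derive_continuous dk.
have sg1 := schwartzR_derive1n 1 sg.
have ig := integrable_schwartzR sg; have ig1 := integrable_schwartzR sg1.
have [M HM] := schwartzR_xdecay sg.
have i1 := integrable_kft v ck k1 ig1; have i2 := integrable_kft v ck' k'1 ig.
have i3 : mu.-integrable setT (EFin \o (fun x => v * (g x * k' (v * x)))).
  by have := integrableZl measurableT v i2; apply: eq_integrable.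
have i4 : mu.-integrable setT
    (EFin \o (fun x => derive1n 1 g x * k (v * x) + v * (g x * k' (v * x)))).
  by have := integrableD measurableT i1 i3; apply: eq_integrable.
have cM (c : R) : continuous (fun x : R => c * x).
  by move=> x; apply: cvgM; [exact: cvg_cst|exact: cvg_id].
have cc (h : R -> R) : continuous h -> continuous (fun x => h (v * x)).
  by move=> ch x; apply: (@continuous_comp R R R (fun x => v * x) h); [exact: cM|exact: ch].
have dkv (x : R) : is_derive x 1 (fun x => k (v * x)) (v * k' (v * x)).
  have := @is_derive1_comp R k (fun x => v * x) x (k' (v * x)) v.
  rewrite /comp [v * k' _]mulrC; apply => //.
  by apply: is_derive_eq; rewrite /GRing.scale/=; ring.
have dg (x : R) : is_derive x 1 g (derive1n 1 g x) := schwartzR_is_derive 0 x sg.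
have := @integral_derive_decay R
  (fun x => derive1n 1 g x * k (v * x) + v * (g x * k' (v * x)))
  (fun x => g x * k (v * x)) M.
rewrite RintegralD//.
rewrite RintegralZl// -/(kft k (derive1n 1 g) v) -/(kft k' g v) => H.
apply/eqP; rewrite mulNr -addr_eq0; apply/eqP; apply: H => //.
- by move=> x; apply: is_derive_eq; rewrite /GRing.scale/=; ring.
- move=> x; apply: cvgD.
    apply: cvgM; first exact: (continuous_schwartzR0 sg1).
    exact: cc.
  apply: cvgM; first exact: cvg_cst.
  apply: cvgM; first exact: (continuous_schwartzR0 sg).
  exact: cc.
- move=> x; apply: le_trans (HM x); rewrite mulrA normrM ler_piMr//.
Qed.

Lemma kft_cos_derive1 g v : schwartzR g ->
  kft cos (derive1n 1 g) v = v * kft sin g v.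
Proof.
move=> sg; rewrite (@kft_by_parts cos (fun x => - sin x))//.
- rewrite mulNr -mulrN; congr (_ * _).
  rewrite -mulN1r /kft -RintegralZl//.
    by apply: eq_Rintegral => x _; rewrite mulN1r mulrN opprK.
  apply: (@integrable_kft _ (fun x => - sin x) g v); last exact: integrable_schwartzR.
    by move=> x; apply: cvgN; exact: continuous_sin.
  by move=> x; rewrite normrN ler_norml sin_geN1 sin_le1.
- by move=> x; apply: cvgN; exact: continuous_sin.
- by move=> x; rewrite ler_norml cos_geN1 cos_le1.
- by move=> x; rewrite normrN ler_norml sin_geN1 sin_le1.
Qed.

Lemma kft_sin_derive1 g v : schwartzR g ->
  kft sin (derive1n 1 g) v = - v * kft cos g v.
Proof.
move=> sg; rewrite (@kft_by_parts sin cos)//.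
- exact: continuous_cos.
- by move=> x; rewrite ler_norml sin_geN1 sin_le1.
- by move=> x; rewrite ler_norml cos_geN1 cos_le1.
Qed.

Lemma kft_derive2 g v : schwartzR g ->
  kft cos (derive1n 2 g) v = - v ^+ 2 * kft cos g v /\
  kft sin (derive1n 2 g) v = - v ^+ 2 * kft sin g v.
Proof.
move=> sg; have sg1 := schwartzR_derive1n 1 sg.
have -> : derive1n 2 g = derive1n 1 (derive1n 1 g) by [].
split.
  by rewrite (kft_cos_derive1 v sg1) kft_sin_derive1//; ring.
by rewrite (kft_sin_derive1 v sg1) kft_cos_derive1//; ring.
Qed.

(** Two integrations by parts: [- v^2] times the transform of [g] is the transform of [g''], hence
    bounded by the integral of [|g''|]. *)
Lemma kft_decay g : schwartzR g -> exists2 M : R, 0 <= M & forall v,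
  (1 + v ^+ 2) * `|kft cos g v| <= M /\ (1 + v ^+ 2) * `|kft sin g v| <= M.
Proof.
move=> sg; have sg2 := schwartzR_derive1n 2 sg.
have ig := integrable_schwartzR sg; have ig2 := integrable_schwartzR sg2.
have cos1 (x : R) : `|cos x| <= 1 by rewrite ler_norml cos_geN1 cos_le1.
have sin1 (x : R) : `|sin x| <= 1 by rewrite ler_norml sin_geN1 sin_le1.
have cc := @continuous_cos R; have cs := @continuous_sin R.
exists (Rintegral mu setT (fun x => `|g x|) +
        Rintegral mu setT (fun x => `|derive1n 2 g x|)).
  by apply: addr_ge0; apply: Rintegral_ge0.
move=> v; have [E1 E2] := kft_derive2 v sg.
have N2 (z : R) : v ^+ 2 * `|z| = `|- v ^+ 2 * z|.
  by rewrite normrM normrN [`|v ^+ 2|]ger0_norm// sqr_ge0.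
rewrite !mulrDl !mul1r !N2 -E1 -E2; split; apply: lerD; exact: kft_bounded.
Qed.

Lemma cintegrable_schwartz f : schwartz f -> cintegrable f.
Proof. by move=> [s1 s2]; split; exact: integrable_schwartzR. Qed.

Lemma L2_schwartz f : schwartz f -> L2 f.
Proof.
move=> sf; apply/L2P; have mf := cintegrable_cmeasurable (cintegrable_schwartz sf).
split=> //; rewrite sqnormE//; case: sf => s1 s2.
have fin g : schwartzR g -> (\int[mu]_x (g x ^+ 2)%:E < +oo)%E.
  move=> sg; have /integrableP[_] := integrable_sqr_schwartzR sg.
  by under eq_integral do rewrite /= ger0_norm ?sqr_ge0//.
by rewrite lte_add_pinfty//; exact: fin.
Qed.

Lemma cft_decay f : schwartz f -> exists2 M : R, 0 <= M & forall v,
  (1 + v ^+ 2) * `|Re (cft f v)| <= M /\ (1 + v ^+ 2) * `|Im (cft f v)| <= M.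
Proof.
move=> sf; have fi := cintegrable_schwartz sf; case: sf => s1 s2.
have [M1 M10 H1] := kft_decay s1; have [M2 M20 H2] := kft_decay s2.
exists (M1 + M2); first exact: addr_ge0.
move=> v; have [-> ->] := ReIm_cft v fi.
have [h1 h2] := H1 v; have [h3 h4] := H2 v.
have p0 : 0 <= 1 + v ^+ 2 by rewrite addr_ge0// sqr_ge0.
split.
  apply: le_trans (ler_wpM2l p0 (ler_normB _ _)) _.
  by rewrite mulrDr lerD.
apply: le_trans (ler_wpM2l p0 (ler_normD _ _)) _.
by rewrite mulrDr lerD.
Qed.

Lemma admissible_schwartz f : schwartz f -> admissible f.
Proof.
move=> sf; have fi := cintegrable_schwartz sf; split => //.
have [mF1 mF2] := ccontinuous_cmeasurable (ccontinuous_fourier fi).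
have [M M0 HM] := cft_decay sf.
have c0 : 0 <= (Num.sqrt (2 * pi))^-1 :> R by rewrite invr_ge0 sqrtr_ge0.
split; apply: (@integrable_decay _ _ ((Num.sqrt (2 * pi))^-1 * M)) => // x.
  rewrite fourierE cReM /= mul0r subr0 normrM (ger0_norm c0) mulrCA ler_wpM2l//.
  by have [+ _] := HM (- 1 * x); rewrite mulN1r sqrrN.
rewrite fourierE cImM /= mul0r addr0 normrM (ger0_norm c0) mulrCA ler_wpM2l//.
by have [_] := HM (- 1 * x); rewrite mulN1r sqrrN.
Qed.

Definition cderive2 f (x : R) : R[i] :=
  Complex (derive1n 2 (fun x => Re (f x)) x) (derive1n 2 (fun x => Im (f x)) x).

Lemma schwartz_cderive2 f : schwartz f -> schwartz (cderive2 f).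
Proof. by move=> [s1 s2]; split; exact: (schwartzR_derive1n 2). Qed.

(** Up to sign, [xi^2 f^] is the Fourier transform of [f''], again a Schwartz function. This will
    control the dependence of the chirp on its parameter. *)
Lemma sqnorm_sqrM_fourier_lty f : schwartz f ->
  (sqnorm (fun xi => Complex (xi ^+ 2) 0 * fourier f xi)%R < +oo)%E.
Proof.
move=> sf; have fi := cintegrable_schwartz sf.
have sf2 := schwartz_cderive2 sf; have f2i := cintegrable_schwartz sf2.
rewrite (_ : sqnorm _ = sqnorm (fourier (cderive2 f))).
  have /L2P[_ fin] := L2_schwartz sf2.
  apply: le_lt_trans (sqnorm_fourier_le f2i) _.
  apply: lte_mul_pinfty => //; rewrite lee_fin mulr_ge0 ?plancherel_cst_ge0//.
  by rewrite invr_ge0 mulr_ge0// pi_ge0.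
apply: eq_integral => xi _; congr (_%:E).
rewrite !fourierE !cnorm2M.
rewrite [LHS]mulrCA; congr (_ * _).
have -> : cnorm2 (Complex (xi ^+ 2) 0) = xi ^+ 4 by rewrite /cnorm2/=; ring.
case: sf => s1 s2; rewrite /cnorm2.
set v := - 1 * xi.
have R2 : Re (cft (cderive2 f) v) =
    - v ^+ 2 * kft cos (fun x => Re (f x)) v - - v ^+ 2 * kft sin (fun x => Im (f x)) v.
  exact: etrans (ReIm_cft v f2i).1 (congr2 (fun a b : R => a - b)
    (kft_derive2 v s1).1 (kft_derive2 v s2).2).
have I2 : Im (cft (cderive2 f) v) =
    - v ^+ 2 * kft sin (fun x => Re (f x)) v + - v ^+ 2 * kft cos (fun x => Im (f x)) v.
  exact: etrans (ReIm_cft v f2i).2 (congr2 (fun a b : R => a + b)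
    (kft_derive2 v s1).2 (kft_derive2 v s2).1).
rewrite R2 I2; have [-> ->] := ReIm_cft v fi.
by rewrite /v; ring.
Qed.

(** By the mean value theorem the difference is [derive1n 1 g c * ((b - b0) * u)]. The condition on
    [b] keeps [|c| >= |b0 u| / 2], so the decay of the derivative at [c] beats the factor [u] and
    leaves a multiple of a Poisson kernel in [u]. *)
Lemma schwartzR_dilate_le g (b0 : R) : schwartzR g -> b0 != 0 ->
  exists2 K : R, 0 <= K & forall b, `|b - b0| <= `|b0| / 2 ->
  (\int[mu]_u ((g (b * u) - g (b0 * u)) ^+ 2)%:E <= (K * (b - b0) ^+ 2)%:E)%E.
Proof.
move=> sg b00; have [M M0 HM] := schwartzR_decay (schwartzR_derive1n 1 sg).
(* Chosen so that [|c| >= |b0 u| / 2] reads [|u| <= e |c|]. *)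
pose e := 2 / `|b0|; have n0 : 0 < `|b0| by rewrite normr_gt0.
have e0 : 0 < e by rewrite divr_gt0.
have eE : e = 2 / `|b0| by []; clearbody e.
exists (M ^+ 2 * e ^+ 3 * pi).
  by rewrite mulr_ge0 ?pi_ge0// mulr_ge0 ?sqr_ge0// exprn_ge0// ltW.
move=> b bb0.
have cM (c : R) : continuous (fun x : R => g (c * x)).
  move=> x; apply: (@continuous_comp R R R (fun x => c * x) g).
    by apply: cvgM; [exact: cvg_cst|exact: cvg_id].
  exact: (continuous_schwartzR0 sg).
have pos (u : R) : 0 < e ^+ 2 + (u + 0) ^+ 2.
  by rewrite ltr_pwDl ?sqr_ge0// exprn_gt0.
have key (u : R) : (g (b * u) - g (b0 * u)) ^+ 2 <=
    (M ^+ 2 * (b - b0) ^+ 2 * e ^+ 3) * (e / (e ^+ 2 + (u + 0) ^+ 2)).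
  have [c Hc cE] : exists2 c, `|c| >= `|b0 * u| / 2 &
      g (b * u) - g (b0 * u) = derive1n 1 g c * ((b - b0) * u).
    have MV (x y : R) : x <= y -> exists2 c, x <= c <= y &
        g y - g x = derive1n 1 g c * (y - x).
      move=> xy; have [//|||c cin ->] := @MVT_segment _ g (derive1n 1 g) x y.
      - by move=> z _; exact: (schwartzR_is_derive 0).
      - exact/continuous_subspaceT/(continuous_schwartzR0 sg).
      by exists c => //; move: cin; rewrite in_itv.
    have nbu : `|b * u - b0 * u| <= `|b0 * u| / 2.
      by rewrite -mulrBl !normrM mulrAC ler_wpM2r.
    have far (c : R) : `|c - b0 * u| <= `|b * u - b0 * u| -> `|b0 * u| / 2 <= `|c|.
      move=> h; have := ler_normB c (c - b0 * u); rewrite opprB addrC subrK => h2.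
      lra.
    have [le|/ltW le] := leP (b0 * u) (b * u).
      have [c /andP[c1 c2] cE] := MV _ _ le; exists c; last by rewrite cE; ring.
      by apply: far; rewrite !ger0_norm ?subr_ge0// lerB.
    have [c /andP[c1 c2] cE] := MV _ _ le; exists c; last first.
      by rewrite -opprB cE; ring.
    by apply: far; rewrite !ler0_norm ?subr_le0// lerN2 lerB.
  rewrite cE !exprMn.
  have h1 : (derive1n 1 g c) ^+ 2 * (1 + c ^+ 2) ^+ 2 <= M ^+ 2.
    rewrite -exprMn -[leLHS]real_normK ?num_real// lerXn2r ?nnegrE//.
    by have := HM c; rewrite normrM mulrC (ger0_norm (_ : 0 <= 1 + _))// addr_ge0// sqr_ge0.
  have h2 : u ^+ 2 <= e ^+ 2 * c ^+ 2.
    rewrite -[c ^+ 2]real_normK ?num_real// -exprMn -[leLHS]real_normK ?num_real//.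
    rewrite lerXn2r ?nnegrE// ?mulr_ge0 ?(ltW e0)//.
    rewrite eE mulrAC ler_pdivlMr// mulrC -normrM.
    by lra.
  have d0 : 0 <= (derive1n 1 g c) ^+ 2 by exact: sqr_ge0.
  rewrite [leRHS]mulrA ler_pdivlMr// addr0.
  have q0 : 0 <= (b - b0) ^+ 2 by exact: sqr_ge0.
  set D := derive1n 1 g c in h1 d0 *.
  have -> : D ^+ 2 * ((b - b0) ^+ 2 * u ^+ 2) * (e ^+ 2 + u ^+ 2) =
    (b - b0) ^+ 2 * (D ^+ 2 * (u ^+ 2 * (e ^+ 2 + u ^+ 2))) by ring.
  have -> : M ^+ 2 * (b - b0) ^+ 2 * e ^+ 3 * e =
    (b - b0) ^+ 2 * (M ^+ 2 * e ^+ 4) by ring.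
  apply: ler_wpM2l => //.
  (* From [u^2 <= e^2 c^2] one gets [u^2 (e^2 + u^2) <= e^4 c^2 (1 + c^2) <= e^4 (1 + c^2)^2], and
     [h1] takes care of the last square. *)
  apply: (@le_trans _ _ (D ^+ 2 * ((1 + c ^+ 2) ^+ 2 * e ^+ 4))); last first.
    by rewrite mulrA ler_wpM2r// exprn_ge0// ltW.
  apply: ler_wpM2l => //.
  have c20 : 0 <= c ^+ 2 by exact: sqr_ge0.
  have e20 : 0 <= e ^+ 2 by exact: sqr_ge0.
  apply: (@le_trans _ _ ((e ^+ 2 * c ^+ 2) * (e ^+ 2 + e ^+ 2 * c ^+ 2))).
    by apply: ler_pM; rewrite ?sqr_ge0 ?addr_ge0 ?sqr_ge0// lerD2l.
  rewrite -subr_ge0 (_ : _ - _ = (e ^+ 2) ^+ 2 * (1 + c ^+ 2)); last by ring.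
  by rewrite mulr_ge0 ?sqr_ge0// addr_ge0.
apply: (@le_trans _ _ (\int[mu]_u ((M ^+ 2 * (b - b0) ^+ 2 * e ^+ 3) *
    (e / (e ^+ 2 + (u + 0) ^+ 2)))%:E)%E).
  apply: ge0_integral_le => //.
  - apply: measurable_funX; apply: measurable_funB.
      exact: (continuous_measurable_fun (cM b)).
    exact: (continuous_measurable_fun (cM b0)).
  - apply: continuous_measurable_fun => u; apply: cvgM; first exact: cvg_cst.
    apply: cvgM; first exact: cvg_cst.
    apply: cvgV; first by rewrite gt_eqF.
    apply: cvgD; first exact: cvg_cst.
    under eq_fun do rewrite addr0; rewrite addr0.
    exact: exprn_continuous.
  - by move=> u; exact: sqr_ge0.
have k0 : 0 <= M ^+ 2 * (b - b0) ^+ 2 * e ^+ 3.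
  by rewrite mulr_ge0 ?exprn_ge0 ?(ltW e0)// mulr_ge0 ?sqr_ge0.
rewrite ge0_integralZ//; last 2 first.
- apply: continuous_measurable_fun => u; apply: cvgM; first exact: cvg_cst.
  apply: cvgV; first by rewrite gt_eqF.
  apply: cvgD; first exact: cvg_cst.
  under eq_fun do rewrite addr0; rewrite addr0.
  exact: exprn_continuous.
- by move=> u; rewrite divr_ge0 ?(ltW e0)// ltW.
apply: le_trans (lee_wpmul2l _ (integral_poisson_le 0 e0)) _; first by rewrite lee_fin.
by rewrite -EFinM lee_fin le_eqVlt; apply/orP; left; apply/eqP; ring.
Qed.

Lemma sqnorm_schwartz_dilate_le f (b0 : R) : schwartz f -> b0 != 0 ->
  exists2 K : R, 0 <= K & forall b, `|b - b0| <= `|b0| / 2 ->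
  (sqnorm (fun u => f (b * u) - f (b0 * u))%R <= (K * (b - b0) ^+ 2)%:E)%E.
Proof.
move=> sf b00; have mf := cintegrable_cmeasurable (cintegrable_schwartz sf).
case: (sf) => s1 s2.
have [K1 K10 H1] := schwartzR_dilate_le s1 b00.
have [K2 K20 H2] := schwartzR_dilate_le s2 b00.
exists (K1 + K2); first exact: addr_ge0.
move=> b hb; rewrite sqnormE.
  rewrite mulrDl EFinD; apply: leeD.
    by under eq_integral do rewrite cReB; exact: H1.
  by under eq_integral do rewrite cImB; exact: H2.
have cf : ccontinuous f.
  by split; [exact: (continuous_schwartzR0 s1)|exact: (continuous_schwartzR0 s2)].
by apply: cmeasurableB; apply: ccontinuous_cmeasurable; exact: ccontinuous_dilate.
Qed.

End SchwartzFunctions.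

(** * Density of Schwartz functions in L2 *)

Section SchwartzDensity.
Context {R : realType}.
Local Notation mu := (@lebesgue_measure R).
Local Notation Re := complex.Re.
Local Notation Im := complex.Im.
Implicit Types (f g h : R -> R).

Lemma derive1n_add f g n : schwartzR f -> schwartzR g ->
  derive1n n (fun x => f x + g x) = (fun x => derive1n n f x + derive1n n g x).
Proof.
move=> sf sg; elim: n => // n IH; rewrite derive1nS IH.
apply/funext => x; rewrite derive1E.
have df := schwartzR_is_derive n x sf; have dg := schwartzR_is_derive n x sg.
have : is_derive x 1 (fun x => derive1n n f x + derive1n n g x)
  (derive1n n.+1 f x + derive1n n.+1 g x) by apply: is_derive_eq.
by case.
Qed.

Lemma schwartzRD f g : schwartzR f -> schwartzR g -> schwartzR (fun x => f x + g x).
Proof.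
move=> sf sg; split=> [n x|k n]; rewrite derive1n_add//.
  by apply: derivableD; [exact: (proj1 sf)|exact: (proj1 sg)].
have [M1 H1] := proj2 sf k n; have [M2 H2] := proj2 sg k n.
exists (M1 + M2) => x; rewrite mulrDr; apply: le_trans (ler_normD _ _) _.
exact: lerD.
Qed.

Lemma derive1n_scale f (c : R) n : schwartzR f ->
  derive1n n (fun x => c * f x) = (fun x => c * derive1n n f x).
Proof.
move=> sf; elim: n => // n IH; rewrite derive1nS IH.
apply/funext => x; rewrite derive1E.
have df := schwartzR_is_derive n x sf.
have : is_derive x 1 (fun x => c * derive1n n f x) (c * derive1n n.+1 f x).
  by apply: is_derive_eq; rewrite /GRing.scale/=; ring.
by case.
Qed.

Lemma schwartzRZ f (c : R) : schwartzR f -> schwartzR (fun x => c * f x).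
Proof.
move=> sf; split=> [n x|k n]; rewrite derive1n_scale//.
  by apply: derivableM; [exact: derivable_cst|exact: (proj1 sf)].
have [M H] := proj2 sf k n.
by exists (`|c| * M) => x; rewrite mulrCA normrM ler_wpM2l.
Qed.

(** For [|y| <= 1] both factors are at most 1. Beyond, [y^{2m+2} >= y^2], and
    [|y|^i <= (y^2)^i <= i! e^{y^2}] by the exponential series. *)
Lemma powM_expRN_le (y : R) (i m : nat) :
  `|y| ^+ i * expR (- y ^+ m.+1.*2) <= 1 + i`!%:R.
Proof.
have e1 (t : R) : 0 <= t -> expR (- t) <= 1.
  by move=> t0; rewrite -[leRHS]expR0 ler_expR oppr_le0.
have ev : 0 <= y ^+ m.+1.*2 by rewrite -mul2n exprM exprn_ge0// sqr_ge0.
have [y1|/ltW y1] := leP `|y| 1.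
  apply: (@le_trans _ _ 1); last by rewrite lerDl.
  rewrite -[leRHS]mulr1; apply: ler_pM => //; rewrite ?expR_ge0 ?exprn_ge0//.
    exact: exprn_ile1.
  exact: e1.
have y2 : y ^+ 2 <= y ^+ m.+1.*2.
  rewrite -[y ^+ 2]real_normK ?num_real//.
  have -> : y ^+ m.+1.*2 = `|y| ^+ m.+1.*2.
    by rewrite -!mul2n !exprM real_normK ?num_real.
  by apply: ler_weXn2l => //; rewrite -[2%N]/(1.*2) leq_double.
have yi : `|y| ^+ i <= (y ^+ 2) ^+ i.
  rewrite -[y ^+ 2]real_normK ?num_real// -exprM; apply: ler_weXn2l => //.
  by rewrite mul2n -addnn leq_addr.
have F : (y ^+ 2) ^+ i <= i`!%:R * expR (y ^+ 2).
  case: i {yi} => [|i].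
    by rewrite expr0 fact0 mul1r -[leLHS]expR0 ler_expR sqr_ge0.
  have := @expR_ge1Dxn R (y ^+ 2) i (sqr_ge0 _) => h.
  rewrite mulrC -ler_pdivrMr ?ltr0n ?fact_gt0//.
  by apply: le_trans h; rewrite lerDr.
apply: (@le_trans _ _ (i`!%:R * expR (y ^+ 2) * expR (- y ^+ 2))).
  apply: ler_pM; rewrite ?exprn_ge0 ?expR_ge0//; first exact: le_trans F.
  by rewrite ler_expR lerN2.
by rewrite -mulrA -expRD subrr expR0 mulr1 lerDr.
Qed.

Lemma polyM_expRN_bounded (q : {poly R}) (m : nat) :
  exists M : R, forall y : R, `|q.[y] * expR (- y ^+ m.+1.*2)| <= M.
Proof.
exists (\sum_(i < size q) `|q`_i| * (1 + i`!%:R)) => y.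
rewrite normrM (ger0_norm (expR_ge0 _)) horner_coef.
apply: le_trans (ler_wpM2r (expR_ge0 _) (ler_norm_sum _ _ _)) _.
rewrite mulr_suml; apply: ler_sum => i _.
by rewrite normrM normrX -mulrA ler_wpM2l// powM_expRN_le.
Qed.

(** A class closed under differentiation, so that all derivatives are explicit: [expbump_next] is
    the polynomial factor of the next one. The exponent [m.+1.*2] is even and at least 2. With
    [q = 1] and [m] large this approximates an indicator; [m = 0] gives the Gaussians of the
    converse. *)
Definition expbump (c s : R) (m : nat) (q : {poly R}) (x : R) : R :=
  q.[(x - c) * s] * expR (- ((x - c) * s) ^+ m.+1.*2).

Definition expbump_next (s : R) (m : nat) (q : {poly R}) : {poly R} :=
  s *: (q^`() - (m.+1.*2%:R *: 'X^(m.*2.+1)) * q).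

Lemma expbump_is_derive c s m q (x : R) :
  is_derive x 1 (expbump c s m q) (expbump c s m (expbump_next s m q) x).
Proof.
have dy : is_derive x 1 (fun x : R => (x - c) * s) s.
  by apply: is_derive_eq; rewrite /GRing.scale/=; ring.
have dqy (p : {poly R}) : is_derive x 1 (fun x : R => p.[(x - c) * s])
    ((p^`()).[(x - c) * s] * s).
  have dp : is_derive ((x - c) * s) 1 (horner p) (p^`()).[(x - c) * s].
    apply: DeriveDef; first exact: derivable_horner.
    by rewrite derivE derive1E.
  exact: (@is_derive1_comp R (horner p) (fun x : R => (x - c) * s) x _ _ dp dy).
have dX : is_derive x 1 (fun x : R => ((x - c) * s) ^+ m.+1.*2)
    (m.+1.*2%:R * ((x - c) * s) ^+ m.*2.+1 * s).
  have := dqy 'X^(m.+1.*2); rewrite derivXn hornerMn hornerXn mulr_natl doubleS/=.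
  by under [fun x => ('X^_).[_]]eq_fun do rewrite hornerXn.
have dE : is_derive x 1 (fun x : R => expR (- ((x - c) * s) ^+ m.+1.*2))
    (expR (- ((x - c) * s) ^+ m.+1.*2) *
     - (m.+1.*2%:R * ((x - c) * s) ^+ m.*2.+1 * s)).
  have dN : is_derive x 1 (fun x : R => - ((x - c) * s) ^+ m.+1.*2)
    (- (m.+1.*2%:R * ((x - c) * s) ^+ m.*2.+1 * s)) by apply: is_derive_eq.
  exact: (@is_derive1_comp R expR (fun x : R => - ((x - c) * s) ^+ m.+1.*2) x _ _
    (is_derive_expR _) dN).
rewrite /expbump; apply: is_derive_eq.
by rewrite /GRing.scale/= /expbump_next !hornerE /=; ring.
Qed.

Lemma derive1n_expbump c s m q n : derive1n n (expbump c s m q) =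
  expbump c s m (iter n (expbump_next s m) q).
Proof.
elim: n => // n IH; rewrite derive1nS IH iterS; apply/funext => x.
by rewrite derive1E; case: (expbump_is_derive c s m (iter n (expbump_next s m) q) x).
Qed.

Lemma schwartzR_expbump c s m q : s != 0 -> schwartzR (expbump c s m q).
Proof.
move=> s0; split=> [n x|k n]; rewrite derive1n_expbump.
  by case: (expbump_is_derive c s m (iter n (expbump_next s m) q) x).
set p := iter _ _ _.
(* In terms of [y = (x - c) * s] one has [x = c + s^-1 y], so the weight [x ^+ k] is one more
   polynomial factor. *)
have [M HM] := polyM_expRN_bounded ((c%:P + s^-1 *: 'X) ^+ k * p) m.
exists M => x; apply: le_trans (HM ((x - c) * s)).
rewrite /expbump hornerM horner_exp !hornerE /= -mulrA.
by rewrite (_ : c + s^-1 * (x - c) * s = x); [rewrite mulrA|field].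
Qed.

(** The L2 closure of the Schwartz functions, as a predicate to be carried from intervals to bounded
    measurable sets, to simple functions and finally to L2. *)
Definition approximable f := measurable_fun setT f /\
  forall e : R, 0 < e -> exists2 g, schwartzR g &
    (\int[mu]_x ((f x - g x) ^+ 2)%:E <= e%:E)%E.

Lemma sqr_integral_trans f g h : measurable_fun setT f -> measurable_fun setT g ->
  measurable_fun setT h ->
  (\int[mu]_x ((f x - h x)%R ^+ 2)%:E <=
   2%:E * \int[mu]_x ((f x - g x)%R ^+ 2)%:E + 2%:E * \int[mu]_x ((g x - h x)%R ^+ 2)%:E)%E.
Proof.
move=> mf mg mh.
have m1 : measurable_fun setT (fun x => (f x - g x) ^+ 2).
  by apply: measurable_funX; exact: measurable_funB.
have m2 : measurable_fun setT (fun x => (g x - h x) ^+ 2).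
  by apply: measurable_funX; exact: measurable_funB.
have s0 (z : R) : 0 <= 2 * z ^+ 2 by rewrite mulr_ge0// sqr_ge0.
rewrite -!ge0_integralZ//; try by move=> x; exact: sqr_ge0.
rewrite -ge0_integral_add//; first last.
- exact: measurable_funM.
- exact: measurable_funM.
apply: ge0_integral_le.
- by apply: measurable_funX; exact: measurable_funB.
- by apply: measurable_funD; exact: measurable_funM.
- by move=> x; exact: sqr_ge0.
- move=> x; rewrite -subr_ge0.
  rewrite (_ : _ - _ = ((f x - g x) - (g x - h x)) ^+ 2); first exact: sqr_ge0.
  by ring.
Qed.

Lemma approximable_closed f : measurable_fun setT f ->
  (forall e : R, 0 < e -> exists2 h, approximable h &
    (\int[mu]_x ((f x - h x) ^+ 2)%:E <= e%:E)%E) -> approximable f.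
Proof.
move=> mf H; split=> // e e0.
have e40 : 0 < e / 4 by rewrite divr_gt0.
have [h [mh ah] fh] := H _ e40; have [g sg hg] := ah _ e40.
exists g => //; apply: le_trans (sqr_integral_trans mf mh (measurable_schwartzR sg)) _.
apply: (@le_trans _ _ (2%:E * (e / 4)%:E + 2%:E * (e / 4)%:E)%E).
  by apply: leeD; apply: lee_wpmul2l => //; rewrite lee_fin.
by rewrite -!EFinM -EFinD lee_fin; lra.
Qed.

Lemma approximable_schwartzR g : schwartzR g -> approximable g.
Proof.
move=> sg; split=> [|e e0]; first exact: measurable_schwartzR.
exists g => //; under eq_integral do rewrite subrr expr0n.
by rewrite integral0 lee_fin ltW.
Qed.

Lemma approximableD f g : approximable f -> approximable g ->
  approximable (fun x => f x + g x).
Proof.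
move=> [mf af] [mg ag]; split=> [|e e0]; first exact: measurable_funD.
have e40 : 0 < e / 4 by rewrite divr_gt0.
have [f' sf' Hf] := af _ e40; have [g' sg' Hg] := ag _ e40.
exists (fun x => f' x + g' x); first exact: schwartzRD.
have mf' := measurable_schwartzR sf'; have mg' := measurable_schwartzR sg'.
have := @sqr_integral_trans (fun x => f x + g x) (fun x => f' x + g x)
  (fun x => f' x + g' x).
move=> /(_ (measurable_funD mf mg) (measurable_funD mf' mg) (measurable_funD mf' mg')).
move=> /le_trans; apply.
apply: (@le_trans _ _ (2%:E * (e / 4)%:E + 2%:E * (e / 4)%:E)%E); last first.
  by rewrite -!EFinM -EFinD lee_fin; lra.
apply: leeD; apply: lee_wpmul2l; rewrite ?lee_fin//.
  by under eq_integral do rewrite opprD addrACA subrr addr0.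
by under eq_integral do rewrite opprD addrACA subrr add0r.
Qed.

Lemma approximableZ f (c : R) : approximable f -> approximable (fun x => c * f x).
Proof.
move=> [mf af]; split=> [|e e0]; first exact: measurable_funM.
have c1 : 0 < c ^+ 2 + 1 by rewrite ltr_wpDl// sqr_ge0.
have [g sg Hg] := af _ (divr_gt0 e0 c1).
exists (fun x => c * g x); first exact: schwartzRZ.
have mg := measurable_schwartzR sg.
have -> : (\int[mu]_x ((c * f x - c * g x) ^+ 2)%:E =
    \int[mu]_x (c ^+ 2 * (f x - g x) ^+ 2)%:E)%E.
  by apply: eq_integral => x _; rewrite -mulrBr exprMn.
rewrite ge0_integralZ ?sqr_ge0//; last 2 first.
- by apply: measurable_funX; exact: measurable_funB.
- by move=> x; exact: sqr_ge0.
apply: le_trans (lee_wpmul2l _ Hg) _; first by rewrite lee_fin sqr_ge0.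
rewrite -EFinM lee_fin mulrCA -[leRHS]mulr1 ler_wpM2l ?(ltW e0)//.
by rewrite ler_pdivrMr// mul1r lerDl.
Qed.

Lemma approximable_sum n (F : 'I_n -> R -> R) : (forall i, approximable (F i)) ->
  approximable (fun x => \sum_(i < n) F i x).
Proof.
elim: n F => [|n IH] F aF.
  have -> : (fun x => \sum_(i < 0) F i x) = (fun x => 0 * expbump 0 1 0 0 x).
    by apply/funext => x; rewrite big_ord0 mul0r.
  apply: approximableZ; apply: approximable_schwartzR.
  exact: schwartzR_expbump.
have -> : (fun x => \sum_(i < n.+1) F i x) =
    (fun x => \sum_(i < n) F (widen_ord (leqnSn n) i) x + F ord_max x).
  by apply/funext => x; rewrite big_ord_recr.
by apply: approximableD => //; apply: IH => i; exact: aF.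
Qed.

(** Dominated convergence for [(f - F n) ^+ 2], combined with closedness of the class. Every passage
    to the limit in the density proof goes through this. *)
Lemma approximable_dominated (F : nat -> R -> R) f (G : R -> R) :
  (forall n, approximable (F n)) -> measurable_fun setT f ->
  {ae mu, forall x, F n x @[n --> \oo] --> f x} ->
  mu.-integrable setT (EFin \o G) ->
  (forall n x, (f x - F n x) ^+ 2 <= G x) -> approximable f.
Proof.
move=> aF mf Ff iG FG; apply: approximable_closed => // e e0.
have mF n : measurable_fun setT (F n) := proj1 (aF n).
pose h n x := ((f x - F n x) ^+ 2)%:E.
have mh n : measurable_fun setT (h n).
  apply/measurable_EFinP; apply: measurable_funX; exact: measurable_funB.
have hcvg : {ae mu, forall x, setT x -> h n x @[n --> \oo] --> (0 : \bar R)}.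
  have [N [mN N0 HN]] := Ff; exists N; split=> // x /= nh; apply: HN => /= Fx.
  apply: nh => _; apply: cvg_EFin; first exact: nearW.
  rewrite -[X in _ --> X](expr0n _ 2) -[X in X ^+ 2](subrr (f x)).
  apply: (@cvg_comp _ _ _ (fun n => f x - F n x) (fun y : R => y ^+ 2)
    _ (nbhs (f x - f x))).
    by apply: cvgB => //; exact: cvg_cst.
  exact: exprn_continuous.
have hG : {ae mu, forall x n, setT x -> (`|h n x| <= (EFin \o G) x)%E}.
  by apply: aeW => x n _; rewrite /= lee_fin ger0_norm ?sqr_ge0.
have [_ _] := @dominated_convergence _ _ R mu setT measurableT h (cst 0%E)
  (EFin \o G) mh (measurable_cst _) hcvg iG hG.
rewrite integral0 => /fine_cvgP[fin /cvgrPdist_le/(_ _ e0) cv].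
have [n [nfin ncv]] := filter_ex (filterI fin cv).
exists (F n) => //.
have {}nfin : (\int[mu]_x ((f x - F n x) ^+ 2)%:E)%E \is a fin_num := nfin.
have {}ncv : `|0 - fine (\int[mu]_x ((f x - F n x) ^+ 2)%:E)%E| <= e := ncv.
rewrite -(fineK nfin) lee_fin; apply: le_trans ncv.
by rewrite sub0r normrN; exact: ler_norm.
Qed.

Lemma approximable_zero : approximable (fun=> 0).
Proof.
have -> : (fun=> 0) = (fun x => 0 * expbump 0 1 0 0 x) :> (R -> R).
  by apply/funext => x; rewrite mul0r.
apply: approximableZ; apply: approximable_schwartzR.
exact: schwartzR_expbump.
Qed.

(* With [y] the affine function mapping [a, b] to [-1, 1], the functions
   [expR (- y ^+ (2 n + 2))] converge to the indicator outside [a] and [b]. *)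
Lemma approximable_itvoc (a b : R) : approximable (\1_`]a, b]).
Proof.
have [ba|ab] := leP b a.
  rewrite set_itv_ge; last by rewrite -leNgt bnd_simp.
  rewrite indic0; exact: approximable_zero.
pose c := (a + b) / 2; pose s := 2 / (b - a).
have ba0 : 0 < b - a by rewrite subr_gt0.
have s0 : 0 < s by rewrite divr_gt0.
pose y x := (x - c) * s.
have yE x : y x = (2 * x - (a + b)) / (b - a) by rewrite /y /c /s; field; exact: lt0r_neq0.
have ein x : a < x -> x < b -> y x ^+ 2 < 1.
  move=> ax xb; rewrite yE expr_div_n ltr_pdivrMr ?exprn_gt0// mul1r.
  rewrite -subr_gt0 (_ : _ - _ = 4 * ((x - a) * (b - x))); last by ring.
  by rewrite mulr_gt0// mulr_gt0 ?subr_gt0.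
have eout x : x < a \/ b < x -> 1 < y x ^+ 2.
  move=> H; rewrite yE expr_div_n ltr_pdivlMr ?exprn_gt0// mul1r -subr_gt0.
  rewrite (_ : _ - _ = 4 * ((x - a) * (x - b))); last by ring.
  rewrite mulr_gt0//; case: H => h.
    by rewrite nmulr_rgt0 ?subr_lt0// (lt_trans h).
  by rewrite mulr_gt0 ?subr_gt0// (lt_trans ab).
have ewk x : x <= a \/ b <= x -> 1 <= y x ^+ 2.
  move=> H; rewrite yE expr_div_n ler_pdivlMr ?exprn_gt0// mul1r -subr_ge0.
  rewrite (_ : _ - _ = 4 * ((x - a) * (x - b))); last by ring.
  rewrite mulr_ge0//; case: H => h.
    by rewrite mulr_le0 ?subr_le0// (le_trans h)// ltW.
  by rewrite mulr_ge0 ?subr_ge0// (le_trans _ h)// ltW.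
pose F n := expbump c s n 1.
have FE n x : F n x = expR (- (y x ^+ 2) ^+ n.+1).
  by rewrite /F /expbump hornerC mul1r -exprM mul2n.
have F0 n x : 0 <= F n x by rewrite FE expR_ge0.
have F1 n x : F n x <= 1.
  by rewrite FE -[leRHS]expR0 ler_expR oppr_le0 exprn_ge0// sqr_ge0.
have sF n : schwartzR (F n) by apply: schwartzR_expbump; exact: lt0r_neq0.
have mI : measurable_fun setT (\1_`]a, b] : R -> R) by exact: measurable_indic.
have I01 x : 0 <= (\1_`]a, b] x : R) by rewrite indicE ler0n.
(* The squared error is at most 1 on the interval; outside it [y^2 >= 1] makes [F n] decrease in
   [n], so [F n ^+ 2 <= F n <= F 0]. *)
apply: (@approximable_dominated F _ (fun x => \1_`]a, b] x + F 0%N x)) => //.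
- by move=> n; exact: approximable_schwartzR.
- exists ([set a] `|` [set b]); split.
  + exact: measurableU.
  + by rewrite null_set_setU//; exact: lebesgue_measure_set1.
  + move=> x /= H; apply: contrapT => xab; apply: H.
    have [xa xb] : x != a /\ x != b.
      by split; apply/eqP => xE; apply: xab; [left|right].
    have FEx : (fun n => F n x) = (fun n => expR (- (y x ^+ 2) ^+ n.+1)).
      by apply/funext => n; rewrite FE.
    suff : expR (- (y x ^+ 2) ^+ n.+1) @[n --> \oo] --> (\1_`]a, b] x : R).
      by rewrite FEx.
    have [xin|xnin] := boolP (x \in `]a, b]%classic); rewrite indicE.
      have z1 : y x ^+ 2 < 1.
        move: xin; rewrite inE/= in_itv/= => /andP[ax]; rewrite le_eqVlt (negbTE xb)/=.
        exact: ein.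
      rewrite xin -[X in _ --> X]expR0 -oppr0.
      apply: (@cvg_comp _ _ _ (fun n => - (y x ^+ 2) ^+ n.+1) expR _ (nbhs (- 0 : R))).
        apply: cvgN; have := @cvg_expr R (y x ^+ 2).
        rewrite ger0_norm ?sqr_ge0// => /(_ z1) h.
        by rewrite -(cvg_shiftS (fun n => (y x ^+ 2) ^+ n)) in h.
      exact: continuous_expR.
    have z1 : 1 < y x ^+ 2.
      apply: eout; move: xnin; rewrite notin_setE/= in_itv/= => /negP.
      rewrite negb_and -leNgt -ltNge => /orP[|->]; last by right.
      by rewrite le_eqVlt (negbTE xa) => /= ->; left.
    rewrite (negbTE xnin).
    have h : (y x ^+ 2)^-1 ^+ n.+1 @[n --> \oo] --> (0 : R).
      have := @cvg_expr R (y x ^+ 2)^-1.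
      rewrite ger0_norm ?invr_ge0 ?sqr_ge0// invf_lt1 ?(lt_trans ltr01)// => /(_ z1) h.
      by rewrite -(cvg_shiftS (fun n => (y x ^+ 2)^-1 ^+ n)) in h.
    (* [expR (- t) <= t^-1], with [t] a power of [y^2 > 1]. *)
    apply: (@squeeze_cvgr _ _ _ _ (fun=> 0)); last exact: h; last exact: cvg_cst.
    apply: nearW => n; rewrite expR_ge0 /= expRN exprVn lef_pV2 ?posrE ?expR_gt0//.
      by apply: le_trans (expR_ge1Dx _); rewrite lerDr.
    by rewrite exprn_gt0// (lt_trans ltr01).
- have iI := @integrable_indic_itv R a b false false.
  by have := integrableD measurableT iI (integrable_schwartzR (sF 0%N)); apply: eq_integrable.
- move=> n x; rewrite indicE.
  have [xin|xnin] := boolP (x \in `]a, b]%classic) => /=.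
    apply: (@le_trans _ _ 1); last by rewrite lerDl.
    by rewrite expr_le1// ?subr_ge0// lerBlDr lerDl.
  rewrite sub0r sqrrN add0r; apply: (@le_trans _ _ (F n x)).
    by rewrite expr2 ler_piMl.
  rewrite !FE ler_expR lerN2 ler_weXn2l//.
  apply: ewk; move: xnin; rewrite notin_setE/= in_itv/= => /negP.
  rewrite negb_and -leNgt -ltNge => /orP[|/ltW ->]; last by right.
  by move=> ->; left.
Qed.

(** Dynkin's lambda-system argument from the intervals []a, b]], which generate the Borel sets and
    are stable under intersection. Cutting with a fixed bounded interval puts the whole space in the
    class and provides an integrable majorant for increasing unions. *)
Lemma approximable_indic_bounded (A : set R) (N : R) : measurable A ->
  approximable (\1_(A `&` `]- N, N])).
Proof.
move=> mA.
pose J := `]- N, N]%classic : set R.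
pose H := [set A : set R | measurable A /\ approximable (\1_(A `&` J))].
have iJ : mu.-integrable setT (EFin \o (\1_J : R -> R)).
  have := @integrable_indic_itv R (- N) N false false.
  exact.
suff : <<s setT, @ocitv R >> `<=` H by move=> /(_ A mA)[].
apply: (@lambda_system_subset _ (@ocitv R)) => //.
- exact: ocitvI.
- split => //.
  + by split; [exact: measurableT|rewrite setTI; exact: approximable_itvoc].
  + move=> X Y YX [mX aX] [mY aY]; split; first exact: measurableD.
    have -> : \1_((X `\` Y) `&` J) = (fun x => \1_(X `&` J) x + (- 1) * \1_(Y `&` J) x) :> (R -> R).
      apply/funext => x; rewrite !indicE [in LHS]in_setI in_setD 2!in_setI.
      case: (boolP (x \in Y)) => xY; last by rewrite /= andbT mulr0 addr0.
      have xX : x \in X by rewrite inE; apply: YX; exact: set_mem.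
      by rewrite xX/= mulN1r subrr.
    by apply: approximableD => //; exact: approximableZ.
  + move=> F ndF HF; have mF n : measurable (F n) := proj1 (HF n).
    have mU : measurable (\bigcup_n F n) by exact: bigcup_measurable.
    split => //.
    apply: (@approximable_dominated (fun n => \1_(F n `&` J)) _ (\1_J)) => //.
    * by move=> n; exact: (proj2 (HF n)).
    * apply: measurable_indic; apply: measurableI => //; exact: measurable_itv.
    * apply: aeW => x; apply: cvg_near_cst.
      have [[m _ Fmx]|nU] := pselect ((\bigcup_n F n) x).
        exists m => // n /= mn.
        have Fnx : F n x by move: Fmx; apply/subsetPset; exact: ndF.
        rewrite !indicE !in_setI mem_set// (mem_set (A := \bigcup_n F n))//.
        by exists n.
      apply: nearW => n; rewrite !indicE !in_setI (memNset nU) memNset//.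
      by move=> Fnx; apply: nU; exists n.
    * move=> n x; rewrite !indicE !in_setI.
      case: (x \in J); last by rewrite !andbF subrr expr0n.
      rewrite !andbT.
      by case: (x \in _); case: (x \in _); rewrite /= ?subrr ?subr0 ?sub0r ?sqrrN ?expr1n ?expr0n.
- move=> _ [[a b] _ <-] /=; split; first exact: measurable_itv.
  have -> : `]a, b]%classic `&` J = `]Num.max a (- N), Num.min b N]%classic.
    apply/seteqP; split => x; rewrite /J /= !in_itv/= gt_max le_min.
      by move=> [/andP[-> ->] /andP[-> ->]].
    by move=> /andP[/andP[-> ->] /andP[-> ->]].
  exact: approximable_itvoc.
Qed.

Import HBNNSimple.

(** Simple functions increasing to [f] are cut to []-n, n]], so that [approximable_indic_bounded]
    covers their level sets; the squared error stays below [f ^+ 2]. *)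
Lemma approximable_ge0 f : measurable_fun setT f -> (forall x, 0 <= f x) ->
  mu.-integrable setT (EFin \o (fun x => f x ^+ 2)) -> approximable f.
Proof.
move=> mf f0 if2.
have mEf : measurable_fun setT (EFin \o f) by exact/measurable_EFinP.
pose g n : {nnsfun R >-> R} := nnsfun_approx measurableT mEf n.
have Ef0 (x : R) : setT x -> (0 <= (EFin \o f) x)%E by rewrite lee_fin.
have gcvg x : g n x @[n --> \oo] --> f x.
  have := @cvg_nnsfun_approx _ R R setT measurableT _ mEf Ef0 x I.
  by move=> /fine_cvgP[_].
have gle n x : g n x <= f x.
  have := @le_approx _ R R setT (EFin \o f) n x Ef0 I.
  by rewrite /g nnsfun_approxE lee_fin.
have g0 n x : 0 <= g n x by [].
apply: (@approximable_dominated (fun n x => g n x * \1_`]- n%:R, n%:R] x)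
  _ (fun x => f x ^+ 2)) => //.
- move=> n.
  have [k [a [A [mA gE]]]] : exists k (a : 'I_k -> R) (A : 'I_k -> set R),
      (forall i, measurable (A i)) /\ forall x, g n x = \sum_(i < k) a i * \1_(A i) x.
    do 3 eexists; split; last exact: (fimfunEord (g n)).
    by move=> i; exact: measurable_funPTI.
  have -> : (fun x => g n x * \1_`]- n%:R, n%:R] x) =
      (fun x => \sum_(i < k) a i * \1_(A i `&` `]- n%:R, n%:R]) x).
    apply/funext => x; rewrite gE mulr_suml; apply: eq_bigr => i _.
    by rewrite indicI /= mulrA.
  apply: approximable_sum => i; apply: approximableZ.
  exact: approximable_indic_bounded.
- apply: aeW => x; rewrite -[X in _ --> X]mulr1; apply: cvgM; first exact: gcvg.
  apply: cvg_near_cst; near=> n; rewrite indicE mem_set//= in_itv/=.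
  rewrite ltrNl; apply/andP; split.
    by near: n; exact: nbhs_infty_gtr.
  by near: n; exact: nbhs_infty_ger.
- move=> n x.
  have h : 0 <= g n x * \1_`]- n%:R, n%:R] x <= f x.
    rewrite mulr_ge0//=.
    apply: le_trans (gle n x); rewrite ler_piMr// indicE; by case: (_ \in _).
  move/andP: h => [h1 h2].
  by rewrite lerXn2r ?nnegrE ?subr_ge0// lerBlDr lerDl.
Unshelve. all: by end_near. Qed.

Lemma approximable_L2 f : measurable_fun setT f ->
  (\int[mu]_x (f x ^+ 2)%:E < +oo)%E -> approximable f.
Proof.
move=> mf fin.
have if2 : mu.-integrable setT (EFin \o (fun x => f x ^+ 2)).
  apply/integrableP; split; first by apply/measurable_EFinP; exact: measurable_funX.
  by under eq_integral do rewrite /= ger0_norm ?sqr_ge0//.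
pose fp x := Num.max (f x) 0; pose fm x := Num.max (- f x) 0.
have -> : f = (fun x => fp x + (- 1) * fm x).
  apply/funext => x; rewrite /fp /fm mulN1r.
  have [h|h] := leP 0 (f x).
    by rewrite (max_idPr _) ?subr0// oppr_le0.
  by rewrite (max_idPl _) ?oppr_ge0 ?(ltW h)// sub0r opprK.
have mp : measurable_fun setT fp by apply: measurable_maxr => //; exact: measurable_cst.
have mm : measurable_fun setT fm.
  by apply: measurable_maxr; [exact: measurableT_comp|exact: measurable_cst].
have le2 (h : R -> R) : measurable_fun setT h -> (forall x, h x ^+ 2 <= f x ^+ 2) ->
    mu.-integrable setT (EFin \o (fun x => h x ^+ 2)).
  move=> mh hf; apply: le_integrable if2 => //.
    by apply/measurable_EFinP; exact: measurable_funX.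
  by move=> x _ /=; rewrite lee_fin !ger0_norm ?sqr_ge0.
apply: approximableD; last apply: approximableZ.
- apply: approximable_ge0 => //; first by move=> x; rewrite le_max lexx orbT.
  apply: le2 => // x; rewrite /fp; case: (leP (f x) 0) => // _.
  by rewrite expr0n sqr_ge0.
- apply: approximable_ge0 => //; first by move=> x; rewrite le_max lexx orbT.
  apply: le2 => // x; rewrite /fm; case: (leP (- f x) 0) => // _; last by rewrite sqrrN.
  by rewrite expr0n sqr_ge0.
Qed.

Lemma schwartz_dense (f : R -> R[i]) (e : R) : L2 f -> 0 < e ->
  exists2 g : R -> R[i], schwartz g & (sqnorm (fun x => f x - g x)%R <= e%:E)%E.
Proof.
move=> /L2P[mf]; have [m1 m2] := mf; rewrite sqnormE// => fin e0.
have nn (h : R -> R) : (0 <= \int[mu]_x (h x ^+ 2)%:E)%E.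
  by apply: integral_ge0 => x _; rewrite lee_fin sqr_ge0.
have f1 : (\int[mu]_x (Re (f x) ^+ 2)%:E < +oo)%E.
  by apply: le_lt_trans fin; rewrite leeDl.
have f2 : (\int[mu]_x (Im (f x) ^+ 2)%:E < +oo)%E.
  by apply: le_lt_trans fin; rewrite leeDr.
have e20 : 0 < e / 2 by rewrite divr_gt0.
have [_ /(_ _ e20)[g1 s1 H1]] := approximable_L2 m1 f1.
have [_ /(_ _ e20)[g2 s2 H2]] := approximable_L2 m2 f2.
pose g x := Complex (g1 x) (g2 x).
have sg : schwartz g by [].
exists g => //; rewrite sqnormE; last first.
  apply: cmeasurableB => //.
  exact: cintegrable_cmeasurable (cintegrable_schwartz sg).
rewrite [e]splitr EFinD; apply: leeD.
  by under eq_integral do rewrite cReB.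
by under eq_integral do rewrite cImB.
Qed.

End SchwartzDensity.

(** * Continuity of [G f] from continuity of [A] and [B] *)

Section Sufficiency.
Context {R : realType}.
Local Notation mu := (@lebesgue_measure R).
Local Notation Re := complex.Re.
Local Notation Im := complex.Im.
Implicit Types (f g phi : R -> R[i]) (a b : R).

Lemma cos_lipschitz (x y : R) : `|cos x - cos y| <= `|x - y|.
Proof.
wlog xy : x y / y <= x.
  by move=> H; have [|/ltW] := leP y x; [exact: H|rewrite distrC (distrC x); exact: H].
have [//||c _ ->] := @MVT_segment _ cos (fun z : R => - sin z) y x.
  by apply: continuous_subspaceT; exact: continuous_cos.
by rewrite normrM normrN ler_piMl// ler_norml sin_geN1 sin_le1.
Qed.

Lemma sin_lipschitz (x y : R) : `|sin x - sin y| <= `|x - y|.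
Proof.
wlog xy : x y / y <= x.
  by move=> H; have [|/ltW] := leP y x; [exact: H|rewrite distrC (distrC x); exact: H].
have [//||c _ ->] := @MVT_segment _ sin (fun z : R => cos z) y x.
  by apply: continuous_subspaceT; exact: continuous_sin.
by rewrite normrM ler_piMl// ler_norml cos_geN1 cos_le1.
Qed.

Lemma cnorm2_cexpiB_le (x y : R) : cnorm2 (cexpi x - cexpi y) <= 2 * (x - y) ^+ 2.
Proof.
rewrite /cnorm2 cReB cImB /= mulr_natl mulr2n.
have sq (u v : R) : `|u| <= `|v| -> u ^+ 2 <= v ^+ 2.
  move=> h; rewrite -[u ^+ 2]real_normK ?num_real// -[v ^+ 2]real_normK ?num_real//.
  by rewrite lerXn2r ?nnegrE.
by apply: lerD; apply: sq; [exact: cos_lipschitz|exact: sin_lipschitz].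
Qed.

Lemma inv_norm_near (b0 b : R) : b0 != 0 -> `|b - b0| <= `|b0| / 2 ->
  b != 0 /\ `|b|^-1 <= 2 / `|b0|.
Proof.
move=> b00 h; have n0 : 0 < `|b0| by rewrite normr_gt0.
have hb : `|b0| / 2 <= `|b|.
  have := ler_normB b (b - b0); rewrite opprB addrC subrK => h2; lra.
have nb : 0 < `|b| by apply: lt_le_trans hb; rewrite divr_gt0.
split; first by rewrite -normr_gt0.
rewrite -[2 / _]invrK lef_pV2 ?posrE ?invr_gt0 ?divr_gt0//.
by rewrite invf_div.
Qed.

(** [f] is approximated by a Schwartz [psi], for which the dependence on [b] is quadratic; dilations
    near [b0] magnify the squared approximation error by at most [2 / |b0|]. *)
Lemma dilate_L2_continuous f b0 : ccontinuous f -> L2 f -> b0 != 0 ->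
  forall e : R, 0 < e -> exists2 d : R, 0 < d & forall b, `|b - b0| < d ->
  (sqnorm (fun u => f (b * u) - f (b0 * u))%R <= e%:E)%E.
Proof.
move=> cf f2 b00 e e0; have n0 : 0 < `|b0| by rewrite normr_gt0.
(* Multiplied by [2 / |b0|] this becomes [e / 16]; three errors of that size enter with factors 2, 4
   and 4. *)
have eta0 : 0 < e * `|b0| / 32 by rewrite divr_gt0// mulr_gt0.
have [psi spsi Hpsi] := schwartz_dense f2 eta0.
have [K K0 HK] := sqnorm_schwartz_dilate_le spsi b00.
have d10 : 0 < e / (16 * (K + 1)) by rewrite divr_gt0// mulr_gt0// ltr_wpDl.
(* The bound 1 gives [(b - b0)^2 <= |b - b0|]; [K + 1] keeps the denominator positive. *)
exists (Num.min (`|b0| / 2) (Num.min 1 (e / (16 * (K + 1))))).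
  by rewrite !lt_min ltr01 d10 divr_gt0.
move=> b; rewrite !lt_min => /and3P[h1 h2 h3].
have [bn0 binv] := inv_norm_near b00 (ltW h1).
have mf := ccontinuous_cmeasurable cf.
have cpsi : ccontinuous psi.
  by case: spsi => s1 s2; split; exact: continuous_schwartzR0.
have cB : ccontinuous (fun x => f x - psi x).
  case: cf => c1 c2; case: cpsi => c3 c4; split => x.
    by under eq_fun do rewrite cReB; apply: cvgB; [exact: c1|exact: c3].
  by under eq_fun do rewrite cImB; apply: cvgB; [exact: c2|exact: c4].
have md c g : ccontinuous g -> cmeasurable (fun u => g (c * u)).
  by move=> cg; apply: ccontinuous_cmeasurable; exact: ccontinuous_dilate.
have E1 c : c != 0 -> `|c|^-1 <= 2 / `|b0| ->
    (sqnorm (fun u => f (c * u) - psi (c * u))%R <= (e / 16)%:E)%E.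
  move=> c0 hc; rewrite (sqnorm_dilate c0 cB).
  apply: (@le_trans _ _ ((2 / `|b0|)%:E * (e * `|b0| / 32)%:E)%E).
    by apply: lee_pmul => //; rewrite ?lee_fin ?invr_ge0// sqnorm_ge0.
  rewrite -EFinM lee_fin (_ : 2 / `|b0| * (e * `|b0| / 32) = e / 16)//.
  by field; exact: lt0r_neq0.
have ib0 : `|b0|^-1 <= 2 / `|b0| by rewrite ler_pdivlMr// mulVf ?gt_eqF// ler1n.
apply: le_trans (sqnorm_trans (md b f cf) (md b psi cpsi) (md b0 f cf)) _.
have E2 := sqnorm_trans (md b psi cpsi) (md b0 psi cpsi) (md b0 f cf).
apply: (@le_trans _ _ (2%:E * (e / 16)%:E + 2%:E * (2%:E * (e / 16)%:E + 2%:E * (e / 16)%:E))%E).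
  apply: leeD; apply: lee_wpmul2l; rewrite ?lee_fin//; first exact: E1.
  apply: le_trans E2 _; apply: leeD; apply: lee_wpmul2l; rewrite ?lee_fin//.
    apply: le_trans (HK b (ltW h1)) _; rewrite lee_fin.
    have d2 : (b - b0) ^+ 2 <= e / (16 * (K + 1)).
      rewrite -[leLHS]real_normK ?num_real// expr2.
      apply: le_trans (ler_wpM2l (normr_ge0 _) (ltW h2)) _.
      by rewrite mulr1 ltW.
    apply: le_trans (ler_wpM2l K0 d2) _.
    rewrite mulrA ler_pdivrMr; last by rewrite mulr_gt0// ltr_wpDl.
    by nra.
  by rewrite sqnorm_sym; exact: E1.
rewrite -?EFinM -?EFinD -?EFinM -?EFinD lee_fin; lra.
Qed.

Lemma L2_Gop a b f : b != 0 -> schwartz f -> L2 (Gop a b f).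
Proof.
move=> b0 sf; have af := admissible_schwartz sf; apply/L2P; split.
  exact/ccontinuous_cmeasurable/ccontinuous_Gop.
have /L2P[_ fin] := L2_schwartz sf.
apply: le_lt_trans (sqnorm_Gop_le a b0 af) _.
by apply: lte_mul_pinfty => //; rewrite lee_fin mulr_ge0 ?invr_ge0// Gop_cst_ge0.
Qed.

Lemma sqnorm_GopB_le a b f g : b != 0 -> schwartz f -> schwartz g ->
  (sqnorm (fun u => Gop a b f u - Gop a b g u)%R <=
   (`|b|^-1 * Gop_cst)%:E * sqnorm (fun x => f x - g x)%R)%E.
Proof.
move=> b0 sf sg; have af := admissible_schwartz sf; have ag := admissible_schwartz sg.
apply: le_trans (sqnorm_Gop_le a b0 (admissibleB af ag)).
by rewrite (@eq_sqnorm _ _ (Gop a b (fun x => f x - g x)))// => u; rewrite GopB.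
Qed.

(** The parameters move one at a time, through [Gop a0 b]: first from [a] to [a0] at a fixed
    dilation, where the chirp difference is controlled by [|a - a0| xi^2], then from [b] to [b0],
    where the dilated function [H] is fixed. Passing through [Gop a b0] would dilate a function that
    depends on [a]. *)
Lemma Gop_schwartz_continuous phi a0 b0 : schwartz phi -> b0 != 0 ->
  forall e : R, 0 < e -> exists2 d : R, 0 < d & forall a b,
  `|a - a0| < d -> `|b - b0| < d ->
  (sqnorm (fun u => Gop a b phi u - Gop a0 b0 phi u)%R <= e%:E)%E.
Proof.
move=> sphi b00 e e0; have n0 : 0 < `|b0| by rewrite normr_gt0.
have aphi := admissible_schwartz sphi; have [phi1 phi2] := aphi.
pose F := fourier phi.
have mF : cmeasurable F by exact: cintegrable_cmeasurable.
pose H := cft (chirp a0 F).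
have cH : ccontinuous H by exact/ccontinuous_cft/cintegrable_chirp.
have H2 : L2 H.
  apply/L2P; split; first exact: ccontinuous_cmeasurable.
  apply: le_lt_trans (sqnorm_cft_le (cintegrable_chirp a0 phi2)) _.
  rewrite sqnorm_chirp; apply: lte_mul_pinfty; rewrite ?lee_fin ?plancherel_cst_ge0//.
  apply: le_lt_trans (sqnorm_fourier_le phi1) _.
  have /L2P[_ fin] := L2_schwartz sphi.
  apply: lte_mul_pinfty => //; rewrite lee_fin mulr_ge0 ?plancherel_cst_ge0//.
  by rewrite invr_ge0 mulr_ge0// pi_ge0.
have e40 : 0 < e / 4 by rewrite divr_gt0.
have [d1 d10 Hd1] := dilate_L2_continuous cH H2 b00 e40.
pose S := fine (sqnorm (fun xi => Complex (xi ^+ 2) 0 * F xi)).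
have SE : sqnorm (fun xi => Complex (xi ^+ 2) 0 * F xi) = S%:E.
  by rewrite fineK// ge0_fin_numE ?sqnorm_ge0//; exact: sqnorm_sqrM_fourier_lty.
have S0 : 0 <= S by rewrite fine_ge0// sqnorm_ge0.
(* The coefficient of [(a - a0)^2] in the bound for the move from [a] to [a0]: dilation, transform,
   and the factor 2 of [cnorm2_cexpiB_le]. *)
pose T := 2 / `|b0| * (plancherel_cst * (2 * S)).
have T0 : 0 <= T.
  by rewrite /T mulr_ge0 ?divr_ge0// mulr_ge0 ?plancherel_cst_ge0// mulr_ge0.
have d20 : 0 < e / (4 * (T + 1)) by rewrite divr_gt0// mulr_gt0// ltr_wpDl.
exists (Num.min (`|b0| / 2) (Num.min 1 (Num.min d1 (e / (4 * (T + 1)))))).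
  by rewrite !lt_min ltr01 d10 d20 divr_gt0.
move=> a b; rewrite !lt_min => /and4P[_ ha1 _ ha2] /and4P[hb1 _ hb2 _].
have [bn0 binv] := inv_norm_near b00 (ltW hb1).
have mG c d : cmeasurable (Gop c d phi).
  by apply: ccontinuous_cmeasurable; exact: ccontinuous_Gop.
apply: le_trans (sqnorm_trans (mG a b) (mG a0 b) (mG a0 b0)) _.
apply: (@le_trans _ _ (2%:E * (e / 4)%:E + 2%:E * (e / 4)%:E)%E); last first.
  by rewrite -!EFinM -EFinD lee_fin; lra.
apply: leeD; apply: lee_wpmul2l; rewrite ?lee_fin//; last first.
  apply: le_trans (Hd1 b hb2).
  rewrite le_eqVlt; apply/orP; left; apply/eqP; apply: eq_sqnorm => u.
  by rewrite !GopE.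
have ica c := cintegrable_chirp c phi2.
have cD := ccontinuous_cft (cintegrableB (ica a) (ica a0)).
rewrite (@eq_sqnorm _ _
  (fun u => cft (fun xi => chirp a F xi - chirp a0 F xi) (b * u))); last first.
  by move=> u; rewrite !GopE -cftB.
rewrite (sqnorm_dilate bn0 cD).
apply: (@le_trans _ _ ((2 / `|b0|)%:E * (plancherel_cst * (2 * (a - a0) ^+ 2 * S))%:E)%E).
  apply: lee_pmul; rewrite ?lee_fin ?invr_ge0// ?sqnorm_ge0//.
  apply: le_trans (sqnorm_cft_le (cintegrableB (ica a) (ica a0))) _.
  rewrite [X in (_ <= X)%E]EFinM.
  apply: lee_wpmul2l; first by rewrite lee_fin plancherel_cst_ge0.
  rewrite [X in (_ <= X)%E]EFinM -SE /sqnorm -ge0_integralZ; last 3 first.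
  - by rewrite mulr_ge0// sqr_ge0.
  - by apply: measurable_cnorm2; apply: cmeasurableM => //; split => //=.
  - by move=> x; exact: cnorm2_ge0.
  apply: ge0_integral_le.
  - apply: measurable_cnorm2; apply: cmeasurableB; apply: cintegrable_cmeasurable; exact: ica.
  - apply: measurable_funM => //; apply: measurable_cnorm2; apply: cmeasurableM => //.
    by split => //=.
  - by move=> x; exact: cnorm2_ge0.
  - move=> x; rewrite /chirp -mulrBr !cnorm2M mulrC mulrA.
    apply: ler_wpM2r; first by rewrite mulr_ge0// cnorm2_ge0.
    apply: le_trans (cnorm2_cexpiB_le _ _) _.
    rewrite -mulrBl exprMn /cnorm2/= expr0n addr0 -exprM mulrA.
    by [].
rewrite -EFinM lee_fin.
have -> : 2 / `|b0| * (plancherel_cst * (2 * (a - a0) ^+ 2 * S)) = T * (a - a0) ^+ 2.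
  by rewrite /T; ring.
have d2 : (a - a0) ^+ 2 <= e / (4 * (T + 1)).
  rewrite -[leLHS]real_normK ?num_real// expr2.
  apply: le_trans (ler_wpM2l (normr_ge0 _) (ltW ha1)) _.
  by rewrite mulr1 ltW.
apply: le_trans (ler_wpM2l T0 d2) _.
rewrite mulrA ler_pdivrMr; last by rewrite mulr_gt0// ltr_wpDl.
by nra.
Qed.

(** Boundedness of [Gop a b] on differences of Schwartz functions gives the convergence. This
    supplies the family [Gf] for the Gaussians of the converse. *)
Lemma isG_schwartz a b phi : b != 0 -> schwartz phi -> isG a b phi (Gop a b phi).
Proof.
move=> b0 sphi; split; first exact: L2_Gop.
move=> fn sfn cvgfn.
pose c := `|b|^-1 * Gop_cst : R.
have c0 : 0 <= c by rewrite mulr_ge0 ?invr_ge0// Gop_cst_ge0.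
have le n : L2dist (Gop a b (fn n)) (Gop a b phi) <= Num.sqrt c * L2dist (fn n) phi.
  apply: L2dist_le; first by rewrite mulr_ge0 ?sqrtr_ge0.
  apply: le_trans (sqnorm_GopB_le a b0 (sfn n) sphi) _.
  rewrite [(_ * L2dist _ _) ^+ 2]exprMn sqr_sqrtr// [X in (_ <= X)%E]EFinM -/c.
  apply: lee_wpmul2l; first by rewrite lee_fin.
  apply: L2dist_sqnorm_le => //; apply: sqnormB_lty; exact: L2_schwartz.
apply: (@squeeze_cvgr _ _ _ _ (fun=> 0) (fun n => Num.sqrt c * L2dist (fn n) phi)).
- by apply: nearW => n; rewrite le andbT sqrtr_ge0.
- exact: cvg_cst.
- rewrite -[X in _ --> X](mulr0 (Num.sqrt c)).
  by apply: cvgM => //; exact: cvg_cst.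
Qed.

(** [isG] speaks only of sequences, so a Schwartz sequence tending to [f] is built by density, and
    one late term [fn n] is the intermediary. The square norm of [fn n - phi] is at most [4 e];
    [Gop] multiplies this by [|b|^-1 * Gop_cst] and the outer triangle inequality by 2, whence the
    8. *)
Lemma isG_sqnorm_le a b f g phi (e : R) : b != 0 -> L2 f -> isG a b f g ->
  schwartz phi -> 0 < e -> (sqnorm (fun x => f x - phi x)%R <= e%:E)%E ->
  (sqnorm (fun u => g u - Gop a b phi u)%R <= ((2 + 8 * (`|b|^-1 * Gop_cst)) * e)%:E)%E.
Proof.
move=> b0 f2 [g2 Hg] sphi e0 he.
have /choice[fn Hfn] : forall n : nat, exists psi : R -> R[i], schwartz psi /\
    (sqnorm (fun x => f x - psi x)%R <= (n.+1%:R^-1 ^+ 2)%:E)%E.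
  move=> n; have [|psi s h] := @schwartz_dense R f (n.+1%:R^-1 ^+ 2) f2.
    by rewrite exprn_gt0// invr_gt0.
  by exists psi.
have sfn n : schwartz (fn n) := proj1 (Hfn n).
have dfn n : L2dist (fn n) f <= n.+1%:R^-1.
  apply: L2dist_le; first by rewrite invr_ge0.
  by rewrite sqnorm_sym; exact: (proj2 (Hfn n)).
have cfn : L2dist (fn n) f @[n --> \oo] --> 0.
  apply: (@squeeze_cvgr _ _ _ _ (fun=> 0) (fun n => n.+1%:R^-1 : R)).
  - by apply: nearW => n; rewrite dfn andbT sqrtr_ge0.
  - exact: cvg_cst.
  - exact: cvg_harmonic.
(* A distance at most [t] gives a square norm at most [t^2 <= e], whether [e] is above or below
   1. *)
pose t := Num.min 1 e.
have t0 : 0 < t by rewrite lt_min ltr01.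
have t2 : t ^+ 2 <= e.
  rewrite expr2; apply: (@le_trans _ _ (1 * t)).
    by apply: ler_wpM2r; rewrite ?(ltW t0)// ge_min lexx.
  by rewrite mul1r ge_min lexx orbT.
have /cvgrPdist_le/(_ _ t0) h1 := Hg fn sfn cfn.
have /cvgrPdist_le/(_ _ t0) h2 := @cvg_harmonic R.
have [n [n1 n2]] := filter_ex (filterI h1 h2).
have Ln : (sqnorm (fun u => g u - Gop a b (fn n) u)%R <= e%:E)%E.
  rewrite sqnorm_sym; apply: (@le_trans _ _ (t ^+ 2)%:E); last by rewrite lee_fin.
  apply: L2dist_sqnorm_le.
    by apply: sqnormB_lty => //; exact: L2_Gop.
  by apply: le_trans n1; rewrite sub0r normrN ler_norm.
have Fn : (sqnorm (fun x => fn n x - f x)%R <= e%:E)%E.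
  rewrite sqnorm_sym; apply: le_trans (proj2 (Hfn n)) _; rewrite lee_fin.
  apply: le_trans t2; rewrite lerXn2r ?nnegrE ?invr_ge0 ?(ltW t0)//.
  by apply: le_trans n2; rewrite /= sub0r normrN ler_norm.
have /L2P[mg _] := g2; have /L2P[mf _] := f2.
have /L2P[mphi _] := L2_schwartz sphi.
have /L2P[mfn _] := L2_schwartz (sfn n).
have /L2P[mGn _] := L2_Gop a b0 (sfn n).
have /L2P[mGp _] := L2_Gop a b0 sphi.
have c0 : 0 <= `|b|^-1 * Gop_cst by rewrite mulr_ge0 ?invr_ge0// Gop_cst_ge0.
apply: le_trans (sqnorm_trans mg mGn mGp) _.
apply: (@le_trans _ _ (2%:E * e%:E +
    2%:E * ((`|b|^-1 * Gop_cst)%:E * (2%:E * e%:E + 2%:E * e%:E)))%E).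
  apply: leeD; apply: lee_wpmul2l; rewrite ?lee_fin//.
  apply: le_trans (sqnorm_GopB_le a b0 (sfn n) sphi) _.
  apply: lee_wpmul2l; first by rewrite lee_fin.
  apply: le_trans (sqnorm_trans mfn mf mphi) _.
  by apply: leeD; apply: lee_wpmul2l; rewrite ?lee_fin.
by rewrite -?EFinM -?EFinD -?EFinM -?EFinD lee_fin; nra.
Qed.

Lemma G_continuous (I : interval R) (a0 : R) (A B : R -> R) : a0 \in I ->
  (forall a, a \in I -> B a != 0) ->
  A x @[x --> within [set` I] (nbhs a0)] --> A a0 ->
  B x @[x --> within [set` I] (nbhs a0)] --> B a0 ->
  forall f : R -> R[i], L2 f -> forall Gf : R -> R -> R[i],
    (forall a, a \in I -> isG (A a) (B a) f (Gf a)) ->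
    L2dist (Gf a) (Gf a0) @[a --> within [set` I] (nbhs a0)] --> 0.
Proof.
move=> a0I B0 cA cB f f2 Gf HG; apply/cvgrPdist_le => e e0.
have b00 := B0 _ a0I; have n0 : 0 < `|B a0| by rewrite normr_gt0.
(* The constant of [isG_sqnorm_le] with [|B a|^-1] replaced by [2 / |B a0|], its bound for [B a]
   near [B a0]. *)
pose M := 2 + 8 * (2 / `|B a0| * Gop_cst).
have G0 := @Gop_cst_ge0 R.
have M0 : 0 < M by rewrite ltr_pwDl// mulr_ge0// mulr_ge0// divr_ge0.
(* Yields two errors [e^2 / 12]; with the error [e^2 / 8] of the Schwartz case they use up [e^2]
   exactly, as [2/12 + 4/8 + 4/12 = 1]. *)
have eta0 : 0 < e ^+ 2 / (12 * M) by rewrite divr_gt0 ?exprn_gt0// mulr_gt0.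
have [phi sphi Hphi] := schwartz_dense f2 eta0.
have e80 : 0 < e ^+ 2 / 8 by rewrite divr_gt0// exprn_gt0.
have [d d0 Hd] := Gop_schwartz_continuous (A a0) sphi b00 e80.
have d'0 : 0 < Num.min d (`|B a0| / 2) by rewrite lt_min d0 divr_gt0.
move/cvgrPdist_lt : cA => /(_ _ d0) cA.
move/cvgrPdist_lt : cB => /(_ _ d'0) cB.
have key a : a \in I -> `|B a - B a0| <= `|B a0| / 2 ->
    (sqnorm (fun u => Gf a u - Gop (A a) (B a) phi u)%R <= (e ^+ 2 / 12)%:E)%E.
  move=> aI hB; have [bn0 binv] := inv_norm_near b00 hB.
  apply: le_trans (isG_sqnorm_le bn0 f2 (HG _ aI) sphi eta0 Hphi) _.
  rewrite lee_fin; apply: (@le_trans _ _ (M * (e ^+ 2 / (12 * M)))).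
    apply: ler_wpM2r; first exact: ltW.
    by rewrite lerD2l ler_wpM2l// ler_wpM2r.
  rewrite le_eqVlt; apply/orP; left; apply/eqP; field; exact: lt0r_neq0.
have near_I : \forall a \near within [set` I] (nbhs a0), a \in I.
  by apply: withinT; exact: nbhs_filter.
near=> a.
have aI : a \in I by near: a.
have hA : `|A a - A a0| < d by rewrite distrC; near: a.
have hB : `|B a - B a0| < Num.min d (`|B a0| / 2) by rewrite distrC; near: a.
move: hB; rewrite lt_min => /andP[hB1 hB2].
rewrite sub0r normrN ger0_norm ?sqrtr_ge0//; apply: L2dist_le; first exact: ltW.
have /L2P[mGa _] := proj1 (HG _ aI).
have /L2P[mG0 _] := proj1 (HG _ a0I).
have [bn0 _] := inv_norm_near b00 (ltW hB2).
have /L2P[mPa _] := L2_Gop (A a) bn0 sphi.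
have /L2P[mP0 _] := L2_Gop (A a0) b00 sphi.
apply: le_trans (sqnorm_trans mGa mPa mG0) _.
apply: (@le_trans _ _ (2%:E * (e ^+ 2 / 12)%:E +
    2%:E * (2%:E * (e ^+ 2 / 8)%:E + 2%:E * (e ^+ 2 / 12)%:E))%E).
  apply: leeD; apply: lee_wpmul2l; rewrite ?lee_fin//.
    by apply: key => //; exact: ltW.
  apply: le_trans (sqnorm_trans mPa mP0 mG0) _.
  apply: leeD; apply: lee_wpmul2l; rewrite ?lee_fin//.
    exact: Hd.
  rewrite sqnorm_sym; apply: key => //.
  by rewrite subrr normr0 divr_ge0.
by rewrite -?EFinM -?EFinD -?EFinM -?EFinD lee_fin; lra.
Unshelve. all: by end_near. Qed.

End Sufficiency.

(** * Gaussians and their Fourier transforms *)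

Section GaussianCase.
Context {R : realType}.
Local Notation mu := (@lebesgue_measure R).
Local Notation Re := complex.Re.
Local Notation Im := complex.Im.

Definition gauss (k x : R) : R := expR (- (k * x ^+ 2)).

Lemma gauss_gt0 k x : 0 < gauss k x. Proof. exact: expR_gt0. Qed.

Lemma is_derive_gauss k (x : R) :
  is_derive x 1 (gauss k) (- (2 * k) * (x * gauss k x)).
Proof.
rewrite /gauss; apply: is_derive_eq.
by rewrite /GRing.scale/=; ring.
Qed.

Lemma schwartzR_monom_gauss (j : nat) k : 0 < k ->
  schwartzR (fun x => x ^+ j * gauss k x).
Proof.
move=> k0; have s0 : Num.sqrt k != 0 by rewrite gt_eqF// sqrtr_gt0.
(* [m = 0] makes the exponent 2 and the scale [sqrt k] makes it [k x^2]; the polynomial is divided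
   by [sqrt k ^+ j] to undo the scale. *)
have := @schwartzR_expbump R 0 (Num.sqrt k) 0 ((Num.sqrt k ^+ j)^-1 *: 'X^j) s0.
rewrite (_ : expbump _ _ _ _ = (fun x => x ^+ j * gauss k x))//.
apply/funext => x; rewrite /expbump /gauss subr0 hornerZ hornerXn.
have -> : (x * Num.sqrt k) ^+ 1.*2 = k * x ^+ 2.
  by rewrite -[1.*2]/2%N exprMn sqr_sqrtr ?ltW// mulrC.
by rewrite exprMn mulrCA mulVf ?expf_neq0// mulr1.
Qed.

Lemma schwartzR_gauss k : 0 < k -> schwartzR (gauss k).
Proof.
move=> k0; have := schwartzR_monom_gauss 0 k0.
by rewrite (_ : (fun x => _) = gauss k)//; apply/funext => x; rewrite expr0 mul1r.
Qed.

Lemma schwartzR_xgauss k : 0 < k -> schwartzR (fun x => x * gauss k x).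
Proof. exact: (schwartzR_monom_gauss 1). Qed.

Lemma derive1n_gauss k : derive1n 1 (gauss k) = (fun x => - (2 * k) * (x * gauss k x)).
Proof.
apply/funext => x; rewrite derive1n1 derive1E.
by case: (is_derive_gauss k x).
Qed.

Lemma is_derive_kft (k k' g : R -> R) (v : R) :
  (forall x : R, is_derive x 1 k (k' x)) ->
  (forall x, `|k x| <= 1) -> (forall x, `|k' x| <= 1) ->
  mu.-integrable setT (EFin \o g) ->
  mu.-integrable setT (EFin \o (fun x => x * g x)) ->
  is_derive v 1 (kft k g) (kft k' (fun x => x * g x) v).
Proof.
move=> dk k1 k'1 ig ixg.
have ck := is_derive_continuous dk.
have d1 (w x : R) : is_derive w 1 (fun w : R => g x * k (w * x)) (x * g x * k' (w * x)).
  have dM : is_derive w 1 (fun w : R => w * x) x.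
    by apply: is_derive_eq; rewrite /GRing.scale/=; ring.
  have := @is_derive1_comp R k (fun w : R => w * x) w (k' (w * x)) x (dk _) dM.
  rewrite /comp => dkx; apply: is_derive_eq.
  by rewrite /GRing.scale/=; ring.
have Iv : `]v - 1, v + 1[%classic v.
  by rewrite /= in_itv/=; apply/andP; split; lra.
have i1 (w : R) : `]v - 1, v + 1[%classic w ->
    mu.-integrable setT (EFin \o (fun x => g x * k (w * x))).
  by move=> _; exact: integrable_kft.
have i2 : mu.-integrable setT (EFin \o (fun x => `|x * g x|)) by exact: integrable_norm.
have der (w x : R) : `]v - 1, v + 1[%classic w -> setT x ->
    derivable (fun w : R => g x * k (w * x)) w 1 by case: (d1 w x).
have P1 (w x : R) : partial1of2 (fun w x => g x * k (w * x)) w x = x * g x * k' (w * x).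
  by rewrite partial1of2E; case: (d1 w x).
have ub (w x : R) : `]v - 1, v + 1[%classic w -> setT x ->
    `|partial1of2 (fun w x => g x * k (w * x)) w x| <= `|x * g x|.
  by move=> _ _; rewrite P1 normrM ler_piMr.
have n0 (x : R) : 0 <= `|x * g x| by [].
have D1 := @derivable_under_integral R _ _ mu (fun w x => g x * k (w * x)) setT
  measurableT v (v - 1) (v + 1) Iv i1 der (fun x => `|x * g x|) n0 i2 ub.
have D2 := @differentiation_under_integral R _ _ mu (fun w x => g x * k (w * x)) setT
  measurableT v (v - 1) (v + 1) Iv i1 der (fun x => `|x * g x|) n0 i2 ub.
apply: DeriveDef; first exact: D1.
rewrite -derive1E D2; apply: eq_Rintegral => x _.
exact: P1.
Qed.

Lemma kftZ (k g : R -> R) (c v : R) : continuous k -> (forall x, `|k x| <= 1) ->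
  mu.-integrable setT (EFin \o g) -> kft k (fun x => c * g x) v = c * kft k g v.
Proof.
move=> ck k1 ig; rewrite /kft -RintegralZl//; last exact: integrable_kft.
by apply: eq_Rintegral => x _; rewrite mulrA.
Qed.

(** [gauss (- c)] is an integrating factor: its product with [y] has derivative 0. *)
Lemma gauss_ode (y : R -> R) (c : R) :
  (forall v : R, is_derive v 1 y (- (2 * c) * (v * y v))) ->
  forall v, y v = y 0 * gauss c v.
Proof.
move=> dy v.
have dz (w : R) : is_derive w 1 (fun w => y w * gauss (- c) w) 0.
  have dg := is_derive_gauss (- c) w; have dyw := dy w.
  by apply: is_derive_eq; rewrite /GRing.scale/=; ring.
have zc : y v * gauss (- c) v = y 0 * gauss (- c) 0.
  exact: (@is_derive_0_is_cst R (fun w => y w * gauss (- c) w) v 0 dz).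
have g0 : gauss (- c) 0 = 1 by rewrite /gauss expr0n mulr0 oppr0 expR0.
rewrite g0 mulr1 in zc; rewrite -zc -mulrA /gauss -expRD.
by rewrite mulNr opprK subrr expR0 mulr1.
Qed.

(** With [g = gauss k], differentiation under the integral gives [(kft cos g)' = - kft sin (x g)],
    and integration by parts gives [kft sin (x g) = v / (2 k) * kft cos g]. Together they form the
    equation of [gauss_ode] with [c = (4 k)^-1]; the sine transform solves the same equation with
    value 0 at 0. *)
Lemma kft_gauss k v : 0 < k ->
  [/\ kft cos (gauss k) v = kft cos (gauss k) 0 * gauss (4 * k)^-1 v,
      kft sin (gauss k) v = 0,
      kft cos (fun x => x * gauss k x) v = 0 &
      kft sin (fun x => x * gauss k x) v =
        v / (2 * k) * (kft cos (gauss k) 0 * gauss (4 * k)^-1 v)].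
Proof.
move=> k0; have sg := schwartzR_gauss k0; have sxg := schwartzR_xgauss k0.
have ig := integrable_schwartzR sg; have ixg := integrable_schwartzR sxg.
have cos1 (x : R) : `|cos x| <= 1 by rewrite ler_norml cos_geN1 cos_le1.
have sin1 (x : R) : `|sin x| <= 1 by rewrite ler_norml sin_geN1 sin_le1.
have cc := @continuous_cos R; have cs := @continuous_sin R.
have kn0 : k != 0 by rewrite gt_eqF.
have Ex w : kft sin (fun x => x * gauss k x) w = w / (2 * k) * kft cos (gauss k) w.
  have := kft_sin_derive1 w sg; rewrite derive1n_gauss kftZ// => h.
  apply: (@mulfI _ (- (2 * k))); first by rewrite oppr_eq0 mulf_neq0.
  by rewrite h; field.
have Sx w : kft cos (fun x => x * gauss k x) w = - (w / (2 * k)) * kft sin (gauss k) w.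
  have := kft_cos_derive1 w sg; rewrite derive1n_gauss kftZ// => h.
  apply: (@mulfI _ (- (2 * k))); first by rewrite oppr_eq0 mulf_neq0.
  by rewrite h; field.
have E : forall w, kft cos (gauss k) w = kft cos (gauss k) 0 * gauss (4 * k)^-1 w.
  apply: gauss_ode => w.
  have dc (x : R) : is_derive x 1 cos (- sin x) := is_derive_cos x.
  have sinN1 (x : R) : `|- sin x| <= 1 by rewrite normrN.
  have := @is_derive_kft cos (fun x => - sin x) (gauss k) w dc cos1 sinN1 ig ixg.
  have -> : kft (fun x => - sin x) (fun x => x * gauss k x) w =
      - kft sin (fun x => x * gauss k x) w.
    rewrite -mulN1r -kftZ// /kft; apply: eq_Rintegral => x _.
    by rewrite mulrN mulN1r mulNr.
  rewrite Ex (_ : - _ = - (2 * (4 * k)^-1) * (w * kft cos (gauss k) w))//.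
  by field.
have S : forall w, kft sin (gauss k) w = kft sin (gauss k) 0 * gauss (4 * k)^-1 w.
  apply: gauss_ode => w.
  have ds (x : R) : is_derive x 1 sin (cos x) := is_derive_sin x.
  have := @is_derive_kft sin cos (gauss k) w ds sin1 cos1 ig ixg.
  rewrite Sx (_ : - _ * _ = - (2 * (4 * k)^-1) * (w * kft sin (gauss k) w))//.
  by field.
have S0 w : kft sin (gauss k) w = 0.
  rewrite S (_ : kft sin (gauss k) 0 = 0) ?mul0r// /kft.
  have -> : (fun x => gauss k x * sin (0 * x)) = (fun=> 0).
    by apply/funext => x; rewrite mul0r sin0 mulr0.
  by rewrite /Rintegral integral0.
by split; rewrite ?S0// -?E// ?Sx ?S0 ?mulr0// Ex.
Qed.

Lemma integral_itv_le (g : R -> R) (c d r : R) : c <= d -> 0 <= r ->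
  measurable_fun setT g -> (forall x, 0 <= g x) ->
  (forall x, c <= x <= d -> r <= g x) ->
  ((r * (d - c))%:E <= \int[mu]_x (g x)%:E)%E.
Proof.
move=> cd r0 mg g0 rg.
apply: (@le_trans _ _ (\int[mu]_x (r * \1_`[c, d] x)%:E)%E).
  rewrite (@ge0_integralZ R r (\1_`[c, d]))//.
  rewrite integral_indic//= setIT lebesgue_measure_itv/= lte_fin.
  case: ltP => cd'; first by rewrite EFinM EFinB.
  by rewrite (_ : d = c) ?subrr ?mulr0 ?mule0//; apply/eqP; rewrite eq_le cd cd'.
apply: ge0_integral_le => //.
- by apply: measurable_funM => //; exact: measurable_indic.
- by move=> x; rewrite mulr_ge0.
- move=> x; rewrite indicE; case: (boolP (x \in _)) => [|_]; last by rewrite mulr0.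
  by rewrite inE/= in_itv/= mulr1; exact: rg.
Qed.

Lemma Rintegral_gauss_gt0 k : 0 < k -> 0 < Rintegral mu setT (gauss k).
Proof.
move=> k0; have sg := schwartzR_gauss k0.
rewrite -lte_fin (EFin_Rintegral (integrable_schwartzR sg)).
apply: (@lt_le_trans _ _ (gauss k 1 * (1 - 0))%:E).
  by rewrite subr0 mulr1 lte_fin gauss_gt0.
apply: integral_itv_le => //.
- exact: ltW (gauss_gt0 _ _).
- exact: measurable_schwartzR.
- by move=> x; exact: ltW (gauss_gt0 _ _).
- move=> x /andP[x0 x1]; rewrite ler_expR lerN2 ler_pM2l//.
  by rewrite expr1n expr_le1.
Qed.

Definition cgauss (k x : R) : R[i] := Complex (gauss k x) 0.
Definition cxgauss (k x : R) : R[i] := Complex (x * gauss k x) 0.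

Lemma schwartzR0 : schwartzR (fun=> 0 : R).
Proof.
have -> : (fun=> 0) = (fun x => 0 * gauss 1 x) :> (R -> R).
  by apply/funext => x; rewrite mul0r.
exact/schwartzRZ/schwartzR_gauss.
Qed.

Lemma schwartz_cgauss k : 0 < k -> schwartz (cgauss k).
Proof. by move=> k0; split; [exact: schwartzR_gauss|exact: schwartzR0]. Qed.

Lemma schwartz_cxgauss k : 0 < k -> schwartz (cxgauss k).
Proof. by move=> k0; split; [exact: schwartzR_xgauss|exact: schwartzR0]. Qed.

Lemma kft0 (h : R -> R) v : kft h (fun=> 0) v = 0.
Proof.
rewrite /kft; have -> : (fun x => 0 * h (v * x)) = (fun=> 0).
  by apply/funext => x; rewrite mul0r.
by rewrite /Rintegral integral0.
Qed.

(** Its value is [(2 k)^(-1/2)]; it is carried as a symbol, of which positivity is used. *)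
Definition gauss_cst (k : R) : R :=
  (Num.sqrt (2 * pi))^-1 * kft cos (gauss k) 0.

Lemma gauss_cst_gt0 k : 0 < k -> 0 < gauss_cst k.
Proof.
move=> k0; rewrite /gauss_cst mulr_gt0//.
  by rewrite invr_gt0 sqrtr_gt0 mulr_gt0// pi_gt0.
rewrite /kft (_ : (fun x => _) = gauss k); first exact: Rintegral_gauss_gt0.
by apply/funext => x; rewrite mul0r cos0 mulr1.
Qed.

Lemma fourier_cgauss k xi : 0 < k ->
  fourier (cgauss k) xi = Complex (gauss_cst k * gauss (4 * k)^-1 xi) 0.
Proof.
move=> k0; rewrite fourierE.
have gi := cintegrable_schwartz (schwartz_cgauss k0).
have [E1 E2] := ReIm_cft (- 1 * xi) gi.
have [G1 G2 _ _] := kft_gauss (- 1 * xi) k0.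
apply: complexP; rewrite ?cReM ?cImM E1 E2.
  rewrite [kft cos (fun x => Re _) _]G1 [kft sin (fun x => Im _) _]kft0.
  by rewrite /gauss_cst /gauss/= mulN1r sqrrN; ring.
rewrite [kft sin (fun x => Re _) _]G2 [kft cos (fun x => Im _) _]kft0/=.
by ring.
Qed.

Lemma fourier_cxgauss k xi : 0 < k -> fourier (cxgauss k) xi =
  Complex 0 (- (gauss_cst k / (2 * k)) * (xi * gauss (4 * k)^-1 xi)).
Proof.
move=> k0; rewrite fourierE.
have gi := cintegrable_schwartz (schwartz_cxgauss k0).
have [E1 E2] := ReIm_cft (- 1 * xi) gi.
have [_ _ G1 G2] := kft_gauss (- 1 * xi) k0.
apply: complexP; rewrite ?cReM ?cImM E1 E2.
  rewrite [kft cos (fun x => Re _) _]G1 [kft sin (fun x => Im _) _]kft0/=.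
  by ring.
rewrite [kft sin (fun x => Re _) _]G2 [kft cos (fun x => Im _) _]kft0.
rewrite /gauss_cst /gauss/= mulN1r sqrrN.
by field; rewrite gt_eqF//= gt_eqF// sqrtr_gt0 mulr_gt0// pi_gt0.
Qed.

(** * Images of Gaussians under [G] *)

Section GaussianImage.
Variables (k : R) (k0 : 0 < k).
Let kappa : R := (4 * k)^-1.
Let kappa_gt0 : 0 < kappa. Proof. by rewrite invr_gt0 mulr_gt0. Qed.
Let phase (a b u xi : R) : R := a * xi ^+ 2 + b * u * xi.

Let cphase a b u : continuous (phase a b u).
Proof.
move=> x; apply: cvgD.
  by apply: cvgM; [exact: cvg_cst|exact: exprn_continuous].
by apply: cvgM; [exact: cvg_cst|exact: cvg_id].
Qed.

Let ccos a b u : continuous (fun x => cos (phase a b u x)).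
Proof.
move=> x; apply: (@continuous_comp R R R (phase a b u) cos); first exact: cphase.
exact: continuous_cos.
Qed.

Let csin a b u : continuous (fun x => sin (phase a b u x)).
Proof.
move=> x; apply: (@continuous_comp R R R (phase a b u) sin); first exact: cphase.
exact: continuous_sin.
Qed.

Let icos (g : R -> R) a b u : schwartzR g ->
  mu.-integrable setT (EFin \o (fun x => g x * cos (phase a b u x))).
Proof.
move=> sg; apply: (integrable_bounded_mul (M := 1) (integrable_schwartzR sg)).
  by apply: continuous_measurable_fun; exact: ccos.
by move=> x; rewrite ler_norml cos_geN1 cos_le1.
Qed.

Let isin (g : R -> R) a b u : schwartzR g ->
  mu.-integrable setT (EFin \o (fun x => g x * sin (phase a b u x))).
Proof.
move=> sg; apply: (integrable_bounded_mul (M := 1) (integrable_schwartzR sg)).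
  by apply: continuous_measurable_fun; exact: csin.
by move=> x; rewrite ler_norml sin_geN1 sin_le1.
Qed.

(** [P + i Q] and [W + i V] are the integrals of [e^{i phase}] against [gauss kappa x] and against
    [x * gauss kappa x]. *)
Let P a b u := Rintegral mu setT (fun x => gauss kappa x * cos (phase a b u x)).
Let Q a b u := Rintegral mu setT (fun x => gauss kappa x * sin (phase a b u x)).
Let W a b u := Rintegral mu setT (fun x => x * gauss kappa x * cos (phase a b u x)).
Let V a b u := Rintegral mu setT (fun x => x * gauss kappa x * sin (phase a b u x)).

Let sg := schwartzR_gauss kappa_gt0.
Let sxg := schwartzR_xgauss kappa_gt0.

Lemma Rintegral_lin3 (f1 f2 f3 : R -> R) (c1 c2 c3 : R) :
  mu.-integrable setT (EFin \o f1) -> mu.-integrable setT (EFin \o f2) ->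
  mu.-integrable setT (EFin \o f3) ->
  mu.-integrable setT (EFin \o (fun x => c1 * f1 x + (c2 * f2 x + c3 * f3 x))) /\
  Rintegral mu setT (fun x => c1 * f1 x + (c2 * f2 x + c3 * f3 x)) =
  c1 * Rintegral mu setT f1 + (c2 * Rintegral mu setT f2 + c3 * Rintegral mu setT f3).
Proof.
move=> i1 i2 i3.
have iZ (c : R) (f : R -> R) : mu.-integrable setT (EFin \o f) ->
    mu.-integrable setT (EFin \o (fun x => c * f x)).
  by move=> i; have := integrableZl measurableT c i; apply: eq_integrable.
have iD (f g : R -> R) : mu.-integrable setT (EFin \o f) ->
    mu.-integrable setT (EFin \o g) -> mu.-integrable setT (EFin \o (fun x => f x + g x)).
  by move=> i j; have := integrableD measurableT i j; apply: eq_integrable.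
have j1 := iZ c1 _ i1; have j2 := iZ c2 _ i2; have j3 := iZ c3 _ i3.
have j4 := iD _ _ j2 j3; split; first exact: iD.
by rewrite RintegralD// RintegralD// !RintegralZl.
Qed.

Let Gop_cgauss a b u :
  Gop a b (cgauss k) u = Complex (gauss_cst k * P a b u) (gauss_cst k * Q a b u).
Proof.
rewrite /Gop (_ : (fun xi => _) = (fun xi =>
    Complex (gauss_cst k * (gauss kappa xi * cos (phase a b u xi)))
            (gauss_cst k * (gauss kappa xi * sin (phase a b u xi))))).
  by rewrite /cintegral /= !RintegralZl//; [exact: isin|exact: icos].
apply/funext => xi; rewrite fourier_cgauss//.
by apply: complexP; rewrite ?cReM ?cImM /= mul0r ?subr0 ?addr0 mulrA.
Qed.

(** The transform of [x * gauss k x] is purely imaginary, so the result is [- i] times a multiple of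
    [W + i V], and the two parts change places. *)
Let Gop_cxgauss a b u : Gop a b (cxgauss k) u =
  Complex (gauss_cst k / (2 * k) * V a b u) (- (gauss_cst k / (2 * k)) * W a b u).
Proof.
rewrite /Gop (_ : (fun xi => _) = (fun xi =>
    Complex (gauss_cst k / (2 * k) * (xi * gauss kappa xi * sin (phase a b u xi)))
      (- (gauss_cst k / (2 * k)) * (xi * gauss kappa xi * cos (phase a b u xi))))).
  by rewrite /cintegral /= !RintegralZl//; [exact: (icos _ _ _ sxg)|exact: (isin _ _ _ sxg)].
apply/funext => xi; rewrite fourier_cxgauss//.
by apply: complexP; rewrite ?cReM ?cImM /= -/kappa /phase; ring.
Qed.

(** Real and imaginary parts of [(2 i a - 2 kappa) (W + i V) + i b u (P + i Q) = 0], the vanishing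
    integral of the derivative of [gauss kappa x * e^{i phase}]. *)
Let by_parts a b u :
  - (2 * kappa) * W a b u + (- (2 * a) * V a b u + - (b * u) * Q a b u) = 0 /\
  - (2 * kappa) * V a b u + (2 * a * W a b u + b * u * P a b u) = 0.
Proof.
have dg x := is_derive_gauss kappa x.
have [M HM] := schwartzR_xdecay sg.
have cg := continuous_schwartzR0 sg; have cxg := continuous_schwartzR0 sxg.
split.
  have [int <-] := Rintegral_lin3 (- (2 * kappa)) (- (2 * a)) (- (b * u))
    (icos a b u sxg) (isin a b u sxg) (isin a b u sg).
  apply: (@integral_derive_decay R _ (fun x => gauss kappa x * cos (phase a b u x)) M) => //.
  - by move=> x; apply: is_derive_eq; rewrite /GRing.scale/= /phase; ring.
  - move=> x; apply: cvgD; last apply: cvgD.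
    + apply: cvgM; first exact: cvg_cst.
      by apply: cvgM; [exact: cxg|exact: ccos].
    + apply: cvgM; first exact: cvg_cst.
      by apply: cvgM; [exact: cxg|exact: csin].
    + apply: cvgM; first exact: cvg_cst.
      by apply: cvgM; [exact: cg|exact: csin].
  - move=> x; apply: le_trans (HM x); rewrite mulrA normrM ler_piMr//.
    by rewrite ler_norml cos_geN1 cos_le1.
have [int <-] := Rintegral_lin3 (- (2 * kappa)) (2 * a) (b * u)
  (isin a b u sxg) (icos a b u sxg) (icos a b u sg).
apply: (@integral_derive_decay R _ (fun x => gauss kappa x * sin (phase a b u x)) M) => //.
- by move=> x; apply: is_derive_eq; rewrite /GRing.scale/= /phase; ring.
- move=> x; apply: cvgD; last apply: cvgD.
  + apply: cvgM; first exact: cvg_cst.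
    by apply: cvgM; [exact: cxg|exact: csin].
  + apply: cvgM; first exact: cvg_cst.
    by apply: cvgM; [exact: cxg|exact: ccos].
  + apply: cvgM; first exact: cvg_cst.
    by apply: cvgM; [exact: cg|exact: ccos].
- move=> x; apply: le_trans (HM x); rewrite mulrA normrM ler_piMr//.
  by rewrite ler_norml sin_geN1 sin_le1.
Qed.

(** The identity of [by_parts] multiplied by [- i]; as [4 k kappa = 1], the factor
    [2 k (2 kappa - 2 i a)] is [1 - 4 i k a]. *)
Lemma Gop_gauss_ratio a b u : Complex (b * u) 0 * Gop a b (cgauss k) u =
  Complex 1 (- (4 * k * a)) * Gop a b (cxgauss k) u.
Proof.
have [H1 H2] := by_parts a b u.
have kn0 : k != 0 by rewrite gt_eqF.
have kE : kappa = (4 * k)^-1 by [].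
have E1 : b * u * Q a b u = - (2 * kappa) * W a b u - 2 * a * V a b u.
  by apply/eqP; rewrite -subr_eq0 -oppr_eq0 -[X in _ == X]H1; apply/eqP; ring.
have E2 : b * u * P a b u = 2 * kappa * V a b u - 2 * a * W a b u.
  by apply/eqP; rewrite -subr_eq0 -[X in _ == X]H2; apply/eqP; ring.
rewrite Gop_cgauss Gop_cxgauss; apply: complexP; rewrite ?cReM ?cImM /=.
  transitivity (gauss_cst k * (b * u * P a b u)); first by ring.
  by rewrite E2 kE; field.
transitivity (gauss_cst k * (b * u * Q a b u)); first by ring.
by rewrite E1 kE; field.
Qed.

(** At [u = 0] the phase is [a x^2], and [cos t >= 1 - |t|]: the integral is at least the mass of
    [gauss kappa] minus [|a|] times its second moment, which is [2 k] times the mass. *)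
Lemma Re_Gop_cgauss0_gt0 a b : 2 * k * `|a| < 1 -> 0 < Re (Gop a b (cgauss k) 0).
Proof.
move=> ka; rewrite Gop_cgauss/= mulr_gt0 ?gauss_cst_gt0//.
have s2g := schwartzR_monom_gauss 2 kappa_gt0.
have ig := integrable_schwartzR sg; have i2g := integrable_schwartzR s2g.
have kn0 : k != 0 by rewrite gt_eqF.
(* From the vanishing integral of the derivative of [x * gauss kappa x]; the term with coefficient 0
   is padding for [Rintegral_lin3]. *)
have mom : Rintegral mu setT (fun x => x ^+ 2 * gauss kappa x) =
    2 * k * Rintegral mu setT (gauss kappa).
  have [M HM] := schwartzR_xdecay sxg.
  have [int EI] := Rintegral_lin3 (1 : R) (- (2 * kappa)) (0 : R) ig i2g ig.
  have H : Rintegral mu setT (fun x => 1 * gauss kappa x + (- (2 * kappa) *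
      (x ^+ 2 * gauss kappa x) + 0 * gauss kappa x)) = 0.
    have dg x := is_derive_gauss kappa x.
    apply: (@integral_derive_decay R _ (fun x => x * gauss kappa x) M) => //.
    - by move=> x; apply: is_derive_eq; rewrite /GRing.scale/=; ring.
    - have cg := continuous_schwartzR0 sg; have c2g := continuous_schwartzR0 s2g.
      move=> x; apply: cvgD; last apply: cvgD.
      + by apply: cvgM; [exact: cvg_cst|exact: cg].
      + by apply: cvgM; [exact: cvg_cst|exact: c2g].
      + by apply: cvgM; [exact: cvg_cst|exact: cg].
  have kE : kappa = (4 * k)^-1 by [].
  move: EI; rewrite H mul1r mul0r addr0 => /esym/eqP; rewrite addr_eq0 => /eqP ->.
  by rewrite kE; field.
apply: (@lt_le_trans _ _ ((1 - 2 * k * `|a|) * Rintegral mu setT (gauss kappa))).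
  by rewrite mulr_gt0 ?subr_gt0// Rintegral_gauss_gt0.
have [int EI] := Rintegral_lin3 (1 : R) (- `|a|) (0 : R) ig i2g ig.
have -> : (1 - 2 * k * `|a|) * Rintegral mu setT (gauss kappa) =
    1 * Rintegral mu setT (gauss kappa) + (- `|a| *
      Rintegral mu setT (fun x => x ^+ 2 * gauss kappa x) +
      0 * Rintegral mu setT (gauss kappa)) by rewrite mom; ring.
rewrite -EI; apply: le_Rintegral => //; first exact: icos.
move=> x _.
have -> : 1 * gauss kappa x + (- `|a| * (x ^+ 2 * gauss kappa x) + 0 * gauss kappa x) =
  gauss kappa x * (1 - `|a| * x ^+ 2) by ring.
apply: ler_wpM2l; first exact: ltW (gauss_gt0 _ _).
rewrite /phase mulr0 mul0r addr0.
have := cos_lipschitz (a * x ^+ 2) 0; rewrite cos0 subr0 normrM.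
rewrite (ger0_norm (sqr_ge0 x)) ler_norml => /andP[h _].
by lra.
Qed.

End GaussianImage.

End GaussianCase.

(** * Continuity of [A] and [B] from the images of Gaussians *)

Section Necessity.
Context {R : realType}.
Local Notation mu := (@lebesgue_measure R).
Local Notation Re := complex.Re.
Local Notation Im := complex.Im.

(** [Y0] stands on the left because it is the function known to be nonzero. On the right
    [kap - kap0] occurs again, but multiplied by [Y - Y0], which is small in L2, so that it can be
    absorbed later. *)
Lemma cnorm2_ratioB_le (kap kap0 X X0 Y Y0 : R[i]) (u : R) : u ^+ 2 <= 1 ->
  Complex u 0 * X = kap * Y -> Complex u 0 * X0 = kap0 * Y0 ->
  cnorm2 (kap - kap0) * cnorm2 Y0 <=
  4 * cnorm2 (X - X0) + (4 * cnorm2 kap0 + 2 * cnorm2 (kap - kap0)) * cnorm2 (Y - Y0).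
Proof.
move=> u1 E E0; rewrite -cnorm2M.
have -> : (kap - kap0) * Y0 =
    (Complex u 0 * (X - X0) - kap0 * (Y - Y0)) - (kap - kap0) * (Y - Y0).
  by rewrite mulrBr E E0; ring.
have B (x y : R[i]) : cnorm2 (x - y) <= 2 * cnorm2 x + 2 * cnorm2 y.
  by apply: le_trans (cnorm2D_le _ _) _; rewrite lerD2l /cnorm2; case: y => c d /=; rewrite !sqrrN.
apply: le_trans (B _ _) _.
have := B (Complex u 0 * (X - X0)) (kap0 * (Y - Y0)).
rewrite !cnorm2M; have -> : cnorm2 (Complex u 0) = u ^+ 2 by rewrite /cnorm2/= expr0n addr0.
have := ler_wpM2r (cnorm2_ge0 (X - X0)) u1.
by lra.
Qed.

(** Integrating over [[c, d]], where [Y0] is bounded below, turns L2 closeness of [X] to [X0] and of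
    [Y] to [Y0] into an inequality between numbers. *)
Lemma ratioB_integral_le (kap kap0 : R[i]) (X X0 Y Y0 : R -> R[i]) (c d r x y : R) :
  cmeasurable X -> cmeasurable X0 -> cmeasurable Y -> cmeasurable Y0 ->
  (forall u, Complex u 0 * X u = kap * Y u) ->
  (forall u, Complex u 0 * X0 u = kap0 * Y0 u) ->
  0 <= c -> c <= d -> d <= 1 -> 0 <= r ->
  (forall u, c <= u <= d -> r <= cnorm2 (Y0 u)) ->
  (sqnorm (fun u => X u - X0 u)%R <= x%:E)%E ->
  (sqnorm (fun u => Y u - Y0 u)%R <= y%:E)%E ->
  cnorm2 (kap - kap0) * (r * (d - c)) <=
  4 * x + (4 * cnorm2 kap0 + 2 * cnorm2 (kap - kap0)) * y.
Proof.
move=> mX mX0 mY mY0 E E0 c0 cd d1 r0 hr hx hy.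
set w := cnorm2 (kap - kap0); set K := cnorm2 kap0.
have w0 : 0 <= w by exact: cnorm2_ge0.
have K0 : 0 <= K by exact: cnorm2_ge0.
have s0 : 0 <= 4 * K + 2 * w by lra.
have m1 := measurable_cnorm2 (cmeasurableB mX mX0).
have m2 := measurable_cnorm2 (cmeasurableB mY mY0).
pose g u := 4 * cnorm2 (X u - X0 u) + (4 * K + 2 * w) * cnorm2 (Y u - Y0 u).
have mg1 : measurable_fun setT (fun u => 4 * cnorm2 (X u - X0 u)) by exact: measurable_funM.
have mg2 : measurable_fun setT (fun u => (4 * K + 2 * w) * cnorm2 (Y u - Y0 u)).
  exact: measurable_funM.
have p1 u : 0 <= 4 * cnorm2 (X u - X0 u) by rewrite mulr_ge0// cnorm2_ge0.
have p2 u : 0 <= (4 * K + 2 * w) * cnorm2 (Y u - Y0 u) by rewrite mulr_ge0// cnorm2_ge0.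
rewrite -lee_fin mulrA.
apply: (@le_trans _ _ (\int[mu]_u (g u)%:E)%E).
  apply: integral_itv_le => //; first by rewrite mulr_ge0.
  - exact: measurable_funD.
  - by move=> u; rewrite addr_ge0.
  - move=> u /[dup] /hr hu /andP[cu ud].
    apply: le_trans (cnorm2_ratioB_le _ (E u) (E0 u)); first exact: ler_wpM2l.
    by rewrite expr_le1//; [exact: le_trans ud d1|exact: le_trans c0 cu].
rewrite /g ge0_integral_add// !ge0_integralZ// => [|u|u]; try exact: cnorm2_ge0.
rewrite (_ : (4 * x + (4 * K + 2 * w) * y)%:E =
  (4%:E * x%:E + (4 * K + 2 * w)%:E * y%:E)%E)//.
by apply: leeD; apply: lee_wpmul2l.
Qed.

Lemma G_continuous_coefficients (I : interval R) (a0 : R) (A B : R -> R) : a0 \in I ->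
  (forall a, a \in I -> B a != 0) ->
  (forall f : R -> R[i], L2 f -> forall Gf : R -> R -> R[i],
    (forall a, a \in I -> isG (A a) (B a) f (Gf a)) ->
    L2dist (Gf a) (Gf a0) @[a --> within [set` I] (nbhs a0)] --> 0) ->
  (A x @[x --> within [set` I] (nbhs a0)] --> A a0) /\
  (B x @[x --> within [set` I] (nbhs a0)] --> B a0).
Proof.
move=> a0I B0 H.
have FF : Filter (within [set` I] (nbhs a0)) by exact: within_filter.
have near_I : \forall a \near within [set` I] (nbhs a0), a \in I.
  by apply: withinT; exact: nbhs_filter.
(* Small enough for [2 k |A a0| < 1], so that [X a0] has positive real part at 0. *)
pose k : R := (4 * (1 + `|A a0|))^-1.
have A1 : 0 < 1 + `|A a0| by rewrite ltr_pwDl.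
have k0 : 0 < k by rewrite invr_gt0 mulr_gt0.
have kA : 2 * k * `|A a0| < 1.
  rewrite /k invfM mulrA mulrAC ltr_pdivrMr//; have := normr_ge0 (A a0); lra.
have sg := schwartz_cgauss k0; have sxg := schwartz_cxgauss k0.
have ag := admissible_schwartz sg; have axg := admissible_schwartz sxg.
pose X a := Gop (A a) (B a) (cgauss k); pose Y a := Gop (A a) (B a) (cxgauss k).
have cX a : ccontinuous (X a) by exact: ccontinuous_Gop.
have cY a : ccontinuous (Y a) by exact: ccontinuous_Gop.
have HX : L2dist (X a) (X a0) @[a --> within [set` I] (nbhs a0)] --> 0.
  by apply: (H _ (L2_schwartz sg)) => a aI; exact: isG_schwartz (B0 _ aI) sg.
have HY : L2dist (Y a) (Y a0) @[a --> within [set` I] (nbhs a0)] --> 0.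
  by apply: (H _ (L2_schwartz sxg)) => a aI; exact: isG_schwartz (B0 _ aI) sxg.
(* The real part will yield the continuity of [B], and the imaginary part then that of [A]. *)
pose kap a := Complex (B a)^-1 (- (4 * k * (A a / B a))) : R[i].
have ratio a u : a \in I -> Complex u 0 * X a u = kap a * Y a u.
  move=> aI; have b0 := B0 _ aI.
  have -> : kap a = Complex (B a)^-1 0 * Complex 1 (- (4 * k * A a)).
    by apply: complexP; rewrite ?cReM ?cImM /=; field.
  rewrite -mulrA -Gop_gauss_ratio// mulrA; congr (_ * _).
  by apply: complexP; rewrite ?cReM ?cImM /=; field.
have LX b : b \in I -> L2 (X b) by move=> bI; exact: L2_Gop (B0 _ bI) sg.
have LY b : b \in I -> L2 (Y b) by move=> bI; exact: L2_Gop (B0 _ bI) sxg.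
have p0 : 0 < Re (X a0 0) by exact: Re_Gop_cgauss0_gt0.
clearbody X Y.
have kap_cvg e : 0 < e ->
    \forall a \near within [set` I] (nbhs a0), cnorm2 (kap a - kap a0) <= e.
  move=> e0.
  set K := cnorm2 (kap a0).
  have b00 := B0 _ a0I.
  have K0 : 0 < K.
    rewrite /K /cnorm2/= ltr_pwDl ?sqr_ge0// exprn_even_gt0//=.
    by rewrite invr_eq0.
  set p := Re (X a0 0) in p0.
  have p20 : 0 < p / 2 by rewrite divr_gt0.
  have /cvgrPdist_lt/(_ _ p20)/nbhs_ballP[d1 d10 Hd1] := (cX a0).1 0.
  have {}d10 : 0 < d1 := d10.
  pose d := Num.min 1 (d1 / 2).
  have d0 : 0 < d by rewrite lt_min ltr01 divr_gt0.
  have dle1 : d <= 1 by rewrite ge_min lexx.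
  have dd1 : d < d1.
    by apply: (@le_lt_trans _ _ (d1 / 2)); [rewrite ge_min lexx orbT|lra].
  (* On [[d / 2, d]] one has [|u X| >= (d / 2) (p / 2)], and [u X = kap Y] divides this by [|kap|].
     The interval avoids 0, where [Y a0] vanishes. *)
  pose r := (d / 2) ^+ 2 * (p / 2) ^+ 2 / K.
  have r0 : 0 < r by rewrite divr_gt0// mulr_gt0// exprn_gt0// divr_gt0.
  have hr u : d / 2 <= u <= d -> r <= cnorm2 (Y a0 u).
    move=> /andP[du ud].
    have u0 : 0 <= u by apply: le_trans du; rewrite divr_ge0// ltW.
    have hp : p / 2 <= Re (X a0 u).
      have : `|p - Re (X a0 u)| < p / 2.
        by apply: Hd1; rewrite /ball/= sub0r normrN ger0_norm// (le_lt_trans ud dd1).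
      by rewrite ltr_norml => /andP[_]; move: (Re (X a0 u)) => z; lra.
    rewrite ler_pdivrMr// [leRHS]mulrC -cnorm2M -ratio// cnorm2M.
    apply: ler_pM; rewrite ?sqr_ge0//.
      rewrite /cnorm2/= expr0n addr0 lerXn2r ?nnegrE//.
      by rewrite divr_ge0// ltW.
    apply: ler_wpDr; first exact: sqr_ge0.
    by rewrite lerXn2r ?nnegrE// ?(le_trans (ltW p20) hp)// ltW.
  pose rho := r * (d - d / 2).
  have rho0 : 0 < rho by rewrite mulr_gt0//; lra.
  (* By the first bound the term [2 w s] is at most [rho w / 2] and is absorbed on the left; by the
     second the remaining [4 s (1 + K)] is at most [rho e / 2]. Hence [w <= e]. *)
  pose s := Num.min (rho / 4) (rho * e / (8 * (1 + K))).
  have K10 : 0 < 8 * (1 + K) by lra.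
  have s0 : 0 < s by rewrite lt_min !divr_gt0// mulr_gt0.
  have t0 : 0 < Num.sqrt s by rewrite sqrtr_gt0.
  move/cvgrPdist_le : HX => /(_ _ t0) HX; move/cvgrPdist_le : HY => /(_ _ t0) HY.
  apply: filterS3 near_I HX HY => a aI; rewrite !sub0r !normrN => hdX hdY.
  have dX := le_trans (ler_norm _) hdX; have dY := le_trans (ler_norm _) hdY.
  have mc f : ccontinuous f -> cmeasurable f := @ccontinuous_cmeasurable R f.
  have := @ratioB_integral_le (kap a) (kap a0) (X a) (X a0) (Y a) (Y a0) (d / 2) d r s s
    (mc _ (cX a)) (mc _ (cX a0)) (mc _ (cY a)) (mc _ (cY a0))
    (fun u => ratio a u aI) (fun u => ratio a0 u a0I) _ _ dle1 (ltW r0) hr.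
  rewrite -/rho -/K; set w := cnorm2 _.
  have w0 : 0 <= w by exact: cnorm2_ge0.
  have ss : s = Num.sqrt s ^+ 2 by rewrite sqr_sqrtr// ltW.
  have h1 : s <= rho / 4 by rewrite ge_min lexx.
  have h2 : s * (8 * (1 + K)) <= rho * e.
    by rewrite -ler_pdivlMr// ge_min lexx orbT.
  have h3 := ler_wpM2l w0 h1.
  have hd : d / 2 <= d by lra.
  have hd0 : 0 <= d / 2 by lra.
  have hX : (sqnorm (fun u => X a u - X a0 u)%R <= s%:E)%E.
    by rewrite ss; apply: L2dist_sqnorm_le => //; apply: sqnormB_lty; exact: LX.
  have hY : (sqnorm (fun u => Y a u - Y a0 u)%R <= s%:E)%E.
    by rewrite ss; apply: L2dist_sqnorm_le => //; apply: sqnormB_lty; exact: LY.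
  move=> /(_ hd0 hd hX hY) h.
  rewrite -(ler_pM2l rho0); lra.
have cBV : (B a)^-1 @[a --> within [set` I] (nbhs a0)] --> (B a0)^-1.
  apply/cvgrPdist_le => e e0; have := kap_cvg (e ^+ 2).
  rewrite exprn_gt0// => /(_ isT); apply: filterS => a h.
  rewrite distrC -[leRHS](ger0_norm (ltW e0)) -ler_sqr ?nnegrE// !real_normK ?num_real//.
  by apply: le_trans h; rewrite /cnorm2/= lerDl sqr_ge0.
have cAB : A a / B a @[a --> within [set` I] (nbhs a0)] --> A a0 / B a0.
  apply/cvgrPdist_le => e e0; have e10 : 0 < 4 * k * e by rewrite !mulr_gt0.
  have := kap_cvg ((4 * k * e) ^+ 2).
  rewrite exprn_gt0// => /(_ isT); apply: filterS => a h.
  have k40 : 0 < 4 * k by rewrite mulr_gt0.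
  rewrite -(ler_pM2l k40) -[X in X * `|_|](gtr0_norm k40) -normrM.
  rewrite -[leRHS](ger0_norm (ltW e10)) -ler_sqr ?nnegrE// !real_normK ?num_real//.
  apply: le_trans h; rewrite /cnorm2/= (_ : - (4 * k * (A a / B a)) - _ =
    4 * k * (A a0 / B a0 - A a / B a)); last by ring.
  by rewrite lerDr sqr_ge0.
have cB : B x @[x --> within [set` I] (nbhs a0)] --> B a0.
  rewrite -[B a0]invrK.
  have := @cvgV _ _ _ FF (fun a => (B a)^-1) (B a0)^-1.
  rewrite invr_eq0 => /(_ (B0 _ a0I) cBV).
  by apply: cvg_trans; apply: near_eq_cvg; apply: nearW => a; rewrite /= /unstable.inv_fun invrK.
split => //.
have -> : A a0 = A a0 / B a0 * B a0 by rewrite divfK// B0.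
apply: cvg_trans (cvgM cAB cB); apply: near_eq_cvg.
(* Off [I] the value [B a] may be 0, so the cancellation is available only at points of [I]. *)
by apply: filterS near_I => a aI; rewrite /= divfK// B0.
Qed.

End Necessity.

Theorem theorem3 (R : realType) (I : interval R) (a0 : R) (A B : R -> R) :
  a0 \in I ->
  (forall a, a \in I -> B a != 0) ->
  ((forall f : R -> R[i], L2 f ->
     forall Gf : R -> R -> R[i],
       (forall a, a \in I -> isG (A a) (B a) f (Gf a)) ->
       L2dist (Gf a) (Gf a0) @[a --> within [set` I] (nbhs a0)] --> 0)
   <->
   ((A x @[x --> within [set` I] (nbhs a0)] --> A a0) /\
    (B x @[x --> within [set` I] (nbhs a0)] --> B a0))).
Proof.
move=> a0I B0; split; first exact: G_continuous_coefficients.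
by move=> [cA cB]; exact: G_continuous.
Qed.
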